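(* Let $\mu$ be a measure on $\mathbb{R}^d$. Then $\mu$ is Fourier transformable as a measure if and only if the following hold: (i) $\mu$ is tempered (i.e. $\mu$ is a tempered distribution); (ii) the Fourier transform $\nu$ of $\mu$ as a tempered distribution is a translation bounded measure. Moreover, in this case $\widehat\mu=\nu$.
   Context: $\mathbb{R}^d$ carries Lebesgue measure and $\widehat{\mathbb{R}^d}$ is identified with $\mathbb{R}^d$ via $e^{2\pi i x\cdot y}$; $\check f(y)=\int f(x)e^{2\pi i x\cdot y}\,dx$; $\widetilde f(x)=\overline{f(-x)}$; $f*g$ is convolution; $C_c(\mathbb{R}^d)$ is the space of continuous compactly supported functions. A measure on $\mathbb{R}^d$ is a linear functional $\mu:C_c(\mathbb{R}^d)\to\mathbb{C}$ such that for each compact $K$ there is $C_K$ with $|\mu(f)|\le C_K\|f\|_\infty$ for all $f\in C_c(\mathbb{R}^d)$ supported in $K$ (a complex Radon measure, possibly unbounded); $|\mu|$ is its variation. It is translation bounded if $\sup_{x}|\mu|(x+K)<\infty$ for every compact $K$. A measure $\mu$ is Fourier transformable (as a measure) if there is a measure $\widehat\mu$ on $\mathbb{R}^d$ such that for all $f\in C_c(\mathbb{R}^d)$: $|\check f|^2\in L^1(|\widehat\mu|)$ and $\langle\mu,f*\widetilde f\rangle=\langle\widehat\mu,|\check f|^2\rangle$. A measure $\mu$ is tempered if the functional $\mu|_{C_c^\infty(\mathbb{R}^d)}$ extends to a continuous linear functional on the Schwartz space $\mathcal{S}(\mathbb{R}^d)$. Its Fourier transform as a tempered distribution is the tempered distribution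 $\nu$ with $\langle\mu,g\rangle=\langle\nu,\check g\rangle$ for all $g\in\mathcal{S}(\mathbb{R}^d)$. *)

(* Defs.v *)
From HB Require Import structures.
From mathcomp Require Import all_boot all_order all_algebra.
From mathcomp Require Import complex.
From mathcomp Require Import all_classical all_reals all_analysis.

Set Implicit Arguments.
Unset Strict Implicit.
Unset Printing Implicit Defensive.

Import Order.TTheory GRing.Theory Num.Theory.
Import numFieldNormedType.Exports.

Local Open Scope classical_set_scope.
Local Open Scope ring_scope.
Local Open Scope complex_scope.

Notation cabs := ComplexField.Normc.normc.

Section LebesgueMeasure.
Variable R : realType.
Local Notation T1 := (measurableTypeR R).

Definition tuple_cons n (p : T1 * n.-tuple T1) : n.+1.-tuple T1 :=
  [the n.+1.-tuple T1 of p.1 :: p.2].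

Lemma measurable_tuple_cons n :
  measurable_fun [set: T1 * n.-tuple T1] (@tuple_cons n).
Proof. by apply: measurable_cons => //; exact: measurable_snd. Qed.

Section Step.
Variables (n : nat) (m : {sigma_finite_measure set (n.-tuple T1) -> \bar R}).

Let mu1 : {sigma_finite_measure set T1 -> \bar R} :=
  [the {sigma_finite_measure set T1 -> \bar R} of @lebesgue_measure R].

Definition lebesgue_cons : set (n.+1.-tuple T1) -> \bar R :=
  pushforward (mu1 \x m)%E (@tuple_cons n).

HB.instance Definition _ := Measure.copy lebesgue_cons
  (measure_function_pushforward__canonical__measure_function_Measure
    (mu1 \x m)%E (@measurable_tuple_cons n)).

Let lebesgue_cons_sigma_finite :
  sigma_finite [set: n.+1.-tuple T1] lebesgue_cons.
Proof.
have /sigma_finiteP[F [TF ndF Foo]] := sigma_finiteT mu1.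
have /sigma_finiteP[G [TG ndG Goo]] := sigma_finiteT m.
pose u (t : n.+1.-tuple T1) : T1 * n.-tuple T1 := (thead t, [tuple of behead t]).
have mu_ : measurable_fun [set: n.+1.-tuple T1] u.
  apply/measurable_fun_pairP; split; last exact: measurable_behead.
  exact: measurable_tnth.
have uK : u \o @tuple_cons n = id.
  by apply/funext => -[a t]; congr (_, _); apply: val_inj.
exists (fun k => u @^-1` (F k `*` G k)).
  rewrite -preimage_bigcup (_ : \bigcup_k _ = setT) ?preimage_setT//.
  rewrite -setXTT TF TG predeqE => -[x y]; split.
    by move=> [k _ []/= ? ?]; split; exists k.
  move=> [/= [k _ Fkx] [l _ Gly]]; exists (maxn k l) => //; split.
  - by move: x Fkx; exact/subsetPset/ndF/leq_maxl.
  - by move: y Gly; exact/subsetPset/ndG/leq_maxr.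
move=> k; have [? ?] := Foo k; have [? ?] := Goo k; split.
  by rewrite -[X in measurable X]setTI; apply: mu_ => //; exact: measurableX.
rewrite /lebesgue_cons /pushforward -comp_preimage uK preimage_id.
by rewrite product_measure1E// lte_mul_pinfty// ge0_fin_numE.
Qed.

HB.instance Definition _ := Measure_isSigmaFinite.Build _ _ _
  lebesgue_cons lebesgue_cons_sigma_finite.

End Step.

Fixpoint lebesgue_tuple n : {sigma_finite_measure set (n.-tuple T1) -> \bar R} :=
  if n is k.+1 then [the {sigma_finite_measure set _ -> \bar R} of lebesgue_cons (lebesgue_tuple k)]
  else [the {sigma_finite_measure set _ -> \bar R} of \d_([tuple] : 0.-tuple T1)].

Lemma lebesgue_tuple_box n (A : 'I_n -> set T1) : (forall i, measurable (A i)) ->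
  lebesgue_tuple n [set t | forall i, A i (tnth t i)] = (\prod_(i < n) lebesgue_measure (A i))%E.
Proof.
elim: n A => [A _|n ih A mA].
  by rewrite big_ord0 /= diracE mem_set// => -[].
rewrite big_ord_recl -(ih (fun i => A (lift ord0 i)))//=.
rewrite /lebesgue_cons /pushforward.
rewrite -product_measure1E//; last first.
  rewrite (_ : mkset _ = \bigcap_(i in [set: 'I_n]) ((@tnth n T1)^~ i @^-1` A (lift ord0 i))); last first.
    by apply/seteqP; split => [t H i _|t H i]; exact: H.
  apply: fin_bigcap_measurable => // i _; rewrite -[X in measurable X]setTI.
  exact: measurable_tnth.
congr (product_measure1 _ _ _); apply/seteqP; split => -[a t] /=.
  by move=> H; split => [|i]; [exact: (H ord0)|have := H (lift ord0 i); rewrite tnthS].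
by move=> -[H0 H] i; case: (unliftP ord0 i) => [j|] ->; rewrite ?tnthS.
Qed.

End LebesgueMeasure.

Definition ccont (V : topologicalType) (K : numFieldType) (f : V -> K) : Prop :=
  continuous f /\ compact (closure [set x | f x != 0]).

Section Functions.
Variables (R : realType) (d : nat).
Local Notation V := 'rV[R]_d.
Local Notation C := R[i].
Implicit Types (f g F : V -> C) (K : set V).

(* Coordinatewise identification of d-tuples, which carry Lebesgue measure,
   with row vectors, which carry the topology. *)
Definition row_of (t : d.-tuple (measurableTypeR R)) : V := \row_i tnth t i.

Definition cintegral f : C :=
  (\int[lebesgue_tuple R d]_t complex.Re (f (row_of t)))
    +i* (\int[lebesgue_tuple R d]_t complex.Im (f (row_of t))).

Definition dotv (x y : V) : R := \sum_i x 0 i * y 0 i.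

Definition expi (t : R) : C := cos t +i* sin t.

Definition fcheck f : V -> C :=
  fun y => cintegral (fun x => f x * expi (2 * pi * dotv x y)).

Definition tilde f : V -> C := fun x => (f (- x))^*.

Definition convolution f g : V -> C :=
  fun x => cintegral (fun y => f y * g (x - y)).

Definition supp f : set V := closure [set x | f x != 0].

Definition supnorm f : R := sup (range (fun x => cabs (f x))).

(* Functionals on C_c (and below on the Schwartz space) are represented by
   total functions whose values outside that space are irrelevant: every
   notion below only depends on the values on the space. *)
Definition is_measure (mu : (V -> C) -> C) : Prop :=
  (forall (a : C) f g, ccont f -> ccont g ->
     mu (fun x => a * f x + g x) = a * mu f + mu g) /\
  (forall K, compact K -> exists CK : R, forall f, ccont f -> supp f `<=` K ->
     cabs (mu f) <= CK * supnorm f).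

Definition same_measure (mu nu : (V -> C) -> C) : Prop :=
  forall f, ccont f -> mu f = nu f.

(* The variation |mu| on nonnegative phi in C_c, followed by Bourbaki's upper
   integral of a nonnegative function with respect to |mu|: a supremum over
   minorants in C_c for lower semicontinuous functions, an infimum over lower
   semicontinuous majorants in general. *)
Definition abs_measure (mu : (V -> C) -> C) (phi : V -> R) : \bar R :=
  ereal_sup [set (cabs (mu g))%:E |
    g in [set g | ccont g /\ forall x, cabs (g x) <= phi x]].

Definition upper_integral_lsc (mu : (V -> C) -> C) (h : V -> \bar R) : \bar R :=
  ereal_sup [set abs_measure mu phi |
    phi in [set phi : V -> R | [/\ ccont phi, forall x, 0 <= phi x &
                                  forall x, ((phi x)%:E <= h x)%E]]].

Definition upper_integral (mu : (V -> C) -> C) (h : V -> \bar R) : \bar R :=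
  ereal_inf [set upper_integral_lsc mu k |
    k in [set k : V -> \bar R | lower_semicontinuous k /\
                                forall x, (h x <= k x)%E]].

Definition abs_measure_set (mu : (V -> C) -> C) (A : set V) : \bar R :=
  upper_integral mu (fun x => (\1_A x)%:E).

Definition translation_bounded (mu : (V -> C) -> C) : Prop :=
  forall K, compact K ->
    (ereal_sup [set abs_measure_set mu [set x + k | k in K]%R | x in [set: V]]
       < +oo)%E.

Definition L1_seminorm (mu : (V -> C) -> C) F : \bar R :=
  upper_integral mu (fun x => (cabs (F x))%:E).

(* L^1(|mu|) is the closure of C_c for this seminorm, and <mu, F> is the
   extension of mu to L^1(|mu|) by continuity. *)
Definition L1 (mu : (V -> C) -> C) F : Prop :=
  forall e : R, 0 < e -> exists g, ccont g /\
    (L1_seminorm mu (F \- g)%R < e%:E)%E.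

Definition pairing (mu : (V -> C) -> C) F : C :=
  xget 0 [set z : C | forall e : R, 0 < e -> exists g, [/\ ccont g,
    (L1_seminorm mu (F \- g)%R < e%:E)%E &
    cabs (mu g - z) < e]].

Definition is_fourier_transform (mu muhat : (V -> C) -> C) : Prop :=
  is_measure muhat /\
  forall f, ccont f ->
    let sq := fun y => `|fcheck f y| ^+ 2 in
    L1 muhat sq /\ mu (convolution f (tilde f)) = pairing muhat sq.

Definition fourier_transformable (mu : (V -> C) -> C) : Prop :=
  exists muhat, is_fourier_transform mu muhat.

Definition pderiv (i : 'I_d) f : V -> C := fun x =>
  ('D_(delta_mx 0 i) (fun y => complex.Re (f y)) x)
    +i* ('D_(delta_mx 0 i) (fun y => complex.Im (f y)) x).

(* A list of coordinates encodes an iterated partial derivative or a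
   monomial; the multi-index is given by the multiplicities. *)
Definition pderivs (s : seq 'I_d) f : V -> C := foldr pderiv f s.

Definition monom (s : seq 'I_d) (x : V) : R := \prod_(i <- s) x 0 i.

Definition smooth f : Prop :=
  forall s : seq 'I_d,
    continuous (pderivs s f : V -> (C : numFieldType)) /\
    forall (i : 'I_d) (x : V),
      derivable (fun y => complex.Re (pderivs s f y)) x (delta_mx 0 i) /\
      derivable (fun y => complex.Im (pderivs s f y)) x (delta_mx 0 i).

Definition ccsmooth f : Prop := smooth f /\ ccont f.

Definition schwartz_seminorm (a b : seq 'I_d) f : \bar R :=
  ereal_sup (range (fun x : V => (cabs ((monom a x)%:C * pderivs b f x))%:E)).

Definition schwartz f : Prop :=
  smooth f /\ forall a b, (schwartz_seminorm a b f < +oo)%E.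

(* Continuity is for the topology of the Schwartz space, which is generated
   by the seminorms above. *)
Definition tempered_distribution (T : (V -> C) -> C) : Prop :=
  (forall (a : C) f g, schwartz f -> schwartz g ->
     T (fun x => a * f x + g x) = a * T f + T g) /\
  (forall f, schwartz f -> forall e : R, 0 < e ->
     exists N : nat, exists2 r : R, 0 < r & forall g, schwartz g ->
       (forall a b, (size a <= N)%N -> (size b <= N)%N ->
          (schwartz_seminorm a b (g \- f)%R < r%:E)%E) ->
       cabs (T g - T f) < e).

Definition extends (T mu : (V -> C) -> C) : Prop :=
  forall g, ccsmooth g -> T g = mu g.

Definition tempered (mu : (V -> C) -> C) : Prop :=
  exists T, tempered_distribution T /\ extends T mu.

Definition is_tempered_fourier_transform (mu nu : (V -> C) -> C) : Prop :=
  tempered_distribution nu /\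
  exists T, [/\ tempered_distribution T, extends T mu &
    forall g, schwartz g -> T g = nu (fcheck g)].

(* The distribution nu is the measure m. *)
Definition is_distribution_of (nu m : (V -> C) -> C) : Prop :=
  is_measure m /\ extends nu m.

End Functions.

(* Main.v *)
Require Import Defs.
From mathcomp Require Import all_boot all_order all_algebra complex.
From mathcomp Require Import all_classical all_reals all_analysis.
From mathcomp Require Import measurable_realfun.
From mathcomp Require Import ring lra.

(** A measure [m] is studied through [dominated m h c], that is [|m|(h) <= c]
    for a continuous [h]; on continuous functions this captures the seminorm,
    the space and the pairing of L^1, so all measure theory for the transforms
    becomes estimates of [m] on C_c. Translation boundedness amounts to one
    constant that dominates all translates of a tent. Such a measure is finite on
    the product weight [weight], and more generally on any function with
    summable suprema over lattice cells ([lattice_dominated]); hence it pairs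
    continuously with Schwartz functions and with their transforms.

    If [mu] has a transform [om], then for each [f] in C_c the square of
    [fcheck f] is integrable for [om]. A Baire argument in the space of functions
    carried by a fixed ball makes the integral bounded on the unit ball
    ([fcheck_sq_uniform]); applied to all modulations of one narrow mollifier,
    this bounds [om] on all translates of a tent. So [om] and
    [g |-> om (fcheck g)] are tempered distributions. Polarizing the defining
    identity and letting one factor run through mollifiers gives
    [mu g = om (fcheck g)] for test functions ([transform_ccsmooth]), so these
    are the distribution [mu] and its transform.

    Conversely let the distributional transform be a translation bounded
    measure [m]. For mollified [g] the function [g * tilde g] is a test function
    and the required identity is the definition of the distributional
    transform, since the transform of [g * tilde g] is the square of the modulus
    of [fcheck g]. To pass to a general [f] in C_c one needs
    [|m| (|fcheck f|^2) <= K (sup |f|)^2] with [K] depending only on the support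
    of [f] ([fcheck_sq_dominated]). This comes from a large sieve inequality:
    the sum of [|fcheck f (y_k)|^2] over one point of each lattice cell is at
    most a constant times the integral of [|f|^2], by duality and the decay of
    the transform of a bump that is at least 1 on the support of [f].

    Finally, a transform of [mu] as a measure and one as a distribution agree on
    the functions [fcheck u] with [u] a test function. These are dense among the
    test functions for the Schwartz seminorms ([fcheck_dense], an approximate
    form of Fourier inversion), which in turn are dense in C_c. *)

Set Implicit Arguments.
Unset Strict Implicit.
Unset Printing Implicit Defensive.

Import Order.TTheory GRing.Theory Num.Theory.
Import numFieldNormedType.Exports.

Local Open Scope classical_set_scope.
Local Open Scope ring_scope.
Local Open Scope complex_scope.

(** * Complex numbers *)

Section ComplexNumbers.
Variable R : realType.
Local Notation C := R[i].
Implicit Types z u : C.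

Lemma normE z : `|z| = (cabs z)%:C.
Proof. by case: z. Qed.

Lemma cabs_ge0 z : 0 <= cabs z.
Proof. by case: z => a b; exact: sqrtr_ge0. Qed.

Lemma cabs_eq0 z : cabs z = 0 -> z = 0.
Proof. exact: ComplexField.Normc.eq0_normc. Qed.

Lemma cabs0 : cabs (0 : C) = 0.
Proof. exact: ComplexField.Normc.normc0. Qed.

Lemma cabs1 : cabs (1 : C) = 1.
Proof. exact: ComplexField.Normc.normc1. Qed.

Lemma cabsM z u : cabs (z * u) = cabs z * cabs u.
Proof. exact: ComplexField.Normc.normcM. Qed.

Lemma cabsD z u : cabs (z + u) <= cabs z + cabs u.
Proof. exact: le_normcD. Qed.

Lemma cabsN z : cabs (- z) = cabs z.
Proof. exact: normcN. Qed.

Lemma cabsB z u : cabs (z - u) <= cabs z + cabs u.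
Proof. by rewrite -(cabsN u) cabsD. Qed.

Lemma cabs_distC z u : cabs (z - u) = cabs (u - z).
Proof. by rewrite -cabsN opprB. Qed.

Lemma cabs_dist z u : cabs z - cabs u <= cabs (z - u).
Proof. by rewrite lerBlDr -{1}(subrK u z) cabsD. Qed.

Lemma cabs_tri z u v : cabs (z - v) <= cabs (z - u) + cabs (u - v).
Proof. by rewrite -{1}(subrK u z) -addrA cabsD. Qed.

Lemma cabs_rr (x : R) : cabs x%:C = `|x|.
Proof. by rewrite /= expr0n addr0 sqrtr_sqr. Qed.

Lemma cabs_conj z : cabs z^* = cabs z.
Proof. by case: z => a b /=; rewrite sqrrN. Qed.

Lemma cabs_re z : `|complex.Re z| <= cabs z.
Proof.
case: z => a b /=; rewrite -sqrtr_sqr ler_sqrt ?addr_ge0 ?sqr_ge0//.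
by rewrite lerDl sqr_ge0.
Qed.

Lemma cabs_im z : `|complex.Im z| <= cabs z.
Proof.
case: z => a b /=; rewrite -sqrtr_sqr ler_sqrt ?addr_ge0 ?sqr_ge0//.
by rewrite lerDr sqr_ge0.
Qed.

Lemma cabs_le z : cabs z <= `|complex.Re z| + `|complex.Im z|.
Proof.
case: z => a b /=.
rewrite -[leRHS]ger0_norm ?addr_ge0// -sqrtr_sqr ler_sqrt ?sqr_ge0//.
rewrite sqrrD !real_normK ?num_real// -addrA lerD2l lerDr.
by rewrite mulrn_wge0// mulr_ge0.
Qed.

Lemma cReD z u : complex.Re (z + u) = complex.Re z + complex.Re u.
Proof. by case: z u => a b [c e]. Qed.

Lemma cImD z u : complex.Im (z + u) = complex.Im z + complex.Im u.
Proof. by case: z u => a b [c e]. Qed.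

Lemma cReN z : complex.Re (- z) = - complex.Re z.
Proof. by case: z. Qed.

Lemma cImN z : complex.Im (- z) = - complex.Im z.
Proof. by case: z. Qed.

Lemma cReM z u : complex.Re (z * u) =
  complex.Re z * complex.Re u - complex.Im z * complex.Im u.
Proof. by case: z u => a b [c e]. Qed.

Lemma cImM z u : complex.Im (z * u) =
  complex.Re z * complex.Im u + complex.Im z * complex.Re u.
Proof. by case: z u => a b [c e]. Qed.

Lemma complex_eq z u : complex.Re z = complex.Re u ->
  complex.Im z = complex.Im u -> z = u.
Proof. by case: z u => a b [c e] /= -> ->. Qed.

Lemma cabs_sqr z : (cabs z ^+ 2)%:C = z * z^*%C.
Proof.
case: z => a b /=; rewrite sqr_sqrtr ?addr_ge0 ?sqr_ge0//.
by apply: complex_eq => /=; ring.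
Qed.

Lemma cabs_expi (t : R) : cabs (expi t) = 1.
Proof. by rewrite /= cos2Dsin2 sqrtr1. Qed.

Lemma expiD (s t : R) : expi (s + t) = expi s * expi t.
Proof. by apply: complex_eq => /=; rewrite ?cosD ?sinD// addrC. Qed.

Lemma expi0 : expi (0 : R) = 1.
Proof. by rewrite /expi cos0 sin0. Qed.

Lemma expiN (t : R) : expi (- t) = (expi t)^*.
Proof. by rewrite /expi cosN sinN. Qed.

(** A unimodular factor turning [z] into its modulus. *)
Lemma phase z : exists2 u, cabs u = 1 & u * z = (cabs z)%:C.
Proof.
have [->|z0] := eqVneq z 0; first by exists 1; rewrite ?cabs1// mulr0 cabs0.
have c0 : cabs z != 0 by apply: contra_neq z0; exact: cabs_eq0.
exists ((cabs z)^-1%:C * z^*%C).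
  by rewrite cabsM cabs_rr cabs_conj ger0_norm ?invr_ge0 ?cabs_ge0// mulVf.
by rewrite -mulrA (mulrC _ z) -cabs_sqr -rmorphM/= expr2 mulrA mulVf// mul1r.
Qed.

End ComplexNumbers.

(** * Continuous functions with values in the complex numbers *)

Section Continuity.
Variable R : realType.
Local Notation C := R[i].

Section General.
Variable V : normedModType R.
Implicit Types f g : V -> C.

Lemma ccP f : continuous (f : V -> (C : numFieldType)) <->
  forall x (e : R), 0 < e -> exists2 r : R, 0 < r &
    forall y, `|y - x| < r -> cabs (f y - f x) < e.
Proof.
split=> [cf x e e0|cf x].
  have /cvgrPdist_lt /(_ e%:C) := cf x.
  rewrite ltcR => /(_ e0) /nbhs_ballP[r r0 H]; exists r => // y yx.
  have := H y; rewrite -ball_normE /= distrC => /(_ yx).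
  by rewrite normE ltcR cabs_distC.
apply/cvgrPdist_lt => e e0.
have eE : e = (complex.Re e)%:C.
  by move: e0; case: (e) => a b; rewrite ltcE/= => /andP[/eqP -> _].
have e0' : 0 < complex.Re e by move: e0; rewrite ltcE => /andP[].
have [r r0 H] := cf x _ e0'.
apply/nbhs_ballP; exists r => //= y; rewrite -ball_normE/= distrC => /H.
by rewrite normE eE ltcR cabs_distC.
Qed.

Lemma crP (u : V -> R) : continuous u <->
  forall x (e : R), 0 < e -> exists2 r : R, 0 < r &
    forall y, `|y - x| < r -> `|u y - u x| < e.
Proof.
split=> [cf x e e0|cf x].
  have /cvgrPdist_lt /(_ e e0) /nbhs_ballP[r r0 H] := cf x.
  exists r => // y yx.
  have := H y; rewrite -ball_normE /= distrC => /(_ yx).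
  by rewrite distrC.
apply/cvgrPdist_lt => e e0; have [r r0 H] := cf x _ e0.
apply/nbhs_ballP; exists r => //= y; rewrite -ball_normE/= distrC => /H.
by rewrite distrC.
Qed.

Lemma cc_re f : continuous (f : V -> (C : numFieldType)) ->
  continuous (fun x => complex.Re (f x)).
Proof.
move=> /ccP cf; apply/crP => x e /(cf x)[r r0 H]; exists r => // y /H.
by apply: le_lt_trans; rewrite -cReN -cReD; exact: cabs_re.
Qed.

Lemma cc_im f : continuous (f : V -> (C : numFieldType)) ->
  continuous (fun x => complex.Im (f x)).
Proof.
move=> /ccP cf; apply/crP => x e /(cf x)[r r0 H]; exists r => // y /H.
by apply: le_lt_trans; rewrite -cImN -cImD; exact: cabs_im.
Qed.

Lemma cc_cabs f : continuous (f : V -> (C : numFieldType)) ->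
  continuous (fun x => cabs (f x)).
Proof.
move=> /ccP cf; apply/crP => x e /(cf x)[r r0 H]; exists r => // y /H.
apply: le_lt_trans; rewrite ler_norml cabs_dist andbT lerNl opprB.
by rewrite cabs_distC cabs_dist.
Qed.

Lemma cc_pair f : continuous (fun x => complex.Re (f x)) ->
  continuous (fun x => complex.Im (f x)) ->
  continuous (f : V -> (C : numFieldType)).
Proof.
move=> /crP c1 /crP c2; apply/ccP => x e e0.
have e20 : 0 < e / 2 by rewrite divr_gt0.
have [r1 r10 H1] := c1 x _ e20; have [r2 r20 H2] := c2 x _ e20.
exists (Num.min r1 r2); first by rewrite lt_min r10.
move=> y; rewrite lt_min => /andP[/H1 h1 /H2 h2].
apply: le_lt_trans (cabs_le _) _; rewrite cReD cImD cReN cImN.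
by rewrite [e in _ < e]splitr ltrD.
Qed.

Lemma cc_real (u : V -> R) : continuous u ->
  continuous ((fun x => (u x)%:C) : V -> (C : numFieldType)).
Proof. by move=> cu; apply: cc_pair => //= x; exact: cvg_cst. Qed.

Lemma cc_cst (c : C) : continuous ((fun=> c) : V -> (C : numFieldType)).
Proof. by move=> x; exact: cvg_cst. Qed.

Lemma cc_add f g : continuous (f : V -> (C : numFieldType)) ->
  continuous (g : V -> (C : numFieldType)) ->
  continuous ((fun x => f x + g x) : V -> (C : numFieldType)).
Proof. by move=> cf cg x; apply: cvgD; [exact: cf|exact: cg]. Qed.

Lemma cc_mul f g : continuous (f : V -> (C : numFieldType)) ->
  continuous (g : V -> (C : numFieldType)) ->
  continuous ((fun x => f x * g x) : V -> (C : numFieldType)).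
Proof. by move=> cf cg x; apply: cvgM; [exact: cf|exact: cg]. Qed.

Lemma cc_opp f : continuous (f : V -> (C : numFieldType)) ->
  continuous ((fun x => - f x) : V -> (C : numFieldType)).
Proof. by move=> cf x; apply: cvgN; exact: cf. Qed.

Lemma cr_cst (c : R) : continuous ((fun=> c) : V -> R).
Proof. by move=> x; exact: cvg_cst. Qed.

Lemma cr_add (u v : V -> R) : continuous u -> continuous v ->
  continuous (fun x => u x + v x).
Proof. by move=> cu cv x; apply: cvgD; [exact: cu|exact: cv]. Qed.

Lemma cr_opp (u : V -> R) : continuous u -> continuous (fun x => - u x).
Proof. by move=> cu x; apply: cvgN; exact: cu. Qed.

Lemma cr_sub (u v : V -> R) : continuous u -> continuous v ->
  continuous (fun x => u x - v x).
Proof. by move=> cu cv; exact: (cr_add cu (cr_opp cv)). Qed.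

Lemma cr_mul (u v : V -> R) : continuous u -> continuous v ->
  continuous (fun x => u x * v x).
Proof. by move=> cu cv x; apply: cvgM; [exact: cu|exact: cv]. Qed.

Lemma cr_inv (u : V -> R) : (forall x, u x != 0) -> continuous u ->
  continuous (fun x => (u x)^-1).
Proof. by move=> u0 cu x; apply: (cvgV (u0 x)); exact: cu. Qed.

Lemma cr_comp (u : V -> R) (k : R -> R) : continuous u -> continuous k ->
  continuous (fun x => k (u x)).
Proof. by move=> cu ck x; apply: (cvg_comp _ _ (cu x)); exact: ck. Qed.

Lemma cr_sum (I : Type) (s : seq I) (u : I -> V -> R) :
  (forall i, continuous (u i)) -> continuous (fun x => \sum_(i <- s) u i x).
Proof.
move=> cu; elim: s => [|i s ih].
  rewrite (_ : (fun _ => _) = (fun=> 0)); first exact: cr_cst.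
  by apply/funext => x; rewrite big_nil.
rewrite (_ : (fun _ => _) = (fun x => u i x + \sum_(j <- s) u j x)).
  exact: cr_add.
by apply/funext => x; rewrite big_cons.
Qed.

Lemma cr_prod (I : Type) (s : seq I) (u : I -> V -> R) :
  (forall i, continuous (u i)) -> continuous (fun x => \prod_(i <- s) u i x).
Proof.
move=> cu; elim: s => [|i s ih].
  rewrite (_ : (fun _ => _) = (fun=> 1)); first exact: cr_cst.
  by apply/funext => x; rewrite big_nil.
rewrite (_ : (fun _ => _) = (fun x => u i x * \prod_(j <- s) u j x)).
  exact: cr_mul.
by apply/funext => x; rewrite big_cons.
Qed.

Lemma cr_min (u v : V -> R) : continuous u -> continuous v ->
  continuous (fun x => Num.min (u x) (v x)).
Proof.
move=> cu cv; rewrite (_ : (fun _ => _) = fun x => (u x + v x - `|u x - v x|) / 2).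
  apply: cr_mul; last exact: cr_cst.
  apply: cr_sub; first exact: cr_add.
  by apply: cr_comp; [exact: cr_sub|exact: norm_continuous].
apply/funext => x; move: (u x) (v x) => a b.
by case: (leP a b) => ab; [rewrite ler0_norm|rewrite gtr0_norm]; lra.
Qed.

Lemma cc_conj f : continuous (f : V -> (C : numFieldType)) ->
  continuous ((fun x => (f x)^*) : V -> (C : numFieldType)).
Proof.
move=> cf; apply: cc_pair.
  rewrite (_ : (fun _ => _) = (fun x => complex.Re (f x))); first exact: cc_re.
  by apply/funext => x; case: (f x).
rewrite (_ : (fun _ => _) = (fun x => - complex.Im (f x))).
  by move=> x; apply: cvgN; exact: cc_im.
by apply/funext => x; case: (f x).
Qed.

End General.

Lemma cc_comp (V W : normedModType R) (f : V -> C) (q : W -> V) :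
  continuous q -> continuous (f : V -> (C : numFieldType)) ->
  continuous ((fun x => f (q x)) : W -> (C : numFieldType)).
Proof. by move=> cq cf x; apply: (cvg_comp _ _ (cq x)); exact: cf. Qed.

Lemma cc_expi (V : normedModType R) (u : V -> R) : continuous u ->
  continuous ((fun x => expi (u x)) : V -> (C : numFieldType)).
Proof.
move=> cu; apply: cc_pair => x /=.
  by apply: (cvg_comp _ _ (cu x)); exact: continuous_cos.
by apply: (cvg_comp _ _ (cu x)); exact: continuous_sin.
Qed.

End Continuity.

(** * Compactly supported continuous functions *)

Section CompactSupport.
Variables (R : realType) (d : nat).
Local Notation V := 'rV[R]_d.
Local Notation C := R[i].
Implicit Types (f g : V -> C) (h : V -> R).

Lemma compact_cball (r : R) : compact [set x : V | `|x| <= r].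
Proof.
apply: bounded_closed_compact.
  exists r; split; first exact: num_real.
  by move=> M rM x /= /le_trans; apply; exact: ltW.
rewrite (_ : mkset _ = [set x : V | (fun y : V => `|y|) x \in `]-oo, r]]); last first.
  by apply/seteqP; split=> x /=; rewrite in_itv.
apply: (@closed_comp _ _ _ [set x | x \in `]-oo, r]]).
  by move=> x _; exact: norm_continuous.
exact: interval_closed.
Qed.

Lemma ccontE (K : numFieldType) (f : V -> K) : ccont f <->
  continuous f /\ exists r : R, forall x, r < `|x| -> f x = 0.
Proof.
split=> -[cf H]; split=> //.
  have [M [_ HM]] := compact_bounded H.
  exists (M + 1) => x Mx; apply: contrapT => /eqP fx.
  have /= := HM (M + 1); rewrite ltrDl ltr01 => /(_ isT x).
  have clx : closure [set x | f x != 0] x by exact: subset_closure.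
  by move=> /(_ clx); rewrite leNgt Mx.
have [r Hr] := H.
apply: (subclosed_compact _ (@compact_cball r)); first exact: closed_closure.
have : closed [set x : V | `|x| <= r].
  by apply: compact_closed; [exact: norm_hausdorff|exact: compact_cball].
rewrite closure_id => ->; apply: closureS => x /= fx.
by rewrite leNgt; apply: contra fx => /Hr ->.
Qed.

Lemma supp_cball f r : (forall x, r < `|x| -> f x = 0) ->
  supp f `<=` [set x | `|x| <= r].
Proof.
move=> Hr; have : closed [set x : V | `|x| <= r].
  by apply: compact_closed; [exact: norm_hausdorff|exact: compact_cball].
rewrite closure_id => ->; apply: closureS => x /= fx.
by rewrite leNgt; apply: contra fx => /Hr ->.
Qed.

Lemma ccont_cont f : ccont f -> continuous (f : V -> (C : numFieldType)).
Proof. by case. Qed.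

Lemma ccont_lin (a : C) f g : ccont f -> ccont g ->
  ccont (fun x => a * f x + g x).
Proof.
move=> /ccontE[cf [r Hr]] /ccontE[cg [s Hs]]; apply/ccontE; split.
  exact: (cc_add (cc_mul (@cc_cst _ _ a) cf) cg).
by exists (Num.max r s) => x; rewrite gt_max => /andP[/Hr -> /Hs ->]; rewrite mulr0 addr0.
Qed.

Lemma ccont_mul f g : ccont f -> continuous (g : V -> (C : numFieldType)) ->
  ccont (fun x => f x * g x).
Proof.
move=> /ccontE[cf [r Hr]] cg; apply/ccontE; split; first exact: (cc_mul cf cg).
by exists r => x /Hr ->; rewrite mul0r.
Qed.

Lemma ccont_zero : ccont ((fun=> 0) : V -> C).
Proof. by apply/ccontE; split; [exact: cc_cst|exists 0]. Qed.

Lemma ccont_scale (a : C) f : ccont f -> ccont (fun x => a * f x).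
Proof.
move=> cf; rewrite (_ : (fun _ => _) = (fun x => a * f x + (fun=> 0) x)).
  by apply: ccont_lin => //; exact: ccont_zero.
by apply/funext => x; rewrite addr0.
Qed.

Lemma ccont_add f g : ccont f -> ccont g -> ccont (fun x => f x + g x).
Proof.
move=> cf cg; rewrite (_ : (fun _ => _) = (fun x => 1 * f x + g x)).
  exact: ccont_lin.
by apply/funext => x; rewrite mul1r.
Qed.

Lemma ccont_sub f g : ccont f -> ccont g -> ccont (fun x => f x - g x).
Proof.
move=> cf cg; rewrite (_ : (fun _ => _) = (fun x => -1 * g x + f x)).
  exact: ccont_lin.
by apply/funext => x; rewrite mulN1r addrC.
Qed.

Lemma ccont_bounded f : ccont f -> exists2 M : R, 0 < M & forall x, cabs (f x) <= M.
Proof.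
move=> [cf]; set K := closure _ => cK.
have cc : {within K, continuous (fun x => cabs (f x))}.
  by apply: continuous_subspaceT; exact: cc_cabs.
have [M [Mr HM]] := compact_bounded (continuous_compact cc cK).
exists (Num.max M 0 + 1); first by rewrite ltr_pwDr// le_max lexx orbT.
move=> x; have [fx|fx] := eqVneq (f x) 0.
  by rewrite fx cabs0 addr_ge0// le_max lexx orbT.
have /= := HM (Num.max M 0 + 1).
have lM : M < Num.max M 0 + 1 by rewrite (@le_lt_trans _ _ (Num.max M 0))// ?le_max ?lexx// ltrDl.
move=> /(_ lM (cabs (f x))); rewrite ger0_norm ?cabs_ge0//; apply.
by exists x => //; exact: subset_closure.
Qed.

Lemma ccont_uniform f : ccont f -> forall e : R, 0 < e ->
  exists2 r : R, 0 < r & forall x y, `|y - x| < r -> cabs (f y - f x) < e.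
Proof.
move=> /ccontE[cf [r0 Hr0]] e e0.
pose P (s : R) (x : V) := forall y, `|y - x| < s -> cabs (f y - f x) < e.
have /compact_near_coveringP/(_ _ (0 : R)^'+ P) := @compact_cball (r0 + 1).
case.
- move=> x _.
  have /ccP/(_ x (e / 2)) := cf; rewrite divr_gt0// => -[//|r r_gt0 Hr].
  exists ([set y | `|y - x| < r / 2], [set s : R | 0 < s < r / 2]) => /=.
    split.
      apply/nbhs_ballP; exists (r / 2) => /=; first by rewrite divr_gt0.
      by move=> y; rewrite -ball_normE /= distrC.
    near=> s; apply/andP; split; near: s; first exact: nbhs_right_gt.
    by apply: nbhs_right_lt; rewrite divr_gt0.
  move=> [x' s] /= [x'x /andP[s0 sr]] y yx'.
  have h1 : `|x' - x| < r by rewrite (lt_trans x'x)// ltr_pdivrMr// mulr2n mulrDr mulr1 ltrDl.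
  have h2 : `|y - x| < r.
    rewrite -(subrK x' y) -addrA [r]splitr (le_lt_trans (ler_normD _ _))//.
    by rewrite ltrD// (lt_trans yx').
  rewrite (le_lt_trans (cabs_tri _ (f x) _))// [e]splitr ltrD ?Hr//.
  by rewrite cabs_distC Hr.
- move=> s [/= s0 Hs].
  exists (Num.min (s / 2) 1); first by rewrite lt_min ltr01 divr_gt0.
  move=> x y; rewrite lt_min => /andP[ys y1].
  have [xr|xr] := leP `|x| (r0 + 1).
    have := Hs (s / 2); rewrite /= sub0r normrN gtr0_norm ?divr_gt0//.
    by rewrite ltr_pdivrMr// mulr2n mulrDr mulr1 ltrDl => /(_ s0 isT x xr); apply.
  rewrite !Hr0 ?subr0 ?cabs0//.
    by rewrite (le_lt_trans _ xr)// lerDl.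
  rewrite -(ltrD2r 1) (lt_le_trans xr)//.
  rewrite -{1}(subrK y x) addrC (le_trans (ler_normD _ _))// lerD2l.
  by rewrite distrC ltW.
Unshelve. all: by end_near.
Qed.

End CompactSupport.

(** * Cauchy sequences *)

Section Rates.
Variable R : realType.

Lemma cauchy_rate (u a : nat -> R) : (forall n p, `|u n - u p| <= a n + a p) ->
  exists l, forall n, `|u n - l| <= a n.
Proof.
move=> H; pose E := range (fun n => u n - a n).
have ubE p : ubound E (u p + a p).
  move=> _ [n _ <-]; have := H n p; rewrite ler_norml => /andP[_].
  by rewrite lerBlDr; lra.
have E0 : E !=set0 by exists (u 0%N - a 0%N), 0%N.
exists (sup E) => n.
have h1 : sup E <= u n + a n by apply: ge_sup.
have h2 : u n - a n <= sup E.
  by apply: ub_le_sup; [exists (u n + a n); exact: ubE|exists n].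
by rewrite ler_norml; lra.
Qed.

Lemma cauchy_rateC (u : nat -> R[i]) (a : nat -> R) :
  (forall n p, cabs (u n - u p) <= a n + a p) ->
  exists l, forall n, cabs (u n - l) <= a n + a n.
Proof.
move=> H.
have [|x Hx] := @cauchy_rate (fun n => complex.Re (u n)) a.
  by move=> n p; rewrite -cReN -cReD (le_trans (cabs_re _)).
have [|y Hy] := @cauchy_rate (fun n => complex.Im (u n)) a.
  by move=> n p; rewrite -cImN -cImD (le_trans (cabs_im _)).
exists (x +i* y) => n; rewrite (le_trans (cabs_le _))//.
by rewrite cReD cImD cReN cImN lerD.
Qed.

End Rates.

(** * Measures and the seminorm of their variation *)

Section Domination.
Variables (R : realType) (d : nat).
Local Notation V := 'rV[R]_d.
Local Notation C := R[i].
Implicit Types (f g F : V -> C) (h : V -> R) (m : (V -> C) -> C).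

(** For continuous [h >= 0] this says [|m|(h) <= c]; stated on [m] directly,
    since a continuous function is the supremum of its minorants. *)
Definition dominated m h (c : R) : Prop :=
  forall g, ccont g -> (forall x, cabs (g x) <= h x) -> cabs (m g) <= c.

(** For continuous [F] this relation is single-valued in [z] and characterizes
    [pairing m F]; being a plain approximation property, it passes to limits. *)
Definition extension_value m F (z : C) : Prop :=
  forall e : R, 0 < e -> exists g, [/\ ccont g,
    dominated m (fun x => cabs (F x - g x)) e & cabs (m g - z) <= e].

Lemma dominated_le m h1 h2 c1 c2 : (forall x, h1 x <= h2 x) -> c2 <= c1 ->
  dominated m h2 c2 -> dominated m h1 c1.
Proof.
move=> h12 c12 H g cg gh; apply: le_trans c12; apply: H => // x.
exact: le_trans (h12 x).
Qed.

Section Measure.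
Variable m : (V -> C) -> C.
Hypothesis hm : is_measure m.

Lemma measure_add f g : ccont f -> ccont g ->
  m (fun x => f x + g x) = m f + m g.
Proof.
move=> cf cg; have [/(_ 1 f g cf cg) + _] := hm; rewrite mul1r => <-.
by congr m; apply/funext => x; rewrite mul1r.
Qed.

Lemma measure_zero : m (fun=> 0) = 0.
Proof.
have := measure_add (@ccont_zero R d) (@ccont_zero R d).
rewrite (_ : (fun _ => _) = (fun=> 0)); last by apply/funext => x; rewrite addr0.
move=> /eqP; rewrite -subr_eq0 opprD addrA subrr sub0r oppr_eq0 => /eqP.
exact.
Qed.

Lemma measure_scale a f : ccont f -> m (fun x => a * f x) = a * m f.
Proof.
move=> cf; have [/(_ a f _ cf (@ccont_zero R d)) + _] := hm.
rewrite measure_zero addr0 => <-.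
by congr m; apply/funext => x; rewrite addr0.
Qed.

Lemma measure_sub f g : ccont f -> ccont g ->
  m (fun x => f x - g x) = m f - m g.
Proof.
move=> cf cg; have [/(_ (-1) g f cg cf) + _] := hm.
rewrite mulN1r addrC => <-.
by congr m; apply/funext => x; rewrite mulN1r addrC.
Qed.

Lemma measure_bound (r : R) : exists2 K : R, 0 < K &
  forall f, ccont f -> (forall x, r < `|x| -> f x = 0) ->
  forall e : R, (forall x, cabs (f x) <= e) -> cabs (m f) <= K * e.
Proof.
have [_ /(_ _ (@compact_cball R d r))[CK HK]] := hm.
exists (Num.max CK 0 + 1); first by rewrite ltr_pwDr// le_max lexx orbT.
move=> f cf fr e fe.
have e0 : 0 <= e by apply: le_trans (fe 0); exact: cabs_ge0.
have sle : supnorm f <= e.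
  apply: ge_sup; first by exists (cabs (f 0)), 0.
  by move=> _ [x _ <-].
have s0 : 0 <= supnorm f.
  apply: le_trans (cabs_ge0 (f 0)) _; apply: ub_le_sup; last by exists 0.
  by exists e => _ [x _ <-].
apply: le_trans (HK f cf _) _; first exact: supp_cball.
apply: (@le_trans _ _ ((Num.max CK 0 + 1) * supnorm f)).
  by rewrite ler_wpM2r// (@le_trans _ _ (Num.max CK 0)) ?lerDl// le_max lexx.
by rewrite ler_wpM2l// addr_ge0// le_max lexx orbT.
Qed.

Lemma dominated_ball (r : R) : exists2 K : R, 0 < K & forall h (e : R),
  (forall x, r < `|x| -> h x = 0) -> (forall x, h x <= e) -> dominated m h (K * e).
Proof.
have [K K0 HK] := measure_bound r; exists K => // h e hr he g cg gh.
apply: HK => // [x /hr hx|x]; last exact: le_trans (gh x) (he x).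
by apply/cabs_eq0/eqP; rewrite eq_le cabs_ge0 andbT -hx.
Qed.

Lemma dominated_ccont g : ccont g -> exists c, dominated m (fun x => cabs (g x)) c.
Proof.
move=> cg; have /ccontE[_ [r Hr]] := cg.
have [K K0 HK] := dominated_ball r; have [M M0 HM] := ccont_bounded cg.
by exists (K * M); apply: HK => // x /Hr ->; rewrite cabs0.
Qed.

(** A minorant of [h1 + h2] splits proportionally to [h1] and [h2]; the
    constant [e] keeps the denominator away from zero. *)
Lemma dominated_add h1 h2 c1 c2 : continuous h1 -> continuous h2 ->
  (forall x, 0 <= h1 x) -> (forall x, 0 <= h2 x) ->
  dominated m h1 c1 -> dominated m h2 c2 ->
  dominated m (fun x => h1 x + h2 x) (c1 + c2).
Proof.
move=> ch1 ch2 h10 h20 H1 H2 g cg gh.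
have /ccontE[_ [r Hr]] := cg; have [K K0 HK] := measure_bound r.
have key e : 0 < e -> cabs (m g) <= c1 + c2 + K * e.
  move=> e0; pose q x := h1 x + h2 x + e.
  have q0 x : 0 < q x by rewrite ltr_wpDl// addr_ge0.
  have cq : continuous (fun x => (q x)^-1).
    apply: cr_inv => [x|]; first exact: lt0r_neq0.
    exact: (cr_add (cr_add ch1 ch2) (@cr_cst _ _ e)).
  (* The share of [g] proportional to [k]. *)
  have part (k : V -> R) : continuous k -> (forall x, 0 <= k x) ->
      ccont (fun x => g x * (k x / q x)%:C) /\
      forall x, cabs (g x * (k x / q x)%:C) <= k x.
    move=> ck k0; split.
      by apply: ccont_mul => //; apply: cc_real; exact: (cr_mul ck cq).
    move=> x; rewrite cabsM cabs_rr ger0_norm ?divr_ge0// ?(ltW (q0 x))//.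
    rewrite mulrC mulrAC ler_pdivrMr// ler_wpM2l//.
    by rewrite (le_trans (gh x))// lerDl ltW.
  have [a1 b1] := part h1 ch1 h10; have [a2 b2] := part h2 ch2 h20.
  have [a3 b3] := part (fun=> e) (@cr_cst _ _ e) (fun=> ltW e0).
  have -> : g = (fun x => (g x * (h1 x / q x)%:C + g x * (h2 x / q x)%:C) + g x * (e / q x)%:C).
    apply/funext => x; have qx : q x != 0 by rewrite gt_eqF.
    rewrite -!mulrDr -!(rmorphD (real_complex R)) -!mulrDl -/(q x).
    by rewrite divff// rmorph1 mulr1.
  rewrite measure_add ?measure_add//; last exact: (ccont_add a1 a2).
  apply: le_trans (cabsD _ _) _; rewrite lerD//.
    by apply: le_trans (cabsD _ _) _; rewrite lerD//; [exact: H1|exact: H2].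
  by apply: HK => // x /Hr ->; rewrite mul0r.
apply/ler_addgt0Pr => e e0; have := key (e / K); rewrite divr_gt0// => /(_ isT).
by rewrite mulrCA divff ?mulr1// gt_eqF.
Qed.

Lemma dominated_zero : dominated m (fun=> 0) 0.
Proof.
move=> g cg g0; rewrite (_ : g = fun=> 0) ?measure_zero ?cabs0//.
by apply/funext => x; apply/cabs_eq0/eqP; rewrite eq_le g0 cabs_ge0.
Qed.

Lemma dominated_scale h c (a : R) : 0 <= a -> dominated m h c ->
  dominated m (fun x => a * h x) (a * c).
Proof.
rewrite le_eqVlt => /predU1P[<- _|a0 H g cg gh].
  rewrite mul0r; apply: dominated_le dominated_zero => // x.
  by rewrite mul0r.
rewrite -ler_pdivrMl//.
have := H (fun x => (a^-1)%:C * g x) (ccont_scale _ cg).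
rewrite measure_scale// cabsM cabs_rr gtr0_norm ?invr_gt0//; apply => x.
by rewrite cabsM cabs_rr gtr0_norm ?invr_gt0// ler_pdivrMl.
Qed.

Lemma dominated_sum (I : Type) (s : seq I) (h : I -> V -> R) (c : I -> R) :
  (forall i, continuous (h i)) -> (forall i x, 0 <= h i x) ->
  (forall i, dominated m (h i) (c i)) ->
  dominated m (fun x => \sum_(i <- s) h i x) (\sum_(i <- s) c i).
Proof.
move=> ch h0 H.
elim: s => [|i s ih].
  rewrite big_nil (_ : (fun _ => _) = (fun=> 0)); first exact: dominated_zero.
  by apply/funext => x; rewrite big_nil.
rewrite big_cons (_ : (fun _ => _) = (fun x => h i x + \sum_(j <- s) h j x)).
  apply: dominated_add => // [x|x]; last exact: sumr_ge0.
  exact: cr_sum.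
by apply/funext => x; rewrite big_cons.
Qed.

Lemma dominated_tri f g F c1 c2 :
  continuous (f : V -> (C : numFieldType)) ->
  continuous (g : V -> (C : numFieldType)) ->
  continuous (F : V -> (C : numFieldType)) ->
  dominated m (fun x => cabs (f x - g x)) c1 ->
  dominated m (fun x => cabs (g x - F x)) c2 ->
  dominated m (fun x => cabs (f x - F x)) (c1 + c2).
Proof.
move=> cf cg cF H1 H2.
have c a b : continuous (a : V -> (C : numFieldType)) ->
    continuous (b : V -> (C : numFieldType)) -> continuous (fun x => cabs (a x - b x)).
  by move=> ca cb; apply: cc_cabs; exact: (cc_add ca (cc_opp cb)).
apply: (dominated_le _ (lexx _) (dominated_add (c _ _ cf cg) (c _ _ cg cF) _ _ H1 H2)).
- by move=> x; exact: cabs_tri.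
- by move=> x; exact: cabs_ge0.
- by move=> x; exact: cabs_ge0.
Qed.

Lemma extension_value_bound F z c : continuous (F : V -> (C : numFieldType)) ->
  dominated m (fun x => cabs (F x)) c -> extension_value m F z -> cabs z <= c.
Proof.
move=> cF H Hz; apply/ler_addgt0Pr => e e0.
have [g [cg g1 g2]] := Hz (e / 2) (divr_gt0 e0 (ltr0Sn R 1)).
have H' : dominated m (fun x => cabs (g x - 0)) (e / 2 + c).
  apply: (@dominated_tri _ F).
  - exact: ccont_cont.
  - exact: cF.
  - exact: cc_cst.
  - by apply: dominated_le g1 => // x; rewrite cabs_distC.
  - by apply: dominated_le H => // x; rewrite subr0.
have h1 : cabs (m g) <= e / 2 + c by apply: H' => // x; rewrite subr0.
have := cabsB (m g) (m g - z); rewrite opprB addrC subrK => h2.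
by apply: le_trans h2 _; lra.
Qed.

Lemma extension_value_lin F G a z w :
  continuous (F : V -> (C : numFieldType)) ->
  continuous (G : V -> (C : numFieldType)) ->
  extension_value m F z -> extension_value m G w ->
  extension_value m (fun x => a * F x + G x) (a * z + w).
Proof.
move=> cF cG HF HG e e0.
pose b := cabs a + 1; have b0 : 0 < b by rewrite ltr_wpDl// cabs_ge0.
have ab : cabs a <= b by rewrite lerDl.
have e20 : 0 < e / 2 by rewrite divr_gt0.
have [f [cf f1 f2]] := HF (e / 2 / b) (divr_gt0 e20 b0).
have [g [cg g1 g2]] := HG (e / 2) e20.
exists (fun x => a * f x + g x); split; first exact: ccont_lin.
  have c u v : continuous (u : V -> (C : numFieldType)) ->
      continuous (v : V -> (C : numFieldType)) -> continuous (fun x => cabs (u x - v x)).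
    by move=> cu cv; apply: cc_cabs; exact: (cc_add cu (cc_opp cv)).
  have h1 := dominated_scale (ltW b0) f1.
  have cb : continuous (fun x => b * cabs (F x - f x)).
    exact: (cr_mul (@cr_cst _ _ b) (c _ _ cF (ccont_cont cf))).
  apply: (dominated_le _ _ (dominated_add cb (c _ _ cG (ccont_cont cg)) _ _ h1 g1)).
  - move=> x; have -> : a * F x + G x - (a * f x + g x) = a * (F x - f x) + (G x - g x) by ring.
    by rewrite (le_trans (cabsD _ _))// lerD2r cabsM ler_wpM2r// cabs_ge0.
  - by rewrite mulrCA divff ?mulr1 -?splitr// gt_eqF.
  - by move=> x; rewrite mulr_ge0 ?cabs_ge0// ltW.
  - by move=> x; exact: cabs_ge0.
have [-> // _] := hm.
have -> : a * m f + m g - (a * z + w) = a * (m f - z) + (m g - w) by ring.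
rewrite (le_trans (cabsD _ _))// [e]splitr lerD// cabsM.
rewrite (@le_trans _ _ (b * (e / 2 / b)))//.
  by rewrite ler_pM// cabs_ge0.
by rewrite mulrCA divff ?mulr1// gt_eqF.
Qed.

Lemma extension_value_ccont g : ccont g -> extension_value m g (m g).
Proof.
move=> cg e e0; exists g; split => //; last by rewrite subrr cabs0 ltW.
apply: dominated_le dominated_zero; last exact: ltW.
by move=> x; rewrite subrr cabs0.
Qed.

Lemma extension_value_uniq F z w : continuous (F : V -> (C : numFieldType)) ->
  extension_value m F z -> extension_value m F w -> z = w.
Proof.
move=> cF Hz Hw; have := extension_value_lin (-1) cF cF Hw Hz.
rewrite (_ : (fun _ => _) = (fun=> 0)); last first.
  by apply/funext => x; rewrite mulN1r addNr.
move=> /(extension_value_bound (@cc_cst _ _ 0) (c := 0)) H.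
apply/eqP; rewrite -subr_eq0 addrC -mulN1r; apply/eqP/cabs_eq0/eqP.
rewrite eq_le cabs_ge0 andbT; apply: H.
by apply: dominated_le dominated_zero => // x; rewrite cabs0.
Qed.

Lemma extension_value_lim F z : continuous (F : V -> (C : numFieldType)) ->
  (forall e : R, 0 < e -> exists G w,
    [/\ continuous (G : V -> (C : numFieldType)), extension_value m G w,
      dominated m (fun x => cabs (F x - G x)) e & cabs (w - z) <= e]) ->
  extension_value m F z.
Proof.
move=> cF H e e0; have e20 : 0 < e / 2 by rewrite divr_gt0.
have [G [w [cG Gw FG wz]]] := H _ e20.
have [g [cg g1 g2]] := Gw _ e20.
exists g; split => //.
  by rewrite [e]splitr; apply: (dominated_tri cF cG (ccont_cont cg)).
by rewrite (le_trans (cabs_tri _ w _))// [e]splitr lerD.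
Qed.

End Measure.

(** ** Upper integrals *)

(** [cabs g] itself is a minorant in C_c of every lower semicontinuous
    majorant of [h]. *)
Lemma upper_integral_bound m (h : V -> \bar R) c g : ccont g ->
  (forall x, ((cabs (g x))%:E <= h x)%E) -> (upper_integral m h <= c%:E)%E ->
  cabs (m g) <= c.
Proof.
move=> cg gh H; rewrite -lee_fin; apply: le_trans H.
apply: le_ereal_inf_tmp => _ [k [_ hk] <-].
have cg' : ccont (fun x => cabs (g x)).
  have /ccontE[c' [r Hr]] := cg; apply/ccontE; split; first exact: cc_cabs.
  by exists r => x /Hr ->; rewrite cabs0.
apply: (@le_trans _ _ (abs_measure m (fun x => cabs (g x)))).
  by apply: ereal_sup_ubound; exists g.
apply: ereal_sup_ubound; exists (fun x => cabs (g x)) => //; split => //.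
  by move=> x; exact: cabs_ge0.
by move=> x; apply: le_trans (hk x).
Qed.

Lemma L1_seminorm_dominated m F e : (L1_seminorm m F < e%:E)%E ->
  dominated m (fun x => cabs (F x)) e.
Proof.
move=> /ltW H g cg gF; apply: (upper_integral_bound cg _ H) => x.
by rewrite lee_fin.
Qed.

(** [h] is continuous, hence its own lower semicontinuous majorant, and then
    only suprema of values of [m] remain. *)
Lemma upper_integral_dominated m (h : V -> R) (k : V -> \bar R) c : continuous h ->
  (forall x, (k x <= (h x)%:E)%E) ->
  dominated m h c -> (upper_integral m k <= c%:E)%E.
Proof.
move=> ch kh H.
apply: (@le_trans _ _ (upper_integral_lsc m (fun x => (h x)%:E))).
  apply: ereal_inf_lbound; exists (fun x => (h x)%:E) => //; split => //.
  move=> x a; rewrite lte_fin => ax.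
  exists [set y | a < h y]; last by move=> y; rewrite lte_fin.
  have /crP/(_ x (h x - a)) := ch; rewrite subr_gt0 => /(_ ax)[r r0 Hr].
  apply/nbhs_ballP; exists r => //= y; rewrite -ball_normE/= distrC => /Hr.
  by rewrite ltr_norml => /andP[+ _]; lra.
apply: ge_ereal_sup => _ [phi [cphi phi0 phih] <-].
apply: ge_ereal_sup => _ [g [cg gphi] <-]; rewrite lee_fin; apply: H => // x.
by apply: le_trans (gphi x) _; rewrite -lee_fin.
Qed.

Lemma dominated_L1_seminorm m F c : continuous (F : V -> (C : numFieldType)) ->
  dominated m (fun x => cabs (F x)) c -> (L1_seminorm m F <= c%:E)%E.
Proof.
by move=> cF; apply: upper_integral_dominated => [|x]; [exact: cc_cabs|exact: lexx].
Qed.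

Lemma pairingE m F z : is_measure m -> continuous (F : V -> (C : numFieldType)) ->
  extension_value m F z -> pairing m F = z.
Proof.
move=> hm cF Hz; rewrite /pairing; case: xgetP => [w _ Hw|/(_ z)[]].
  apply: (extension_value_uniq hm cF _ Hz) => e /Hw[g [cg g1 g2]].
  by exists g; split; [|exact: L1_seminorm_dominated|exact: ltW].
move=> e e0; have [g [cg g1 g2]] := Hz (e / 2) (divr_gt0 e0 (ltr0Sn R 1)).
have e2 : e / 2 < e by rewrite ltr_pdivrMr// mulr2n mulrDr mulr1 ltrDl.
exists g; split => //; last exact: le_lt_trans e2.
apply: (@le_lt_trans _ _ (e / 2)%:E); last by rewrite lte_fin.
apply: (dominated_L1_seminorm _ g1).
exact: (cc_add cF (cc_opp (ccont_cont cg))).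
Qed.

Lemma extension_value_L1 m F z : continuous (F : V -> (C : numFieldType)) ->
  extension_value m F z -> L1 m F.
Proof.
move=> cF Hz e e0; have [g [cg g1 g2]] := Hz (e / 2) (divr_gt0 e0 (ltr0Sn R 1)).
have e2 : e / 2 < e by rewrite ltr_pdivrMr// mulr2n mulrDr mulr1 ltrDl.
exists g; split => //; apply: (@le_lt_trans _ _ (e / 2)%:E); last by rewrite lte_fin.
apply: (dominated_L1_seminorm _ g1).
exact: (cc_add cF (cc_opp (ccont_cont cg))).
Qed.

(** Approximants of [F] in the seminorm have Cauchy values under [m]. *)
Lemma dominated_extension_value m F : is_measure m ->
  continuous (F : V -> (C : numFieldType)) ->
  (forall e : R, 0 < e -> exists g, ccont g /\
    dominated m (fun x => cabs (F x - g x)) e) ->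
  exists z, extension_value m F z.
Proof.
move=> hm cF H; pose a (n : nat) : R := n.+1%:R^-1.
have a0 n : 0 < a n by rewrite invr_gt0 ltr0n.
have [g Hg] := choice (fun n => H (a n) (a0 n)).
have [|z Hz] := @cauchy_rateC R (fun n => m (g n)) a.
  move=> n p; rewrite -(measure_sub hm (Hg n).1 (Hg p).1).
  have D : dominated m (fun x => cabs (g n x - g p x)) (a n + a p).
    apply: (dominated_tri hm _ cF) (Hg p).2.
    - exact: ccont_cont (Hg n).1.
    - exact: ccont_cont (Hg p).1.
    - by apply: dominated_le (Hg n).2 => // x; rewrite cabs_distC.
  apply: D => [|x]; last exact: lexx.
  by apply: ccont_sub; [exact: (Hg n).1|exact: (Hg p).1].
exists z => e e0.
have [n Hn] : exists n, a n < e / 2.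
  exists (Num.truncn (2 / e)); rewrite /a invf_plt ?posrE ?ltr0n ?divr_gt0// invf_div.
  by rewrite truncnS_gt.
exists (g n); split; first exact: (Hg n).1.
  by apply: dominated_le (Hg n).2 => //; have := a0 n; lra.
by apply: le_trans (Hz n) _; lra.
Qed.

Lemma L1_extension_value m F : is_measure m ->
  continuous (F : V -> (C : numFieldType)) -> L1 m F ->
  exists z, extension_value m F z.
Proof.
move=> hm cF H; apply: dominated_extension_value => // e /H[g [cg He]].
by exists g; split => //; exact: L1_seminorm_dominated He.
Qed.

Lemma extension_value_pairing m F : is_measure m ->
  continuous (F : V -> (C : numFieldType)) ->
  (exists z, extension_value m F z) -> extension_value m F (pairing m F).
Proof. by move=> hm cF [z Hz]; rewrite (pairingE hm cF Hz). Qed.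

End Domination.

(** * Translation bounded measures and lattice sums *)

Section Lattice.
Variables (R : realType) (d : nat).
Local Notation V := 'rV[R]_d.
Local Notation C := R[i].
Implicit Types (f g F : V -> C) (h : V -> R) (m : (V -> C) -> C) (x y z t : V).

Lemma rv_coord x i : `|x 0 i| <= `|x|.
Proof.
rewrite [leRHS]/Num.norm /= mx_normrE; apply/bigmax_geP; right => /=.
by exists (0, i).
Qed.

Lemma rv_norm_le x (b : R) : 0 <= b -> (forall i, `|x 0 i| <= b) -> `|x| <= b.
Proof.
move=> b0 H; rewrite [leLHS]/Num.norm /= mx_normrE; apply/bigmax_leP; split => //.
by move=> [i j] _; rewrite ord1; exact: H.
Qed.

Lemma coord_cont i : continuous (fun x => x 0 i).
Proof. exact: coord_continuous. Qed.

Lemma norm_cont : continuous (fun x : V => `|x|).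
Proof. by move=> x; exact: norm_continuous. Qed.

Lemma shift_cont t : continuous (fun x : V => x - t).
Proof.
by move=> x; apply: (@cvgB _ _ _ (nbhs x)); [exact: cvg_id|exact: cvg_cst].
Qed.

Lemma cr_shift h t : continuous h -> continuous (fun x => h (x - t)).
Proof. by move=> ch x; apply: (cvg_comp _ _ (@shift_cont t x)); exact: ch. Qed.

(** ** The weight *)

(** An integrable weight that factors over the coordinates, so that its
    integral and its sums over lattice points reduce to dimension one. *)
Definition weight x : R := \prod_i (1 + x 0 i ^+ 2)^-1.

Lemma oneDsq_gt0 (a : R) : 0 < 1 + a ^+ 2.
Proof. by rewrite ltr_pwDl// sqr_ge0. Qed.

Lemma weight_gt0 x : 0 < weight x.
Proof. by apply: prodr_gt0 => i _; rewrite invr_gt0 oneDsq_gt0. Qed.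

Lemma weight_ge0 x : 0 <= weight x.
Proof. exact/ltW/weight_gt0. Qed.

Lemma weight_le1 x : weight x <= 1.
Proof.
apply: (@le_trans _ _ (\prod_(i < d) 1)); last by rewrite big1.
apply: ler_prod => i _; rewrite invr_ge0 (ltW (oneDsq_gt0 _))/=.
by rewrite invf_le1 ?oneDsq_gt0// lerDl sqr_ge0.
Qed.

Lemma weight_cont : continuous weight.
Proof.
apply: cr_prod => i; apply: cr_inv => [x|]; first exact/lt0r_neq0/oneDsq_gt0.
by apply: cr_add; [exact: cr_cst|apply: cr_mul; exact: coord_cont].
Qed.

Lemma weight_coord x i : weight x * (1 + x 0 i ^+ 2) <= 1.
Proof.
rewrite /weight (bigD1 i)//= mulrAC mulVf ?gt_eqF ?oneDsq_gt0// mul1r.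
rewrite -[leRHS](_ : \prod_(j < d | j != i) 1 = 1); last by rewrite big1.
apply: ler_prod => j _; rewrite invr_ge0 (ltW (oneDsq_gt0 _))/=.
by rewrite invf_le1 ?oneDsq_gt0// lerDl sqr_ge0.
Qed.

Lemma weight_norm x : weight x * `|x| <= 1.
Proof.
rewrite mulrC -ler_pdivlMr ?weight_gt0// div1r.
apply: rv_norm_le => [|i]; first by rewrite invr_ge0 weight_ge0.
rewrite -[leRHS]div1r ler_pdivlMr ?weight_gt0// mulrC.
apply: le_trans (weight_coord x i); rewrite ler_wpM2l ?weight_ge0//.
rewrite -(real_normK (num_real (x 0 i))); have := normr_ge0 (x 0 i).
by move: `|x 0 i| => a a0; nra.
Qed.

Lemma weight_ball x (r : R) : `|x| <= r -> 1 <= (1 + r ^+ 2) ^+ d * weight x.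
Proof.
move=> xr; have r0 : 0 <= r by apply: le_trans xr.
have -> : (1 + r ^+ 2) ^+ d = \prod_(i < d) (1 + r ^+ 2) by rewrite prodr_const card_ord.
rewrite /weight -big_split/= -[leLHS](_ : \prod_(i < d) 1 = 1); last by rewrite big1.
apply: ler_prod => i _; rewrite ler01/= ler_pdivlMr ?oneDsq_gt0// mul1r lerD2l.
rewrite -(real_normK (num_real (x 0 i))) ler_sqr ?nnegrE//.
exact: le_trans (rv_coord _ _) xr.
Qed.

Lemma weightN x : weight (- x) = weight x.
Proof. by apply: eq_bigr => i _; rewrite !mxE sqrrN. Qed.

(** [1 + (a + e)^2 <= 3 (1 + a^2)] for [|e| <= 1]. *)
Lemma weight_shift x y : `|x - y| <= 1 -> weight x <= 3 ^+ d * weight y.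
Proof.
move=> xy.
have -> : 3 ^+ d = \prod_(i < d) (3 : R) by rewrite prodr_const card_ord.
rewrite /weight -big_split/=; apply: ler_prod => i _.
rewrite invr_ge0 (ltW (oneDsq_gt0 _))/=.
rewrite ler_pdivlMr ?oneDsq_gt0// mulrC ler_pdivrMr ?oneDsq_gt0//.
have := le_trans (rv_coord (x - y) i) xy; rewrite !mxE ler_norml.
move: (x 0 i) (y 0 i) => a b /andP[h1 h2].
have h : (a - b) ^+ 2 <= 1 by nra.
by have := sqr_ge0 (2 * a - b); have := sqr_ge0 a; nra.
Qed.

(** ** Sums over the points of a lattice box *)

Definition box (N : nat) := {ffun 'I_d -> 'I_(N.*2.+1)}.

Definition lattice_point N (k : box N) : V := \row_i ((k i)%:R - N%:R).

Lemma near_lattice N x : `|x| <= N%:R -> exists k : box N, `|x - lattice_point k| <= 1.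
Proof.
move=> xN.
have H i : 0 <= x 0 i + N%:R <= N.*2%:R.
  have := le_trans (rv_coord x i) xN; rewrite ler_norml -addnn natrD.
  by move=> /andP[a b]; apply/andP; split; lra.
exists [ffun i => inord (Num.truncn (x 0 i + N%:R))].
apply: rv_norm_le => // i; rewrite !mxE ffunE inordK; last first.
  have /andP[h1 h2] := H i.
  by rewrite ltnS -(ler_nat R) (le_trans _ h2)// truncn_le.
have /andP[h1 h2] := H i.
have := truncn_itv h1 => /andP[].
move: (Num.truncn _) => j; rewrite -[j.+1%:R]natr1 ler_norml => a b.
by apply/andP; split; lra.
Qed.

(** Each term is at most four times the increment from [j - a] to [j + 1 - a]
    of the function [u / (1 + |u|)], which takes values between -1 and 1. *)
Lemma sum_inv_oneDsq (a : R) (M : nat) : \sum_(j < M) (1 + (j%:R - a) ^+ 2)^-1 <= 8.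
Proof.
pose p (u : R) := if 0 <= u then 1 - (1 + u)^-1 else (1 - u)^-1 - 1.
have pM u : -1 <= p u <= 1.
  rewrite /p; case: (leP 0 u) => u0.
    have : 0 <= (1 + u)^-1 <= 1 by rewrite invr_ge0 invf_le1; lra.
    by lra.
  have : 0 <= (1 - u)^-1 <= 1 by rewrite invr_ge0 invf_le1; lra.
  by lra.
have frac (b c : R) : 0 < b -> 0 < c -> b^-1 - c^-1 = (c - b) / (b * c).
  by move=> b0 c0; field; rewrite !gt_eqF.
have step u : (1 + u ^+ 2)^-1 <= 4 * (p (u + 1) - p u).
  have q0 := oneDsq_gt0 u.
  rewrite /p; case: (leP 0 u) => u0; case: (leP 0 (u + 1)) => u1; [|lra| |].
  - rewrite (_ : 4 * _ = 4 * ((1 + u)^-1 - (1 + (u + 1))^-1)); last by ring.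
    rewrite frac; [|lra|lra].
    rewrite mulrA ler_pdivlMr; last by nra.
    rewrite mulrC ler_pdivrMr//; nra.
  - have a1 : (1 + u^+2)^-1 <= 1 by rewrite invf_le1// lerDl sqr_ge0.
    have a2 : (1 + (u + 1))^-1 <= 1 by rewrite invf_le1; lra.
    have a3 : (1 - u)^-1 <= 1 by rewrite invf_le1; lra.
    have b2 : (1 + (u + 1))^-1 + (1 - u)^-1 <= 3 / 2.
      have e1 : (1 + (u + 1))^-1 = (1 - u) * ((1 + (u + 1)) * (1 - u))^-1.
        by field; rewrite !gt_eqF; lra.
      have e2 : (1 - u)^-1 = (1 + (u + 1)) * ((1 + (u + 1)) * (1 - u))^-1.
        by field; rewrite !gt_eqF; lra.
      rewrite e1 e2 -mulrDl ler_pdivrMr; nra.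
    lra.
  - rewrite (_ : 4 * _ = 4 * ((1 - (u + 1))^-1 - (1 - u)^-1)); last by ring.
    rewrite frac; [|lra|lra].
    rewrite mulrA ler_pdivlMr; last by nra.
    rewrite mulrC ler_pdivrMr//; nra.
apply: (@le_trans _ _ (4 * (p (M%:R - a) - p (0 - a)))).
  elim: M => [|M ih]; first by rewrite big_ord0 subrr mulr0.
  rewrite big_ord_recr/=; have := step (M%:R - a).
  by rewrite -[M.+1%:R]natr1 (addrAC M%:R 1); lra.
by have := pM (M%:R - a); have := pM (0 - a); lra.
Qed.

(** The sum factors over the coordinates; moving each sample point to the
    lattice point costs a factor [3 ^+ d]. *)
Lemma lattice_sum_weight z N (y : box N -> V) :
  (forall k, `|y k - lattice_point k| <= 1) ->
  \sum_k weight (y k - z) <= 24 ^+ d.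
Proof.
move=> yk.
apply: (@le_trans _ _ (\sum_(k : box N) 3 ^+ d * weight (lattice_point k - z))).
  apply: ler_sum => k _; apply: weight_shift.
  by rewrite opprB addrA subrK.
rewrite -mulr_sumr.
have -> : \sum_(k : box N) weight (lattice_point k - z) =
    \prod_(i < d) \sum_(j < N.*2.+1) (1 + (j%:R - (N%:R + z 0 i)) ^+ 2)^-1.
  rewrite bigA_distr_bigA/=; apply: eq_bigr => k _; apply: eq_bigr => i _.
  by rewrite !mxE opprD addrA.
(* 3 moves a sample point to its lattice point, 8 bounds the sum in one
   coordinate. *)
have -> : 24 = 3 * 8 :> R by rewrite -natrM.
rewrite exprMn ler_wpM2l ?exprn_ge0//.
have -> : 8 ^+ d = \prod_(i < d) (8 : R) by rewrite prodr_const card_ord.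
apply: ler_prod => i _; rewrite sum_inv_oneDsq andbT.
by apply: sumr_ge0 => j _; rewrite invr_ge0 ltW// oneDsq_gt0.
Qed.

(** ** Uniform domination of translates *)

Definition tent x : R := Num.max 0 (2 - `|x|).

Lemma tent_ge0 x : 0 <= tent x.
Proof. by rewrite /tent le_max lexx. Qed.

Lemma tent_le2 x : tent x <= 2.
Proof. by rewrite /tent ge_max ler0n lerBlDr lerDl normr_ge0. Qed.

Lemma tent_ge1 x : `|x| <= 1 -> 1 <= tent x.
Proof. by move=> x1; rewrite /tent le_max; apply/orP; right; lra. Qed.

Lemma tent_eq0 x : 2 <= `|x| -> tent x = 0.
Proof. by move=> x2; rewrite /tent max_l// subr_le0. Qed.

Lemma tent_cont : continuous tent.
Proof.
have c : continuous (fun x : V => 2 - `|x|).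
  by apply: cr_sub; [exact: cr_cst|exact: norm_cont].
rewrite (_ : tent = (fun x => ((2 - `|x|) + `|2 - `|x| |) / 2)).
  apply: cr_mul; last exact: cr_cst.
  by apply: cr_add => //; apply: cr_comp => //; exact: norm_continuous.
apply/funext => x; rewrite /tent; move: (2 - _) => a.
by case: (leP 0 a) => a0; [rewrite ger0_norm//|rewrite ltr0_norm//]; lra.
Qed.

(** Translation boundedness tested on one continuous function. As [tent >= 1]
    on the unit ball and unit balls about the lattice points cover the space,
    translates of [tent] dominate any function with summable suprema over
    these balls. *)
Definition uniformly_dominated m (c : R) : Prop :=
  forall t, dominated m (fun x => tent (x - t)) c.

Lemma uniformly_dominated_ge0 m c : is_measure m -> uniformly_dominated m c -> 0 <= c.
Proof.
move=> hm /(_ 0 _ (@ccont_zero R d)); rewrite (measure_zero hm) cabs0; apply => x.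
exact: tent_ge0.
Qed.

Lemma translation_bounded_uniformly m : is_measure m -> translation_bounded m ->
  exists c, uniformly_dominated m c.
Proof.
move=> hm /(_ _ (@compact_cball R d 2)).
set s := ereal_sup _ => soo.
have [c sc] : exists c : R, (s <= c%:E)%E.
  by case: s soo => [r|//|]; [exists r|exists 0; rewrite leNye].
exists (2 * c) => t g cg gt.
have h : ccont (fun x => (2^-1)%:C * g x) by exact: ccont_scale.
have := upper_integral_bound h _ (le_trans (@ereal_sup_ubound _ _ _ _) sc).
move=> /(_ m (fun x => (\1_([set t + k | k in [set x | `|x| <= 2]]) x)%:E)).
rewrite (measure_scale hm _ cg) cabsM cabs_rr gtr0_norm ?invr_gt0// ler_pdivrMl//.
apply; last by exists t.
move=> x; rewrite lee_fin cabsM cabs_rr gtr0_norm ?invr_gt0// ler_pdivrMl//.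
apply: le_trans (gt x) _.
have [xt|xt] := leP `|x - t| 2.
  rewrite indicE mem_set ?mulr1 ?tent_le2//.
  by exists (x - t) => //; rewrite addrC subrK.
by rewrite tent_eq0 ?mulr_ge0// ltW.
Qed.

Section UniformlyDominated.
Variables (m : (V -> C) -> C) (c : R).
Hypotheses (hm : is_measure m) (hc : uniformly_dominated m c).

(** On each cell [h] is bounded by its maximum times a translate of [tent]. *)
Lemma lattice_dominated h (S : R) t : continuous h -> (forall x, 0 <= h x) ->
  (forall N (y : box N -> V), (forall k, `|y k - lattice_point k| <= 1) ->
     \sum_k h (y k) <= S) ->
  dominated m (fun x => h (x - t)) (c * S).
Proof.
move=> ch h0 HS g cg gh; have /ccontE[_ [r Hr]] := cg.
pose N := (Num.truncn (`|r| + `|t|)).+1.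
have NH : `|r| + `|t| <= N%:R by apply: ltW; rewrite truncnS_gt.
have Hy (k : box N) : exists y, `|y - lattice_point k| <= 1 /\
    forall x, `|x - lattice_point k| <= 1 -> h x <= h y.
  pose A := [set x : V | `|x - lattice_point k| <= 1].
  have cA : compact A.
    apply: bounded_closed_compact.
      exists (1 + `|lattice_point k|); split; first exact: num_real.
      move=> M MH x /= xk; rewrite -(subrK (lattice_point k) x).
      by rewrite (le_trans (ler_normD _ _))// (le_trans _ (ltW MH))// lerD2r.
    have -> : A = (fun x : V => `|x - lattice_point k|) @^-1` [set b : R | b <= 1].
      by [].
    have cn : continuous (fun x : V => `|x - lattice_point k|).
      exact: (@cr_shift (fun x => `|x|) _ norm_cont).
    by apply: preimage_closed; [move=> x _; exact: cn|exact: closed_le].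
  have A0 : A !=set0 by exists (lattice_point k); rewrite /A/= subrr normr0.
  have [y yA Hy] := EVT_max_rV A0 cA (continuous_subspaceT ch).
  exists y; split; first by rewrite inE in yA.
  by move=> x xk; apply: Hy; rewrite inE.
have [y yH] := choice Hy.
apply: (@le_trans _ _ (c * \sum_k h (y k))); last first.
  rewrite ler_wpM2l ?(uniformly_dominated_ge0 hm hc)//.
  by apply: HS => k; exact: (yH k).1.
rewrite mulr_sumr.
have D : dominated m
    (fun x => \sum_(k : box N) h (y k) * tent (x - (t + lattice_point k)))
    (\sum_(k : box N) h (y k) * c).
  apply: (dominated_sum hm) => k.
  - apply: cr_mul; first exact: cr_cst.
    by apply: cr_shift; exact: tent_cont.
  - by move=> x; rewrite mulr_ge0// tent_ge0.
  - by apply: (dominated_scale hm) => //; exact: hc.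
rewrite (eq_bigr (fun k => h (y k) * c)); last by move=> k _; rewrite mulrC.
apply: D => // x; have [xr|xr] := leP `|x| r; last first.
  by rewrite Hr// cabs0 sumr_ge0// => k _; rewrite mulr_ge0// tent_ge0.
have [k xk] : exists k : box N, `|x - t - lattice_point k| <= 1.
  apply: near_lattice; rewrite (le_trans (ler_normB _ _))// (le_trans _ NH)//.
  by rewrite lerD2r (le_trans xr)// ler_norm.
apply: le_trans (gh x) _.
rewrite (bigD1 k)//= opprD addrA -[leLHS]addr0 lerD//.
  rewrite -[leLHS]mulr1 ler_pM ?tent_ge1//.
  exact: (yH k).2.
by apply: sumr_ge0 => k' _; rewrite mulr_ge0// tent_ge0.
Qed.

Lemma dominated_weight t : dominated m (fun x => weight (x - t)) (c * 24 ^+ d).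
Proof.
apply: lattice_dominated => [|x|N y yk].
- exact: weight_cont.
- exact: weight_ge0.
- under eq_bigr do rewrite -[y _]subr0.
  exact: lattice_sum_weight.
Qed.

Lemma dominated_decay h (a : R) : (forall x, h x <= a * weight x) ->
  0 <= a -> dominated m h (a * (c * 24 ^+ d)).
Proof.
move=> ha a0; apply: (dominated_le ha (lexx _)); apply: (dominated_scale hm) => //.
rewrite (_ : weight = fun x => weight (x - 0)); first exact: dominated_weight.
by apply/funext => x; rewrite subr0.
Qed.

Lemma uniformly_translation_bounded : translation_bounded m.
Proof.
move=> K /compact_bounded[M [_ HM]].
pose r := Num.max M 0 + 1.
have Mr : M < r by rewrite (@le_lt_trans _ _ (Num.max M 0))// ?le_max ?lexx// ltrDl.
have {}HM : forall x, K x -> `|x| <= r := HM r Mr.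
pose b := (1 + r ^+ 2) ^+ d.
have b0 : 0 <= b by rewrite exprn_ge0// ltW// oneDsq_gt0.
apply: (@le_lt_trans _ _ (b * (c * 24 ^+ d))%:E); last exact: ltry.
apply: ge_ereal_sup => _ [t _ <-].
apply: (upper_integral_dominated (h := fun x => b * weight (x - t))).
- apply: cr_mul; first exact: cr_cst.
  by apply: cr_shift; exact: weight_cont.
- move=> x; rewrite lee_fin indicE.
  case: (asboolP ([set t + k | k in K] x)) => xK.
    rewrite mem_set//; case: xK => k Kk <-; rewrite addrAC subrr add0r.
    exact: weight_ball (HM _ Kk).
  by rewrite memNset// mulr_ge0// weight_ge0.
- by apply: (dominated_scale hm) => //; exact: dominated_weight.
Qed.

(** Cutting off at radius [n] costs [|x| / n], which one of the two factors
    [weight x] absorbs. *)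
Lemma extension_value_decay F (a : R) : continuous (F : V -> (C : numFieldType)) ->
  (forall x, cabs (F x) <= a * weight x ^+ 2) -> exists u : C, extension_value m F u.
Proof.
move=> cF Fa; apply: dominated_extension_value => // e e0.
have a0 : 0 <= a.
  by rewrite -(pmulr_lge0 _ (exprn_gt0 2 (weight_gt0 0))) (le_trans _ (Fa 0))// cabs_ge0.
pose K := a * (c * 24 ^+ d).
have K0 : 0 <= K.
  by rewrite !mulr_ge0// ?exprn_ge0// (uniformly_dominated_ge0 hm hc).
(* The error of the cutoff at radius [n] is [K / n]. *)
pose n : R := (K + 1) / e; have n0 : 0 < n by rewrite divr_gt0// ltr_wpDl.
pose cut x := Num.max 0 (1 - `|x| / n).
have cut_cont : continuous cut.
  rewrite (_ : cut = (fun x => ((1 - `|x| / n) + `|1 - `|x| / n |) / 2)).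
    have cc : continuous (fun x : V => 1 - `|x| / n).
      apply: cr_sub; first exact: cr_cst.
      by apply: cr_mul; [exact: norm_cont|exact: cr_cst].
    apply: cr_mul; last exact: cr_cst.
    by apply: cr_add => //; apply: cr_comp => //; exact: norm_continuous.
  apply/funext => x; rewrite /cut; move: (1 - _) => b.
  by case: (leP 0 b) => b0; [rewrite ger0_norm//|rewrite ltr0_norm//]; lra.
exists (fun x => F x * (cut x)%:C); split.
  apply/ccontE; split; first by apply: cc_mul; [exact: cF|exact: cc_real].
  exists n => x nx; rewrite /cut max_l ?mulr0// subr_le0 ler_pdivlMr// mul1r.
  exact: ltW.
apply: (@dominated_le _ _ _ _ (fun x => cabs (F x - F x * (cut x)%:C)) _ (a / n * (c * 24 ^+ d))).
- by move=> x; exact: lexx.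
- rewrite mulrAC -/K /n invf_div mulrA ler_pdivrMr ?ltr_wpDl// mulrC.
  by rewrite ler_wpM2l ?lerDl// ltW.
apply: dominated_decay; last by rewrite divr_ge0// ltW.
move=> x; have -> : F x - F x * (cut x)%:C = F x * (1 - cut x)%:C.
  by rewrite rmorphB rmorph1 mulrBr mulr1.
rewrite cabsM cabs_rr.
have h1 : `|1 - cut x| <= `|x| / n.
  have : 0 <= `|x| / n by rewrite divr_ge0// ltW.
  rewrite /cut; move: (`|x| / n) => b b0.
  by case: (leP 0 (1 - b)) => bb; rewrite ger0_norm; lra.
apply: (@le_trans _ _ (a * weight x ^+ 2 * (`|x| / n))).
  by rewrite ler_pM ?cabs_ge0.
rewrite (_ : a * weight x ^+ 2 * (`|x| / n) = a / n * (weight x * (weight x * `|x|))); last by ring.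
have an0 : 0 <= a / n by rewrite divr_ge0// ltW.
by rewrite ler_wpM2l// ler_piMr ?weight_ge0// weight_norm.
Qed.

End UniformlyDominated.

End Lattice.

(** * Lebesgue measure on row vectors *)

Section Measurability.
Variable R : realType.

Lemma measurable_countable_fibres d0 (X : measurableType d0) (T : countType)
    (Z : X -> T) (h : T -> R) : (forall z, measurable [set x | Z x = z]) ->
  measurable_fun setT (fun x => h (Z x)).
Proof.
move=> mZ _ Y mY; rewrite setTI.
rewrite (_ : _ @^-1` _ =
    \bigcup_z (if h z \in Y then [set x | Z x = z] else set0)); last first.
  apply/seteqP; split => x /=.
    by move=> hY; exists (Z x) => //; rewrite mem_set.
  by move=> [z _]; case: ifPn => [/set_mem hY /= ->|_ []].
by apply: countable_bigcupT_measurable => // z; case: ifP.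
Qed.

(** Rounding the coordinates of [q] down to multiples of [1 / (k + 1)] gives maps
    with countably many values; their composites with [u] are measurable and
    converge pointwise. *)
Lemma measurable_continuous_rV d0 (X : measurableType d0) n
    (q : X -> 'rV[R]_n) (u : 'rV[R]_n -> R) :
  (forall i, measurable_fun setT (fun x => q x 0 i)) -> continuous u ->
  measurable_fun setT (fun x => u (q x)).
Proof.
move=> mq cu.
pose Z k x : {ffun 'I_n -> int} := [ffun i => Num.floor (k.+1%:R * q x 0 i)].
pose p k (z : {ffun 'I_n -> int}) : 'rV[R]_n := \row_i ((z i)%:~R / k.+1%:R).
apply: (@measurable_fun_cvg _ _ _ _ (fun k x => u (p k (Z k x)))).
  move=> k; apply: (@measurable_countable_fibres _ _ _ (Z k) (fun z => u (p k z))) => z.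
  rewrite (_ : mkset _ = \bigcap_(i in [set: 'I_n])
      ((fun x => k.+1%:R * q x 0 i) @^-1` `[(z i)%:~R, (z i + 1)%:~R[%classic)).
    apply: fin_bigcap_measurable => // i _; rewrite -[X in measurable X]setTI.
    by apply: measurable_funM => //; exact: measurable_cst.
  apply/seteqP; split => [x /= <- i _|x H].
    by rewrite /= in_itv/= ffunE; exact: floor_itv.
  apply/ffunP => i; rewrite ffunE; apply/eqP; rewrite floor_eq.
  by have := H i I; rewrite /= in_itv.
move=> x _.
suff H : p k (Z k x) @[k --> \oo] --> q x by apply: (cvg_comp _ _ H); exact: cu.
apply/cvgrPdist_lt => e e0; near=> k.
have k0 : 0 < (k.+1)%:R :> R by rewrite ltr0n.
apply: (@le_lt_trans _ _ k.+1%:R^-1); last first.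
  rewrite invf_plt ?posrE//; apply: lt_trans (_ : k%:R < _); last by rewrite ltr_nat.
  by near: k; exact: nbhs_infty_gtr.
apply: rv_norm_le => [|i]; first by rewrite invr_ge0 ltW.
rewrite !mxE ffunE.
rewrite -[X in `|X - _|](mulfK (lt0r_neq0 k0)) -mulrBl normrM.
rewrite (ger0_norm (x := _^-1)) ?invr_ge0 ?(ltW k0)//.
rewrite -[leRHS]mul1r ler_wpM2r ?invr_ge0 ?(ltW k0)//.
have /andP[h1 h2] := floor_itv (k.+1%:R * q x 0 i).
rewrite mulrC; move: h1 h2; rewrite intrD; move: (_ * _) (_%:~R) => a b h1 h2.
by rewrite ger0_norm; lra.
Unshelve. all: by end_near.
Qed.

End Measurability.

Section LebesgueTuple.
Variable R : realType.
Local Notation T1 := (measurableTypeR R).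
Local Notation lam := (@lebesgue_measure R).
Local Open Scope ereal_scope.

Lemma ge0_integral_tuple_cons n (f : n.+1.-tuple T1 -> \bar R) :
  measurable_fun setT f -> (forall t, 0 <= f t) ->
  \int[lebesgue_tuple R n.+1]_t f t =
  \int[lam]_x \int[lebesgue_tuple R n]_t f (tuple_cons (x, t)).
Proof.
move=> mf f0.
transitivity (\int[pushforward (lam \x lebesgue_tuple R n) (@tuple_cons R n)]_t f t).
  by [].
rewrite ge0_integral_pushforward//; last exact: measurable_tuple_cons.
rewrite preimage_setT fubini_tonelli1//.
  by apply: measurableT_comp => //; exact: measurable_tuple_cons.
by move=> x; exact: f0.
Qed.

Definition affine1 (a b x : R) : R := (a * x + b)%R.

Lemma measurable_affine1 a b : measurable_fun [set: T1] (affine1 a b : T1 -> T1).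
Proof.
by apply: measurable_funD => //; apply: measurable_funM => //; exact: measurable_cst.
Qed.

Lemma lebesgue_measure_affine (a b : R) : a != 0%R -> forall A : set T1,
  measurable A -> lam A = `|a|%:E * lam (affine1 a b @^-1` A).
Proof.
move=> a0 A mA.
pose mu : {measure set T1 -> \bar R} :=
  [the measure _ _ of mscale (NngNum (normr_ge0 a))
    (measure_function_pushforward__canonical__measure_function_Measure
      lam (measurable_affine1 a b))].
rewrite (@lebesgue_measure_unique _ mu)// => X [[x y] /= _ <-].
rewrite /mu/= /mscale/= /pushforward.
have an : (`|a| != 0)%R by rewrite normr_eq0.
have mulE (c : R) : `|a|%:E * (c / `|a|)%:E = c%:E.
  by rewrite -EFinM mulrC divfK.
have [a_gt0|a_lt0|aE] := ltgtP a 0%R; last by rewrite aE eqxx in a0.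
- have -> : affine1 a b @^-1` `]x, y] = `[((y - b) / a)%R, ((x - b) / a)%R[%classic.
    apply/seteqP; split => z /=; rewrite !in_itv/= /affine1.
      by move=> /andP[h1 h2]; rewrite ler_ndivrMr// ltr_ndivlMr//; apply/andP; split; lra.
    by move=> /andP[]; rewrite ler_ndivrMr// ltr_ndivlMr// => h1 h2; apply/andP; split; lra.
  rewrite !lebesgue_measure_itv/= !lte_fin ltr_ndivlMr// mulfVK ?lt_eqF// ltrBlDr subrK.
  case: ifPn => xy; last by rewrite mule0.
  rewrite -!EFinB -mulrBl -[LHS](mulE (y - x)%R); congr (_ * _%:E).
  by rewrite ltr0_norm// invrN; ring.
- have -> : affine1 a b @^-1` `]x, y] = `]((x - b) / a)%R, ((y - b) / a)%R]%classic.
    apply/seteqP; split => z /=; rewrite !in_itv/= /affine1.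
      by move=> /andP[h1 h2]; rewrite ltr_pdivrMr// ler_pdivlMr//; apply/andP; split; lra.
    by move=> /andP[]; rewrite ltr_pdivrMr// ler_pdivlMr// => h1 h2; apply/andP; split; lra.
  rewrite !lebesgue_measure_itv/= !lte_fin ltr_pdivrMr// mulfVK ?gt_eqF// ltrBlDr subrK.
  case: ifPn => xy; last by rewrite mule0.
  rewrite -!EFinB -mulrBl -[LHS](mulE (y - x)%R); congr (_ * _%:E).
  by rewrite gtr0_norm//; ring.
Qed.

Lemma ge0_integral_affine1 (a b : R) (f : T1 -> \bar R) : a != 0%R ->
  measurable_fun setT f -> (forall x, 0 <= f x) ->
  \int[lam]_x f x = `|a|%:E * \int[lam]_x f (affine1 a b x).
Proof.
move=> a0 mf f0.
pose nu : {measure set T1 -> \bar R} :=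
  measure_function_pushforward__canonical__measure_function_Measure
      lam (measurable_affine1 a b).
rewrite (@eq_measure_integral _ _ _ setT (mscale (NngNum (normr_ge0 a)) nu)).
  rewrite ge0_integral_mscale//; congr (_ * _).
  transitivity (\int[pushforward lam (affine1 a b : T1 -> T1)]_x f x); first by [].
  by rewrite ge0_integral_pushforward//; exact: measurable_affine1.
by move=> A mA _; exact: (lebesgue_measure_affine b a0 mA).
Qed.

Definition affine_tuple n (a : R) (b t : n.-tuple T1) : n.-tuple T1 :=
  [tuple affine1 a (tnth b i) (tnth t i) | i < n].

Lemma measurable_affine_tuple n a b : measurable_fun setT (@affine_tuple n a b).
Proof.
apply/measurable_fun_tnthP => i.
rewrite (_ : _ \o _ = (affine1 a (tnth b i) : T1 -> T1) \o (@tnth _ T1 ^~ i)).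
  by apply: measurableT_comp; [exact: measurable_affine1|exact: measurable_tnth].
by apply/funext => t /=; rewrite tnth_mktuple.
Qed.

Lemma ge0_integral_affine_tuple n (a : R) (b : n.-tuple T1)
    (f : n.-tuple T1 -> \bar R) : a != 0%R ->
  measurable_fun setT f -> (forall t, 0 <= f t) ->
  \int[lebesgue_tuple R n]_t f t =
  (`|a| ^+ n)%:E * \int[lebesgue_tuple R n]_t f (affine_tuple a b t).
Proof.
move=> a0; elim: n b f => [b f mf f0|n ih b f mf f0].
  by rewrite expr0 mul1e; apply: eq_integral => t _; rewrite [in RHS]tuple0 [in LHS]tuple0.
pose b' : n.-tuple T1 := [tuple of behead b].
have mc : measurable_fun setT (f \o @tuple_cons R n).
  by apply: measurableT_comp => //; exact: measurable_tuple_cons.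
rewrite ge0_integral_tuple_cons// ge0_integral_tuple_cons//; last first.
  by apply: measurableT_comp => //; exact: measurable_affine_tuple.
pose G x := \int[lebesgue_tuple R n]_t f (tuple_cons (x, t)).
have mG : measurable_fun setT G.
  by apply: (@measurable_fun_fubini_tonelli_F _ _ _ _ _ _ (f \o @tuple_cons R n)) => // x; exact: f0.
have G0 x : 0 <= G x by apply: integral_ge0.
have maff : measurable_fun setT (fun p => f (affine_tuple a b (@tuple_cons R n p))).
  apply: (measurableT_comp mf); apply: measurableT_comp.
    exact: measurable_affine_tuple.
  exact: measurable_tuple_cons.
pose H x := \int[lebesgue_tuple R n]_t f (affine_tuple a b (tuple_cons (x, t))).
have mH : measurable_fun setT H.
  by apply: (@measurable_fun_fubini_tonelli_F _ _ _ _ _ _ (fun p => f (affine_tuple a b (@tuple_cons R n p)))) => // x; exact: f0.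
have H0 x : 0 <= H x by apply: integral_ge0.
rewrite -/G -/H (@ge0_integral_affine1 a (thead b) G)// exprS EFinM -muleA; congr (_ * _).
rewrite -ge0_integralZl//.
apply: eq_integral => x _; rewrite /G (ih b')//; last first.
  exact: (measurableT_comp mc (@pair1_measurable _ _ _ _ (affine1 a (thead b) x))).
congr (_ * _); apply: eq_integral => t _; congr f.
apply: eq_from_tnth => i; rewrite tnth_mktuple.
case: (unliftP ord0 i) => [j|] ->.
- rewrite /tuple_cons/= !tnthS tnth_mktuple tnth_behead.
  congr (affine1 _ (tnth _ _) _); apply: val_inj.
  by rewrite /= inordK// ltnS ltn_ord.
- by [].
- by move=> y _; exact: H0.
Qed.

Lemma integral_inv_oneDsq : \int[lam]_x ((1 + x ^+ 2)^-1)%:E = (@pi R)%:E.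
Proof.
rewrite ge0_symfun_integralT; last 3 first.
- by move=> x; rewrite invr_ge0 ltW// oneDsq_gt0.
- exact: continuous_oneDsqrV.
- by move=> x /=; rewrite sqrrN.
have := integral0y_oneDsqr R; rewrite set_itvcy => ->.
by rewrite -EFinM mulrCA divff// mulr1.
Qed.

End LebesgueTuple.

(** * Integrals of decaying functions *)

Section Integral.
Variables (R : realType) (d : nat).
Local Notation V := 'rV[R]_d.
Local Notation C := R[i].
Local Notation T1 := (measurableTypeR R).
Local Notation lam := (lebesgue_tuple R d).
Implicit Types (f g F : V -> C) (u v : V -> R) (x y z : V).

Definition rintegral u : R := \int[lam]_t u (row_of t).

Lemma measurable_row_of u : continuous u ->
  measurable_fun [set: d.-tuple T1] (fun t => u (row_of t)).
Proof.
move=> cu; apply: (measurable_continuous_rV (q := @row_of R d)) cu => i.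
rewrite (_ : (fun _ => _) = (@tnth _ T1 ^~ i)); first exact: measurable_tnth.
by apply/funext => t; rewrite mxE.
Qed.

Definition rintegrable u : Prop := lam.-integrable setT (fun t => (u (row_of t))%:E).

End Integral.

Section WeightIntegrable.
Variable R : realType.
Local Notation T1 := (measurableTypeR R).

Lemma integral_weight n :
  (\int[lebesgue_tuple R n]_t (weight (@row_of R n t))%:E = ((@pi R) ^+ n)%:E)%E.
Proof.
elim: n => [|n ih].
  rewrite (eq_integral (fun=> 1%E)); last first.
    by move=> t _; rewrite /weight big_ord0.
  by rewrite integral_cst//= diracE mem_set// mul1e.
rewrite ge0_integral_tuple_cons; last 2 first.
- by apply/measurable_EFinP; apply: measurable_row_of; exact: weight_cont.
- by move=> t; rewrite lee_fin weight_ge0.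
have E x : (\int[lebesgue_tuple R n]_t (weight (row_of (tuple_cons (x, t))))%:E =
    ((1 + x ^+ 2)^-1)%:E * ((@pi R) ^+ n)%:E)%E.
  rewrite -ih -ge0_integralZl//; last 3 first.
  - apply/measurable_EFinP; apply: measurable_row_of; exact: weight_cont.
  - by move=> t _; rewrite lee_fin weight_ge0.
  - by rewrite lee_fin invr_ge0 ltW// oneDsq_gt0.
  apply: eq_integral => t _; rewrite -EFinM; congr (_%:E).
  rewrite /weight big_ord_recl mxE; congr (_ * _).
  by apply: eq_bigr => i _; rewrite !mxE /tuple_cons/= tnthS.
under eq_integral do rewrite E.
rewrite ge0_integralZr//; last 3 first.
- apply/measurable_EFinP; exact: (continuous_measurable_fun (@continuous_oneDsqrV R)).
- by move=> x _; rewrite lee_fin invr_ge0 ltW// oneDsq_gt0.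
- by rewrite lee_fin exprn_ge0// pi_ge0.
by rewrite integral_inv_oneDsq -EFinM -exprS.
Qed.

End WeightIntegrable.

Section Integral2.
Variables (R : realType) (d : nat).
Local Notation V := 'rV[R]_d.
Local Notation C := R[i].
Local Notation T1 := (measurableTypeR R).
Local Notation lam := (lebesgue_tuple R d).
Implicit Types (f g F : V -> C) (u v : V -> R) (x y z : V).

Lemma rintegrable_weight : rintegrable (@weight R d).
Proof.
apply/integrableP; split.
  by apply/measurable_EFinP; apply: measurable_row_of; exact: weight_cont.
under eq_integral do rewrite gee0_abs ?lee_fin ?weight_ge0//.
by rewrite integral_weight ltry.
Qed.

Lemma rintegrable_le u v : continuous u -> rintegrable v ->
  (forall x, `|u x| <= v x) -> rintegrable u.
Proof.
move=> cu iv uv; apply: le_integrable iv => //.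
  by apply/measurable_EFinP; exact: measurable_row_of.
by move=> t _; rewrite lee_fin (le_trans (uv _))// ler_norm.
Qed.

Lemma rintegrable_scale (a : R) u : rintegrable u -> rintegrable (fun x => a * u x).
Proof.
move=> iu; rewrite /rintegrable (_ : (fun _ => _) = (fun t => a%:E * (u (row_of t))%:E)%E).
  exact: integrableZl.
by apply/funext => t; rewrite EFinM.
Qed.

Lemma rintegrable_add u v : rintegrable u -> rintegrable v ->
  rintegrable (fun x => u x + v x).
Proof.
move=> iu iv; rewrite /rintegrable.
rewrite (_ : (fun _ => _) = (fun t => (u (row_of t))%:E + (v (row_of t))%:E)%E).
  exact: integrableD.
by apply/funext => t; rewrite EFinD.
Qed.

Lemma rintegral_scale (a : R) u : rintegrable u ->
  rintegral (fun x => a * u x) = a * rintegral u.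
Proof. by move=> iu; rewrite /rintegral RintegralZl. Qed.

Lemma rintegral_add u v : rintegrable u -> rintegrable v ->
  rintegral (fun x => u x + v x) = rintegral u + rintegral v.
Proof. by move=> iu iv; rewrite /rintegral RintegralD. Qed.

Lemma rintegral_le u v : rintegrable u -> rintegrable v ->
  (forall x, u x <= v x) -> rintegral u <= rintegral v.
Proof. by move=> iu iv uv; apply: le_Rintegral. Qed.

Lemma rintegral_ge0 u : (forall x, 0 <= u x) -> 0 <= rintegral u.
Proof. by move=> u0; apply: Rintegral_ge0. Qed.

Lemma rintegral_weight_ge0 : 0 <= rintegral (@weight R d).
Proof. by apply: rintegral_ge0 => x; exact: weight_ge0. Qed.

Lemma rintegral_EFin u : rintegrable u ->
  (\int[lam]_t (u (row_of t))%:E = (rintegral u)%:E)%E.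
Proof. by move=> iu; rewrite /rintegral fineK// integrable_fin_num. Qed.

(** A nonnegative function stays above [u 0 / 2] on a box of positive volume. *)
Lemma rintegral_gt0 u : continuous u -> rintegrable u -> (forall x, 0 <= u x) ->
  0 < u 0 -> 0 < rintegral u.
Proof.
move=> cu iu u0 u00.
have /crP/(_ 0 (u 0 / 2)) := cu; rewrite divr_gt0// => -[//|r r0 Hr].
pose A := [set t : d.-tuple T1 | forall i : 'I_d, `](- (r / 2)), (r / 2)[%classic (tnth t i)].
have mA : measurable A.
  rewrite (_ : A = \bigcap_(i in [set: 'I_d])
      ((@tnth d T1)^~ i @^-1` `](- (r / 2)), (r / 2)[%classic)).
    apply: fin_bigcap_measurable => // i _; rewrite -[X in measurable X]setTI.
    by apply: measurable_tnth => //; exact: measurable_itv.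
  by apply/seteqP; split => [t H i _|t H i]; exact: H.
have lamA : lam A = (r ^+ d)%:E.
  rewrite (lebesgue_tuple_box (A := fun=> `](- (r / 2)), (r / 2)[%classic))//.
  rewrite lebesgue_measure_itv/= lte_fin gtrN ?divr_gt0// -EFinB opprK -splitr.
  by rewrite prodEFin prodr_const card_ord.
have uA t : A t -> u 0 / 2 <= u (row_of t).
  move=> At; have := Hr (row_of t); rewrite subr0.
  have rt : `|row_of t| < r.
    apply: (@le_lt_trans _ _ (r / 2)); last by rewrite ltr_pdivrMr// mulr2n mulrDr mulr1 ltrDl.
    apply: rv_norm_le => [|i]; first by rewrite divr_ge0// ltW.
    have := At i; rewrite /= in_itv/= mxE ler_norml => /andP[a b].
    by rewrite (ltW a) (ltW b).
  by move=> /(_ rt); rewrite ltr_norml => /andP[+ _]; lra.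
have : ((u 0 / 2 * r ^+ d)%:E <= (rintegral u)%:E)%E.
  rewrite -rintegral_EFin// EFinM -lamA -integral_cst//.
  apply: (@le_trans _ _ (\int[lam]_(t in A) (u (row_of t))%:E)%E).
    apply: ge0_le_integral => //.
    - by move=> t _; rewrite lee_fin divr_ge0// ltW.
    - by apply: measurable_funTS; apply/measurable_EFinP; exact: measurable_row_of.
  apply: ge0_subset_integral => //.
  - by apply/measurable_EFinP; exact: measurable_row_of.
  - by move=> t _; rewrite lee_fin.
by rewrite lee_fin; apply: lt_le_trans; rewrite mulr_gt0 ?divr_gt0// exprn_gt0.
Qed.

Lemma rintegral_affine (a : R) (b : V) u : a != 0 -> continuous u -> rintegrable u ->
  rintegral u = `|a| ^+ d * rintegral (fun x => u (a *: x + b)).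
Proof.
move=> a0 cu iu.
have mu := measurable_row_of cu.
pose b' : d.-tuple T1 := [tuple b 0 i | i < d].
have bE t : row_of (affine_tuple a b' t) = a *: row_of t + b.
  by apply/rowP => i; rewrite !mxE !tnth_mktuple.
pose w t : \bar R := (u (row_of t))%:E.
have mw : measurable_fun setT w by exact/measurable_EFinP.
have an : `|a| ^+ d != 0 by rewrite expf_neq0// normr_eq0.
have fin w' : measurable_fun setT w' -> (forall t, 0 <= w' t)%E ->
    (forall t, w' t <= `|w t|)%E ->
    fine (\int[lam]_t w' t) = `|a| ^+ d * fine (\int[lam]_t w' (affine_tuple a b' t)) /\
    (\int[lam]_t w' t)%E \is a fin_num /\
    (\int[lam]_t w' (affine_tuple a b' t))%E \is a fin_num.
  move=> mw' w'0 w'w.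
  have f1 : (\int[lam]_t w' t)%E \is a fin_num.
    apply: integrable_fin_num => //; apply: le_integrable iu => // t _.
    by rewrite gee0_abs.
  have E := ge0_integral_affine_tuple b' a0 mw' w'0.
  have f2 : (\int[lam]_t w' (affine_tuple a b' t))%E \is a fin_num.
    have c0 : (0%R < (`|a| ^+ d)%:E)%E by rewrite lte_fin exprn_gt0// normr_gt0.
    by move: f1; rewrite E; case: (\int[lam]_t _)%E => //; rewrite ?gt0_muley ?gt0_muleNy.
  by split; [rewrite E fineM|split].
rewrite /rintegral /Rintegral integralE [in RHS]integralE.
have wp t : (w^\+ t <= `|w t|)%E.
  by rewrite -/((abse \o w) t) fune_abse leeDl// funeneg_ge0.
have wn t : (w^\- t <= `|w t|)%E.
  by rewrite -/((abse \o w) t) fune_abse leeDr// funepos_ge0.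
have [E1 [f1 g1]] := fin _ (measurable_funepos mw) (funepos_ge0 w) wp.
have [E2 [f2 g2]] := fin _ (measurable_funeneg mw) (funeneg_ge0 w) wn.
rewrite fineB// E1 E2 -mulrBr -fineB//.
by congr (_ * fine (_ - _)%E); apply: eq_integral => t _;
  rewrite /w ?funeposE ?funenegE/= bE.
Qed.

End Integral2.

(** ** Complex-valued decaying functions *)

Section ComplexIntegral.
Variables (R : realType) (d : nat).
Local Notation V := 'rV[R]_d.
Local Notation C := R[i].
Local Notation T1 := (measurableTypeR R).
Local Notation lam := (lebesgue_tuple R d).
Implicit Types (f g F : V -> C) (u v : V -> R) (x y z : V).

(** Continuity provides measurability and the weight integrability, so
    integrals of such functions obey all the usual rules. *)
Definition decaying f : Prop := continuous (f : V -> (C : numFieldType)) /\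
  exists a : R, forall x, cabs (f x) <= a * weight x.

Lemma decaying_cont f : decaying f -> continuous (f : V -> (C : numFieldType)).
Proof. by case. Qed.

Lemma decaying_lin (a : C) f g : decaying f -> decaying g ->
  decaying (fun x => a * f x + g x).
Proof.
move=> [cf [b Hb]] [cg [c Hc]]; split.
  exact: (cc_add (cc_mul (@cc_cst _ _ a) cf) cg).
exists (cabs a * b + c) => x; rewrite mulrDl (le_trans (cabsD _ _))// lerD//.
by rewrite cabsM -mulrA ler_wpM2l ?cabs_ge0.
Qed.

Lemma decaying_mul f g (b : R) : decaying f ->
  continuous (g : V -> (C : numFieldType)) -> (forall x, cabs (g x) <= b) ->
  decaying (fun x => f x * g x).
Proof.
move=> [cf [a Ha]] cg gb; split; first exact: cc_mul cf cg.
exists (a * b) => x; rewrite cabsM mulrAC ler_pM ?cabs_ge0//.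
Qed.

Lemma decaying_ccont f : ccont f -> decaying f.
Proof.
move=> cf; split; first exact: ccont_cont.
have [M M0 HM] := ccont_bounded cf; have /ccontE[_ [r Hr]] := cf.
exists (M * (1 + r ^+ 2) ^+ d) => x.
have [xr|xr] := leP `|x| r.
  rewrite -mulrA -[leLHS]mulr1 ler_pM ?cabs_ge0//.
  exact: weight_ball.
rewrite Hr// cabs0 mulr_ge0 ?weight_ge0// mulr_ge0 ?(ltW M0)// exprn_ge0//.
by rewrite ltW// oneDsq_gt0.
Qed.

Lemma decaying_zero : decaying ((fun=> 0) : V -> C).
Proof. exact/decaying_ccont/ccont_zero. Qed.

Lemma decaying_scale (a : C) f : decaying f -> decaying (fun x => a * f x).
Proof.
move=> df; rewrite (_ : (fun _ => _) = (fun x => a * f x + (fun=> 0) x)).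
  by apply: decaying_lin df _; exact: decaying_zero.
by apply/funext => x; rewrite addr0.
Qed.

Lemma decaying_sub f g : decaying f -> decaying g -> decaying (fun x => f x - g x).
Proof.
move=> df dg; rewrite (_ : (fun _ => _) = (fun x => -1 * g x + f x)).
  exact: decaying_lin dg df.
by apply/funext => x; rewrite mulN1r addrC.
Qed.

Lemma decaying_integrable f u (a : R) : continuous u ->
  (forall x, cabs (f x) <= a * weight x) -> (forall x, `|u x| <= cabs (f x)) ->
  rintegrable u.
Proof.
move=> cu fa uf; apply: (rintegrable_le cu (rintegrable_scale a (@rintegrable_weight R d))).
by move=> x; exact: le_trans (uf x) (fa x).
Qed.

Lemma decaying_re f : decaying f -> rintegrable (fun x => complex.Re (f x)).
Proof.
move=> [cf [a Ha]]; apply: (decaying_integrable _ Ha); first exact: cc_re.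
by move=> x; exact: cabs_re.
Qed.

Lemma decaying_im f : decaying f -> rintegrable (fun x => complex.Im (f x)).
Proof.
move=> [cf [a Ha]]; apply: (decaying_integrable _ Ha); first exact: cc_im.
by move=> x; exact: cabs_im.
Qed.

Lemma decaying_cabs f : decaying f -> rintegrable (fun x => cabs (f x)).
Proof.
move=> [cf [a Ha]]; apply: (decaying_integrable _ Ha); first exact: cc_cabs.
by move=> x; rewrite ger0_norm// cabs_ge0.
Qed.

Lemma cintegralE f : cintegral f =
  rintegral (fun x => complex.Re (f x)) +i* rintegral (fun x => complex.Im (f x)).
Proof. by []. Qed.

Lemma rintegral_sub u v : rintegrable u -> rintegrable v ->
  rintegral (fun x => u x - v x) = rintegral u - rintegral v.
Proof. by move=> iu iv; rewrite /rintegral RintegralB. Qed.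

Lemma cintegral_lin (a : C) f g : decaying f -> decaying g ->
  cintegral (fun x => a * f x + g x) = a * cintegral f + cintegral g.
Proof.
move=> df dg; rewrite !cintegralE.
have rf := decaying_re df; have jf := decaying_im df.
have rg := decaying_re dg; have jg := decaying_im dg.
apply: complex_eq.
  rewrite cReD cReM /= -!rintegral_scale// -rintegral_sub; [|exact: rintegrable_scale..].
  rewrite -rintegral_add//.
    by congr rintegral; apply/funext => x; rewrite cReD cReM.
  rewrite (_ : (fun _ => _) = (fun x => complex.Re a * complex.Re (f x) +
      - complex.Im a * complex.Im (f x))).
    by apply: rintegrable_add; exact: rintegrable_scale.
  by apply/funext => x; rewrite mulNr.
rewrite cImD cImM /= -!rintegral_scale// -rintegral_add; [|exact: rintegrable_scale..].
rewrite -rintegral_add//.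
  by congr rintegral; apply/funext => x; rewrite cImD cImM.
by apply: rintegrable_add; exact: rintegrable_scale.
Qed.

Lemma cintegral_zero : cintegral ((fun=> 0) : V -> C) = 0.
Proof.
rewrite cintegralE /rintegral !Rintegral_cst//= !mul0r//.
Qed.

Lemma cintegral_scale (a : C) f : decaying f ->
  cintegral (fun x => a * f x) = a * cintegral f.
Proof.
move=> df; rewrite -[RHS]addr0 -cintegral_zero -cintegral_lin//; last exact: decaying_zero.
by congr cintegral; apply/funext => x; rewrite addr0.
Qed.

Lemma cintegral_add f g : decaying f -> decaying g ->
  cintegral (fun x => f x + g x) = cintegral f + cintegral g.
Proof.
move=> df dg; rewrite -[cintegral f]mul1r -cintegral_lin//.
by congr cintegral; apply/funext => x; rewrite mul1r.
Qed.

Lemma cintegral_sub f g : decaying f -> decaying g ->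
  cintegral (fun x => f x - g x) = cintegral f - cintegral g.
Proof.
move=> df dg; rewrite addrC -mulN1r -cintegral_lin//.
by congr cintegral; apply/funext => x; rewrite mulN1r addrC.
Qed.

Lemma cintegral_conj f : decaying f ->
  cintegral (fun x => (f x)^*) = (cintegral f)^*.
Proof.
move=> df; rewrite !cintegralE; apply: complex_eq => /=.
  by congr rintegral; apply/funext => x; case: (f x).
rewrite -mulN1r -rintegral_scale; last exact: decaying_im.
by congr rintegral; apply/funext => x; rewrite mulN1r; case: (f x).
Qed.

(** Rotate [f] so that its integral becomes real. *)
Lemma cabs_cintegral f : decaying f ->
  cabs (cintegral f) <= rintegral (fun x => cabs (f x)).
Proof.
move=> df; have [u u1 uE] := phase (cintegral f).
have duf : decaying (fun x => u * f x) by exact: decaying_scale.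
have := congr1 (@complex.Re R) uE; rewrite -cintegral_scale// cintegralE /= => <-.
apply: rintegral_le; [exact: decaying_re duf|exact: decaying_cabs|].
move=> x; rewrite (le_trans (ler_norm _))// (le_trans (cabs_re _))//.
by rewrite cabsM u1 mul1r.
Qed.

Lemma cintegral_le f u : decaying f -> rintegrable u ->
  (forall x, cabs (f x) <= u x) -> cabs (cintegral f) <= rintegral u.
Proof.
move=> df iu fu; apply: le_trans (cabs_cintegral df) _.
by apply: rintegral_le; [exact: decaying_cabs|exact: iu|].
Qed.

Lemma cintegral_bound f (a : R) : continuous (f : V -> (C : numFieldType)) ->
  (forall x, cabs (f x) <= a * weight x) ->
  cabs (cintegral f) <= a * rintegral (@weight R d).
Proof.
move=> cf fa; rewrite -rintegral_scale; last exact: rintegrable_weight.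
have df : decaying f by split; [exact: cf|exists a].
by apply: (cintegral_le df _ fa); apply: rintegrable_scale; exact: rintegrable_weight.
Qed.

Lemma cintegral_affine (a : R) (b : V) f : a != 0 -> decaying f ->
  cintegral f = (`|a| ^+ d)%:C * cintegral (fun x => f (a *: x + b)).
Proof.
move=> a0 df; rewrite !cintegralE; apply: complex_eq.
  rewrite cReM /= mul0r subr0.
  exact: (rintegral_affine b a0 (cc_re (decaying_cont df)) (decaying_re df)).
rewrite cImM /= mul0r addr0.
exact: (rintegral_affine b a0 (cc_im (decaying_cont df)) (decaying_im df)).
Qed.

Lemma cintegral_shift (b : V) f : decaying f ->
  cintegral (fun x => f (x + b)) = cintegral f.
Proof.
move=> df; rewrite [RHS](cintegral_affine b (oner_neq0 R) df) normr1 expr1n mul1r.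
by congr cintegral; apply/funext => x; rewrite scale1r.
Qed.

Lemma cintegral_reflect (b : V) f : decaying f ->
  cintegral (fun x => f (b - x)) = cintegral f.
Proof.
have n1 : -1 != 0 :> R by rewrite oppr_eq0 oner_neq0.
move=> df; rewrite [RHS](cintegral_affine b n1 df) normrN normr1 expr1n mul1r.
by congr cintegral; apply/funext => x; rewrite scaleN1r addrC.
Qed.

End ComplexIntegral.

Section Fubini.
Variables (R : realType) (d : nat).
Local Notation V := 'rV[R]_d.
Local Notation C := R[i].
Local Notation T1 := (measurableTypeR R).
Local Notation lam := (lebesgue_tuple R d).

Lemma pair_norm (p : V * V) : `|p| = Num.max `|p.1| `|p.2|.
Proof. by []. Qed.

Lemma continuous_row_mx (u : V -> V -> R) :
  continuous (fun p : V * V => u p.1 p.2) ->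
  continuous (fun z : 'rV[R]_(d + d) => u (lsubmx z) (rsubmx z)).
Proof.
move=> cu; apply/crP => z e e0.
have /crP/(_ (lsubmx z, rsubmx z) e e0)[r r0 Hr] := cu.
exists r => // z' z'z; apply: (Hr (lsubmx z', rsubmx z')).
have lz : `|lsubmx z' - lsubmx z| <= `|z' - z|.
  apply: rv_norm_le => // i; rewrite !mxE.
  by have := rv_coord (z' - z) (lshift d i); rewrite !mxE.
have rz : `|rsubmx z' - rsubmx z| <= `|z' - z|.
  apply: rv_norm_le => // i; rewrite !mxE.
  by have := rv_coord (z' - z) (rshift d i); rewrite !mxE.
rewrite pair_norm gt_max.
by rewrite (le_lt_trans lz)// (le_lt_trans rz).
Qed.

Lemma measurable_row_of2 (u : V -> V -> R) :
  continuous (fun p : V * V => u p.1 p.2) ->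
  measurable_fun [set: d.-tuple T1 * d.-tuple T1]
    (fun p => u (row_of p.1) (row_of p.2)).
Proof.
move=> cu; pose q (p : d.-tuple T1 * d.-tuple T1) : 'rV[R]_(d + d) :=
  row_mx (row_of p.1) (row_of p.2).
have := measurable_continuous_rV (q := q) _ (continuous_row_mx cu).
rewrite (_ : (fun x => _) = (fun p => u (row_of p.1) (row_of p.2))); last first.
  by apply/funext => p; rewrite /q row_mxKl row_mxKr.
apply => i; case: (splitP i) => j ij.
  rewrite (_ : (fun _ => _) = (@tnth d T1 ^~ j) \o fst).
    by apply: measurableT_comp => //; exact: measurable_tnth.
  apply/funext => p; rewrite /q (_ : i = lshift d j) ?row_mxEl ?mxE//.
  exact: val_inj.
rewrite (_ : (fun _ => _) = (@tnth d T1 ^~ j) \o snd).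
  by apply: measurableT_comp => //; exact: measurable_tnth.
apply/funext => p; rewrite /q (_ : i = rshift d j) ?row_mxEr ?mxE//.
exact: val_inj.
Qed.

Lemma rintegral_fubini (u : V -> V -> R) (a : R) :
  continuous (fun p : V * V => u p.1 p.2) ->
  (forall x y, `|u x y| <= a * weight x * weight y) ->
  rintegral (fun x => rintegral (u x)) = rintegral (fun y => rintegral (u ^~ y)).
Proof.
move=> cu ua.
have mu := measurable_row_of2 cu.
pose f (p : d.-tuple T1 * d.-tuple T1) : \bar R := (u (row_of p.1) (row_of p.2))%:E.
have mf : measurable_fun setT f by exact/measurable_EFinP.
have c1 x : continuous (u x).
  apply/crP => y e e0; have /crP/(_ (x, y) e e0)[r r0 Hr] := cu.
  exists r => // y' y'y; apply: (Hr (x, y')).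
  have -> : (x, y') - (x, y) = (0, y' - y) :> V * V by congr pair; exact: subrr.
  by rewrite pair_norm gt_max /= normr0 r0.
have c2 y : continuous (u ^~ y).
  apply/crP => x e e0; have /crP/(_ (x, y) e e0)[r r0 Hr] := cu.
  exists r => // x' x'x; apply: (Hr (x', y)).
  have -> : (x', y) - (x, y) = (x' - x, 0) :> V * V by congr pair; exact: subrr.
  by rewrite pair_norm gt_max /= normr0 r0 andbT.
have i1 x : rintegrable (u x).
  apply: (rintegrable_le (c1 x) (rintegrable_scale (a * weight x) (@rintegrable_weight R d))).
  exact: ua.
have i2 y : rintegrable (u ^~ y).
  apply: (rintegrable_le (c2 y) (rintegrable_scale (a * weight y) (@rintegrable_weight R d))).
  by move=> x; rewrite mulrAC; exact: ua.
have intf : (lam \x lam)%E.-integrable setT f.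
  apply/(integrable12ltyP _ _ mf).
  have i3 x : rintegrable (fun y => `|u x y|).
    apply: (rintegrable_le _ (rintegrable_scale (a * weight x) (@rintegrable_weight R d))).
      exact: (cr_comp (c1 x) (@norm_continuous _ _)).
    by move=> y; rewrite normr_id; exact: ua.
  have i4 : rintegrable (fun x : V => a * rintegral (@weight R d) * weight x).
    by apply: rintegrable_scale; exact: rintegrable_weight.
  apply: (@le_lt_trans _ _ (\int[lam]_x (a * rintegral (@weight R d) * weight (row_of x))%:E)%E).
    apply: ge0_le_integral => //.
    - by move=> x _; apply: integral_ge0.
    - have mabs : measurable_fun setT (abse \o f) by apply: measurableT_comp.
      have abs0 p : (0 <= (abse \o f) p)%E by exact: abse_ge0.
      exact: (@measurable_fun_fubini_tonelli_F _ _ _ _ _ lam _ mabs abs0).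
    - by case/integrableP: i4.
    - move=> x _; rewrite (rintegral_EFin (i3 (row_of x))) lee_fin mulrAC.
      rewrite -rintegral_scale; last exact: rintegrable_weight.
      apply: rintegral_le; [exact: i3| |exact: ua].
      by apply: rintegrable_scale; exact: rintegrable_weight.
  by rewrite (rintegral_EFin i4) ltry.
have E1 x : (\int[lam]_y f (x, y) = (rintegral (u (row_of x)))%:E)%E.
  exact: rintegral_EFin.
have E2 y : (\int[lam]_x f (x, y) = (rintegral (u ^~ (row_of y)))%:E)%E.
  exact: (rintegral_EFin (i2 (row_of y))).
have := Fubini intf.
under eq_integral do rewrite E1.
under [in RHS]eq_integral do rewrite E2.
by move=> H; rewrite /rintegral /Rintegral [X in fine X]H.
Qed.

Lemma cintegral_fubini (F : V -> V -> C) (a : R) :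
  continuous ((fun p : V * V => F p.1 p.2) : V * V -> (C : numFieldType)) ->
  (forall x y, cabs (F x y) <= a * weight x * weight y) ->
  cintegral (fun x => cintegral (F x)) = cintegral (fun y => cintegral (F ^~ y)).
Proof.
move=> cF Fa; apply: complex_eq => /=.
  apply: (@rintegral_fubini (fun x y => complex.Re (F x y)) a); first exact: cc_re cF.
  by move=> x y; apply: le_trans (Fa x y); exact: cabs_re.
apply: (@rintegral_fubini (fun x y => complex.Im (F x y)) a); first exact: cc_im cF.
by move=> x y; apply: le_trans (Fa x y); exact: cabs_im.
Qed.

End Fubini.

(** * Partial derivatives of complex functions *)

Section RealDerivative.
Variable R : realType.

Lemma is_derive_small (V : normedModType R) (f : V -> R) x v l :
  (forall e : R, 0 < e -> exists2 r : R, 0 < r & forall h : R, `|h| < r ->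
     `|f (x + h *: v) - f x - h * l| <= e * `|h|) -> is_derive x v f l.
Proof.
move=> H.
have L : (fun h : R => h^-1 *: ((f \o shift x) (h *: v) - f x)) @ 0^' --> l.
  apply/cvgrPdist_le => e e0; have [r r0 Hr] := H e e0.
  near=> h; have h0 : h != 0 by near: h; exact: nbhs_dnbhs_neq.
  have hr : `|h| < r by near: h; exact: dnbhs0_lt.
  rewrite /= distrC (_ : h *: v + x = x + h *: v); last by rewrite addrC.
  have -> : h^-1 *: (f (x + h *: v) - f x) - l = h^-1 * (f (x + h *: v) - f x - h * l).
    by rewrite /GRing.scale/=; field.
  by rewrite normrM normfV mulrC ler_pdivrMr ?normr_gt0// Hr.
apply: DeriveDef; first by apply/cvg_ex; exists l.
exact: cvg_lim L.
Unshelve. all: by end_near.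
Qed.

Lemma is_derive_line (V : normedModType R) (f : V -> R) x v l (s : R) :
  is_derive (x + s *: v) v f l -> is_derive s 1 (fun t : R => f (x + t *: v)) l.
Proof.
move=> [+ <-]; rewrite /derivable /derive => H.
have E : (fun h : R => h^-1 *: (((fun t : R => f (x + t *: v)) \o shift s) (h *: 1) -
      f (x + s *: v))) =
    (fun h : R => h^-1 *: ((f \o shift (x + s *: v)) (h *: v) - f (x + s *: v))).
  apply/funext => h /=; congr (_ *: (f _ - _)).
  by rewrite (_ : h *: (1 : R) = h) ?scalerDl 1?addrCA// /GRing.scale/= mulr1.
apply: DeriveDef; first by rewrite /derivable E.
by rewrite /derive E.
Qed.

Lemma line_is_derive (V : normedModType R) (f : V -> R) x v l :
  is_derive (0 : R) (1 : R) (fun t : R => f (x + t *: v)) l -> is_derive x v f l.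
Proof.
move=> [+ <-]; rewrite /derivable /derive => H.
have E : (fun h : R => h^-1 *: (((fun t : R => f (x + t *: v)) \o shift (0 : R)) (h *: (1 : R)) -
      f (x + (0 : R) *: v))) =
    (fun h : R => h^-1 *: ((f \o shift x) (h *: v) - f x)).
  apply/funext => h /=; rewrite scale0r !addr0 [x + _]addrC.
  by rewrite (_ : h *: (1 : R) = h)// /GRing.scale/= mulr1.
by apply: DeriveDef; rewrite /derivable /derive -E.
Qed.

Lemma mean_value (f df : R -> R) (a b : R) :
  (forall x : R, is_derive x (1 : R) f (df x)) ->
  exists c, [/\ `|c - a| <= `|b - a| & f b - f a = df c * (b - a)].
Proof.
move=> H.
have cf : continuous f.
  by move=> x; apply/differentiable_continuous/derivable1_diffP; have [] := H x.
have aux (u v : R) : u <= v -> exists2 c, c \in `[u, v] & f v - f u = df c * (v - u).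
  by move=> uv; apply: MVT_segment => //; exact: continuous_subspaceT.
case: (leP a b) => [ab|/ltW ba].
  have [c] := aux _ _ ab; rewrite in_itv/= => /andP[ac cb] E; exists c; split => //.
  by rewrite !ger0_norm; lra.
have [c] := aux _ _ ba; rewrite in_itv/= => /andP[bc ca] E; exists c; split.
  by rewrite !ler0_norm; lra.
by rewrite -[LHS]opprB E -mulrN opprB.
Qed.

Lemma taylor2 (f df ddf : R -> R) (s M : R) :
  (forall x : R, is_derive x (1 : R) f (df x)) -> (forall x : R, is_derive x (1 : R) df (ddf x)) ->
  (forall t, `|t| <= `|s| -> `|ddf t| <= M) ->
  `|f s - f 0 - s * df 0| <= M * s ^+ 2.
Proof.
move=> H1 H2 HM.
have [c [cs E1]] := mean_value 0 s H1; have [b [bc E2]] := mean_value 0 c H2.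
rewrite !subr0 in cs E1 bc E2.
have -> : f s - f 0 - s * df 0 = ddf b * c * s.
  by rewrite E1 -E2; ring.
rewrite !normrM -[s ^+ 2]real_normK ?num_real// expr2 mulrA ler_wpM2r//.
by rewrite ler_pM// HM// (le_trans bc).
Qed.

End RealDerivative.

Section PartialDerivative.
Variables (R : realType) (d : nat).
Local Notation V := 'rV[R]_d.
Local Notation C := R[i].
Implicit Types (f g F : V -> C) (u v : V -> R) (x y z : V) (i j : 'I_d).

Local Notation ei i := (delta_mx 0 i : V).

Definition has_pderiv i f x (l : C) : Prop :=
  is_derive x (ei i) (fun y => complex.Re (f y)) (complex.Re l) /\
  is_derive x (ei i) (fun y => complex.Im (f y)) (complex.Im l).

Definition pderivable i f x : Prop :=
  derivable (fun y => complex.Re (f y)) x (ei i) /\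
  derivable (fun y => complex.Im (f y)) x (ei i).

Lemma has_pderiv_val i f x l : has_pderiv i f x l -> pderiv i f x = l.
Proof. by move=> [[_ h1] [_ h2]]; apply: complex_eq. Qed.

Lemma has_pderiv_able i f x l : has_pderiv i f x l -> pderivable i f x.
Proof. by move=> [[h1 _] [h2 _]]. Qed.

Lemma pderivableP i f x : pderivable i f x -> has_pderiv i f x (pderiv i f x).
Proof. by move=> [h1 h2]; split; apply: DeriveDef. Qed.

Lemma has_pderiv_small i f x l :
  (forall e : R, 0 < e -> exists2 r : R, 0 < r & forall h : R, `|h| < r ->
     cabs (f (x + h *: ei i) - f x - h%:C * l) <= e * `|h|) -> has_pderiv i f x l.
Proof.
move=> H; split; apply: is_derive_small => e /H[r r0 Hr]; exists r => // h /Hr;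
  apply: le_trans.
  by rewrite (le_trans _ (cabs_re _))// !(cReD, cReN, cReM)/= mul0r subr0.
by rewrite (le_trans _ (cabs_im _))// !(cImD, cImN, cImM)/= mul0r addr0.
Qed.

Lemma has_pderiv_quad i f x l (A : R) : (forall h : R, `|h| <= 1 ->
     cabs (f (x + h *: ei i) - f x - h%:C * l) <= A * h ^+ 2) -> has_pderiv i f x l.
Proof.
move=> H; apply: has_pderiv_small => e e0.
pose B := `|A| + 1; have B0 : 0 < B by rewrite ltr_wpDl.
exists (Num.min 1 (e / B)); first by rewrite lt_min ltr01 divr_gt0.
move=> h; rewrite lt_min => /andP[h1 he]; apply: le_trans (H _ (ltW h1)) _.
rewrite -(real_normK (num_real h)) expr2 mulrA ler_wpM2r//.
apply: (@le_trans _ _ (B * `|h|)).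
  by rewrite ler_wpM2r// (le_trans (ler_norm A))// lerDl.
by rewrite mulrC -ler_pdivlMr// ltW.
Qed.

Lemma has_pderiv_eq i f x l l' : has_pderiv i f x l -> l = l' -> has_pderiv i f x l'.
Proof. by move=> H <-. Qed.

Lemma has_pderiv_cst i (c : C) x : has_pderiv i (fun=> c) x 0.
Proof.
apply: (@has_pderiv_quad _ _ _ _ 0) => h _.
by rewrite mulr0 !subrr mul0r cabs0.
Qed.

Lemma has_pderiv_add i f g x k l : has_pderiv i f x k -> has_pderiv i g x l ->
  has_pderiv i (fun y => f y + g y) x (k + l).
Proof.
move=> [f1 f2] [g1 g2]; split.
  rewrite cReD (_ : (fun _ => _) =
    (fun y => complex.Re (f y)) + (fun y => complex.Re (g y))); first exact: is_deriveD.
  by apply/funext => y; rewrite cReD.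
rewrite cImD (_ : (fun _ => _) =
  (fun y => complex.Im (f y)) + (fun y => complex.Im (g y))); first exact: is_deriveD.
by apply/funext => y; rewrite cImD.
Qed.

Lemma has_pderiv_mul i f g x k l : has_pderiv i f x k -> has_pderiv i g x l ->
  has_pderiv i (fun y => f y * g y) x (k * g x + f x * l).
Proof.
move=> [f1 f2] [g1 g2]; split.
  rewrite (_ : (fun _ => _) =
    (fun y => complex.Re (f y)) * (fun y => complex.Re (g y)) -
    (fun y => complex.Im (f y)) * (fun y => complex.Im (g y))).
    apply: (is_derive_eq (is_deriveB (is_deriveM f1 g1) (is_deriveM f2 g2))).
    by rewrite cReD !cReM /GRing.scale/=; ring.
  by apply/funext => y; rewrite cReM.
rewrite (_ : (fun _ => _) =
  (fun y => complex.Re (f y)) * (fun y => complex.Im (g y)) +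
  (fun y => complex.Im (f y)) * (fun y => complex.Re (g y))).
  apply: (is_derive_eq (is_deriveD (is_deriveM f1 g2) (is_deriveM f2 g1))).
  by rewrite cImD !cImM /GRing.scale/=; ring.
by apply/funext => y; rewrite cImM.
Qed.

Lemma has_pderiv_scale i (a : C) f x k : has_pderiv i f x k ->
  has_pderiv i (fun y => a * f y) x (a * k).
Proof.
move=> H; apply: has_pderiv_eq (has_pderiv_mul (has_pderiv_cst i a x) H) _.
by rewrite mul0r add0r.
Qed.

Lemma has_pderiv_lin i (a : C) f g x k l : has_pderiv i f x k -> has_pderiv i g x l ->
  has_pderiv i (fun y => a * f y + g y) x (a * k + l).
Proof. by move=> H1 H2; apply: has_pderiv_add H2; exact: has_pderiv_scale. Qed.

Lemma has_pderiv_conj i f x k : has_pderiv i f x k ->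
  has_pderiv i (fun y => (f y)^*) x k^*.
Proof.
move=> [f1 f2]; split.
  rewrite (_ : (fun _ => _) = (fun y => complex.Re (f y))).
    by case: (k) f1.
  by apply/funext => y; case: (f y).
rewrite (_ : (fun _ => _) = - (fun y => complex.Im (f y))).
  by case: (k) f2 => a b /= f2; exact: is_deriveN.
apply/funext => y; transitivity (- complex.Im (f y)); last by [].
by case: (f y).
Qed.

Lemma has_pderiv_dilate i f x k (a : R) : has_pderiv i f (a *: x) k ->
  has_pderiv i (fun y => f (a *: y)) x (a%:C * k).
Proof.
have [->|a0] := eqVneq a 0.
  move=> _; rewrite mul0r (_ : (fun _ => _) = (fun=> f 0)); first exact: has_pderiv_cst.
  by apply/funext => y; rewrite scale0r.
have gen (u : V -> R) l : is_derive (a *: x) (ei i) u l ->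
    is_derive x (ei i) (fun y => u (a *: y)) (a * l).
  move=> H; have {}H : is_derive (a *: x + (0 : R) *: ei i) (ei i) u l.
    by rewrite scale0r addr0.
  have {}H := is_derive_line H.
  have H1 : is_derive (0 : R) (1 : R) (fun s : R => u (a *: x + (a * s) *: ei i)) (a * l).
    rewrite (_ : (fun s => _) = (fun t : R => u (a *: x + t *: ei i)) \o (fun s => a * s))//.
    have Ha : is_derive (0 : R) (1 : R) (fun s : R => a * s) a.
      apply: (is_derive_eq (is_deriveZ a (is_derive_id (0 : R) (1 : R)))).
      by rewrite /GRing.scale/= mulr1.
    have H0 : is_derive (a * 0) (1 : R) (fun t : R => u (a *: x + t *: ei i)) l.
      by rewrite mulr0.
    by apply: (is_derive_eq (is_derive1_comp H0 Ha)); rewrite mulrC.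
  apply: line_is_derive; rewrite (_ : (fun _ => _) = (fun s : R => u (a *: x + (a * s) *: ei i)))//.
  by apply/funext => s; rewrite scalerDr scalerA.
move=> [h1 h2]; split.
  by rewrite cReM /= mul0r subr0; exact: (gen (fun y => complex.Re (f y))).
by rewrite cImM /= mul0r addr0; exact: (gen (fun y => complex.Im (f y))).
Qed.

Lemma has_pderiv_coord i j (u : R -> R) (l : R) x : is_derive (x 0 j) 1 u l ->
  has_pderiv i (fun y => (u (y 0 j))%:C) x (if i == j then l%:C else 0).
Proof.
move=> H; case: eqVneq => [->|ij]; last first.
  apply: (@has_pderiv_quad _ _ _ _ 0) => h _.
  rewrite !mxE (eq_sym j) (negbTE ij) andbF mulr0 addr0 mulr0 !subrr cabs0.
  by rewrite mul0r.
split; last by apply: is_derive_eq; [exact: is_derive_cst|].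
have [h1 h2] := H.
have E : (fun h : R => h^-1 *: (((fun y : V => u (y 0 j)) \o shift x) (h *: ei j) - u (x 0 j))) =
    (fun h : R => h^-1 *: ((u \o shift (x 0 j)) (h *: 1) - u (x 0 j))).
  apply/funext => h /=; congr (_ *: (u _ - _)).
  by rewrite !mxE !eqxx /GRing.scale.
by apply: DeriveDef; [rewrite /derivable E|rewrite /derive E].
Qed.

End PartialDerivative.

(** * Smooth functions *)

Section Smooth.
Variables (R : realType) (d : nat).
Local Notation V := 'rV[R]_d.
Local Notation C := R[i].
Implicit Types (f g F : V -> C) (u v : V -> R) (x y z : V) (i j : 'I_d).
Local Notation ei i := (delta_mx 0 i : V).

(** Unlike [smooth], this differentiates [f] before iterating, so that
    closure properties follow by induction on [k]. *)
Fixpoint Ck (k : nat) f : Prop :=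
  continuous (f : V -> (C : numFieldType)) /\
  if k is k'.+1 then
    forall i, (forall x, pderivable i f x) /\ Ck k' (pderiv i f)
  else True.

Lemma pderivs_rcons s i f : pderivs (rcons s i) f = pderivs s (pderiv i f).
Proof. by rewrite /pderivs foldr_rcons. Qed.

Lemma smooth_cont f : smooth f -> continuous (f : V -> (C : numFieldType)).
Proof. by move=> /(_ [::])[]. Qed.

Lemma smooth_pderivable i f x : smooth f -> pderivable i f x.
Proof. by move=> /(_ [::])[_]; exact. Qed.

Lemma smooth_has_pderiv i f x : smooth f -> has_pderiv i f x (pderiv i f x).
Proof. by move=> sf; apply: pderivableP; exact: smooth_pderivable. Qed.

Lemma smooth_pderiv i f : smooth f -> smooth (pderiv i f).
Proof. by move=> sf s; have := sf (rcons s i); rewrite pderivs_rcons. Qed.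

Lemma smooth_pderivs s f : smooth f -> smooth (pderivs s f).
Proof.
elim/last_ind: s f => [|s i ih] f sf; first exact: sf.
by rewrite pderivs_rcons; apply: ih; exact: smooth_pderiv.
Qed.

Lemma smooth_Ck f : smooth f -> forall k, Ck k f.
Proof.
move=> sf k; elim: k f sf => [|k ih] f sf; (split; first exact: smooth_cont); first by [].
by move=> i; split => [x|]; [exact: smooth_pderivable|apply: ih; exact: smooth_pderiv].
Qed.

Lemma Ck_smooth f : (forall k, Ck k f) -> smooth f.
Proof.
move=> H s; elim/last_ind: s f H => [f H|s i ih f H].
  split; first exact: (H 0%N).1.
  by move=> i x; exact: ((H 1%N).2 i).1.
by rewrite pderivs_rcons; apply: ih => k; exact: ((H k.+1).2 i).2.
Qed.

Lemma Ck_le k f : Ck k.+1 f -> Ck k f.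
Proof.
elim: k f => [|k ih] f [cf H]; (split; first exact: cf); first by [].
by move=> i; have [h1 h2] := H i; split; [exact: h1|exact: ih].
Qed.

Lemma Ck_cst k (c : C) : Ck k (fun=> c).
Proof.
elim: k c => [|k ih] c; (split; first exact: cc_cst); first by [].
move=> i; split => [x|]; first exact: has_pderiv_able (has_pderiv_cst i c x).
rewrite (_ : pderiv i _ = fun=> 0); first exact: ih.
by apply/funext => x; apply: has_pderiv_val; exact: has_pderiv_cst.
Qed.

Lemma Ck_add k f g : Ck k f -> Ck k g -> Ck k (fun x => f x + g x).
Proof.
elim: k f g => [|k ih] f g [cf Hf] [cg Hg]; (split; first exact: cc_add cf cg); first by [].
move=> i; have [f1 f2] := Hf i; have [g1 g2] := Hg i.
have H x := has_pderiv_add (pderivableP (f1 x)) (pderivableP (g1 x)).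
split => [x|]; first exact: has_pderiv_able (H x).
rewrite (_ : pderiv i _ = fun x => pderiv i f x + pderiv i g x); first exact: ih.
by apply/funext => x; apply: has_pderiv_val; exact: H.
Qed.

Lemma Ck_mul k f g : Ck k f -> Ck k g -> Ck k (fun x => f x * g x).
Proof.
elim: k f g => [|k ih] f g Df Dg.
  by split; first exact: cc_mul Df.1 Dg.1.
have [cf Hf] := Df; have [cg Hg] := Dg; split; first exact: cc_mul cf cg.
move=> i; have [f1 f2] := Hf i; have [g1 g2] := Hg i.
have H x := has_pderiv_mul (pderivableP (f1 x)) (pderivableP (g1 x)).
split => [x|]; first exact: has_pderiv_able (H x).
rewrite (_ : pderiv i _ = fun x => pderiv i f x * g x + f x * pderiv i g x).
  by apply: Ck_add; [exact: (ih _ _ (f2) (Ck_le Dg))|exact: (ih _ _ (Ck_le Df) g2)].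
by apply/funext => x; apply: has_pderiv_val; exact: H.
Qed.

Lemma Ck_conj k f : Ck k f -> Ck k (fun x => (f x)^*).
Proof.
elim: k f => [|k ih] f [cf Hf]; (split; first exact: cc_conj cf); first by [].
move=> i; have [f1 f2] := Hf i.
have H x := has_pderiv_conj (pderivableP (f1 x)).
split => [x|]; first exact: has_pderiv_able (H x).
rewrite (_ : pderiv i _ = fun x => (pderiv i f x)^*); first exact: ih.
by apply/funext => x; apply: has_pderiv_val; exact: H.
Qed.

Lemma dilate_cont (a : R) : continuous (fun x : V => a *: x).
Proof. by move=> x; exact: scaler_continuous. Qed.

Lemma Ck_dilate k f (a : R) : Ck k f -> Ck k (fun x => f (a *: x)).
Proof.
elim: k f => [|k ih] f [cf Hf]; (split; first exact: (cc_comp (@dilate_cont a) cf)); first by [].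
move=> i; have [f1 f2] := Hf i.
have H x := has_pderiv_dilate (pderivableP (f1 (a *: x))).
split => [x|]; first exact: has_pderiv_able (H x).
rewrite (_ : pderiv i _ = fun x => a%:C * pderiv i f (a *: x)).
  by apply: Ck_mul; [exact: Ck_cst|exact: ih].
by apply/funext => x; apply: has_pderiv_val; exact: H.
Qed.

Lemma smooth_cst (c : C) : smooth ((fun=> c) : V -> C).
Proof. by apply: Ck_smooth => k; exact: Ck_cst. Qed.

Lemma smooth_add f g : smooth f -> smooth g -> smooth (fun x => f x + g x).
Proof. by move=> sf sg; apply: Ck_smooth => k; apply: Ck_add; exact: smooth_Ck. Qed.

Lemma smooth_mul f g : smooth f -> smooth g -> smooth (fun x => f x * g x).
Proof. by move=> sf sg; apply: Ck_smooth => k; apply: Ck_mul; exact: smooth_Ck. Qed.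

Lemma smooth_lin (a : C) f g : smooth f -> smooth g -> smooth (fun x => a * f x + g x).
Proof.
move=> sf sg; apply: (smooth_add _ sg); apply: (smooth_mul _ sf); exact: smooth_cst.
Qed.

Lemma smooth_conj f : smooth f -> smooth (fun x => (f x)^*).
Proof. by move=> sf; apply: Ck_smooth => k; apply: Ck_conj; exact: smooth_Ck. Qed.

Lemma smooth_dilate f (a : R) : smooth f -> smooth (fun x => f (a *: x)).
Proof. by move=> sf; apply: Ck_smooth => k; apply: Ck_dilate; exact: smooth_Ck. Qed.

Lemma smooth_prod (I : Type) (s : seq I) (F : I -> V -> C) :
  (forall k, smooth (F k)) -> smooth (fun x => \prod_(k <- s) F k x).
Proof.
move=> H; elim: s => [|k s ih].
  rewrite (_ : (fun _ => _) = fun=> 1); first exact: smooth_cst.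
  by apply/funext => x; rewrite big_nil.
rewrite (_ : (fun _ => _) = fun x => F k x * \prod_(l <- s) F l x).
  exact: (smooth_mul (H k) ih).
by apply/funext => x; rewrite big_cons.
Qed.

(** A family of functions of one real variable closed under derivation gives
    smooth functions of a coordinate. *)
Lemma smooth_coord_family (T : Type) (E : T -> R -> R) (D : T -> seq (R * T)) j :
  (forall t (s : R), is_derive s (1 : R) (E t) (\sum_(p <- D t) p.1 * E p.2 s)) ->
  forall t, smooth (fun x => (E t (x 0 j))%:C).
Proof.
move=> HE t; apply: Ck_smooth => k; elim: k t => [|k ih] t.
  split; last by [].
  apply: cc_real; apply: (cr_comp (@coord_cont R d j)).
  by move=> x; apply/differentiable_continuous/derivable1_diffP; have [] := HE t x.
split.
  apply: cc_real; apply: (cr_comp (@coord_cont R d j)).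
  by move=> x; apply/differentiable_continuous/derivable1_diffP; have [] := HE t x.
move=> i; have H x := has_pderiv_coord i (HE t (x 0 j)).
split=> [x|]; first exact: has_pderiv_able (H x).
have -> : pderiv i (fun x => (E t (x 0 j))%:C) =
    fun x => (if i == j then 1 else 0) * (\sum_(p <- D t) p.1 * E p.2 (x 0 j))%:C.
  apply/funext => x; rewrite (has_pderiv_val (H x)).
  by case: ifP => _; rewrite ?mul1r ?mul0r.
apply: Ck_mul; first exact: Ck_cst.
elim: (D t) => [|p s ihs].
  rewrite (_ : (fun _ => _) = fun=> 0); first exact: Ck_cst.
  by apply/funext => x; rewrite big_nil.
rewrite (_ : (fun _ => _) = fun x => p.1%:C * (E p.2 (x 0 j))%:C +
    (\sum_(p <- s) p.1 * E p.2 (x 0 j))%:C).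
  apply: (Ck_add _ ihs); apply: (Ck_mul _ (ih p.2)); exact: Ck_cst.
by apply/funext => x; rewrite big_cons rmorphD rmorphM.
Qed.

Lemma smooth_coord j : smooth (fun x => (x 0 j)%:C).
Proof.
pose E (b : bool) (s : R) : R := if b then s else 1.
pose D (b : bool) : seq (R * bool) := if b then [:: (1, false)] else [::].
apply: (@smooth_coord_family bool E D j _ true); case=> s.
  by rewrite big_seq1 /= mulr1; exact: is_derive_id.
by rewrite big_nil; exact: is_derive_cst.
Qed.

Lemma smooth_taylor i f x (h M : R) : smooth f ->
  (forall t : R, `|t| <= `|h| -> cabs (pderiv i (pderiv i f) (x + t *: ei i)) <= M) ->
  cabs (f (x + h *: ei i) - f x - h%:C * pderiv i f x) <= 2 * M * h ^+ 2.
Proof.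
move=> sf HM; have sf' := smooth_pderiv i sf.
have A (s : R) := smooth_has_pderiv i (x + s *: ei i) sf.
have B (s : R) := smooth_has_pderiv i (x + s *: ei i) sf'.
rewrite (le_trans (cabs_le _))// (_ : 2 * M * h ^+ 2 = M * h ^+ 2 + M * h ^+ 2); last by ring.
apply: lerD.
  rewrite !(cReD, cReN, cReM) /= mul0r subr0.
  have := @taylor2 R (fun s => complex.Re (f (x + s *: ei i)))
    (fun s => complex.Re (pderiv i f (x + s *: ei i)))
    (fun s => complex.Re (pderiv i (pderiv i f) (x + s *: ei i))) h M.
  rewrite scale0r addr0; apply.
  - move=> s; exact: (is_derive_line (f := fun y => complex.Re (f y)) (A s).1).
  - move=> s; exact: (is_derive_line (f := fun y => complex.Re (pderiv i f y)) (B s).1).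
  - by move=> t /HM; apply: le_trans; exact: cabs_re.
rewrite !(cImD, cImN, cImM) /= mul0r addr0.
have := @taylor2 R (fun s => complex.Im (f (x + s *: ei i)))
  (fun s => complex.Im (pderiv i f (x + s *: ei i)))
  (fun s => complex.Im (pderiv i (pderiv i f) (x + s *: ei i))) h M.
rewrite scale0r addr0; apply.
- move=> s; exact: (is_derive_line (f := fun y => complex.Im (f y)) (A s).2).
- move=> s; exact: (is_derive_line (f := fun y => complex.Im (pderiv i f y)) (B s).2).
- by move=> t /HM; apply: le_trans; exact: cabs_im.
Qed.

(** ** Iterated derivatives *)

Lemma pderiv_lin i (a : C) f g : smooth f -> smooth g ->
  pderiv i (fun x => a * f x + g x) = fun x => a * pderiv i f x + pderiv i g x.
Proof.
move=> sf sg; apply/funext => x; apply: has_pderiv_val.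
by apply: has_pderiv_lin; exact: smooth_has_pderiv.
Qed.

Lemma pderivs_lin s (a : C) f g : smooth f -> smooth g ->
  pderivs s (fun x => a * f x + g x) = fun x => a * pderivs s f x + pderivs s g x.
Proof.
elim/last_ind: s f g => [|s i ih] f g sf sg; first by [].
rewrite !pderivs_rcons (pderiv_lin i a sf sg).
by apply: ih; exact: smooth_pderiv.
Qed.

Lemma pderivs_add s f g : smooth f -> smooth g ->
  pderivs s (fun x => f x + g x) = fun x => pderivs s f x + pderivs s g x.
Proof.
move=> sf sg; have := pderivs_lin s 1 sf sg.
rewrite (_ : (fun x => 1 * f x + g x) = fun x => f x + g x); last first.
  by apply/funext => x; rewrite mul1r.
by move=> ->; apply/funext => x; rewrite mul1r.
Qed.

Lemma pderivs_sub s f g : smooth f -> smooth g ->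
  pderivs s (fun x => f x - g x) = fun x => pderivs s f x - pderivs s g x.
Proof.
move=> sf sg; have := pderivs_lin s (-1) sg sf.
rewrite (_ : (fun x => -1 * g x + f x) = fun x => f x - g x); last first.
  by apply/funext => x; rewrite mulN1r addrC.
by move=> ->; apply/funext => x; rewrite mulN1r addrC.
Qed.

Lemma pderivs_cst i s (c : C) : pderivs (rcons s i) ((fun=> c) : V -> C) = fun=> 0.
Proof.
rewrite pderivs_rcons (_ : pderiv i _ = fun=> 0); last first.
  by apply/funext => x; apply: has_pderiv_val; exact: has_pderiv_cst.
elim/last_ind: s => [|s j ih]; first by [].
rewrite pderivs_rcons (_ : pderiv j _ = fun=> 0); first exact: ih.
by apply/funext => x; apply: has_pderiv_val; exact: has_pderiv_cst.
Qed.

Lemma pderivs_dilate s f (a : R) : smooth f ->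
  pderivs s (fun x => f (a *: x)) = fun x => (a ^+ size s)%:C * pderivs s f (a *: x).
Proof.
elim: s f => [|i s ih] f sf.
  by apply/funext => x; rewrite expr0 mul1r.
rewrite [LHS]/= -/(pderivs s _) (ih _ sf); apply/funext => x; apply: has_pderiv_val.
have D := smooth_has_pderiv i (a *: x) (smooth_pderivs s sf).
apply: (has_pderiv_eq (has_pderiv_scale (a ^+ size s)%:C (has_pderiv_dilate D))).
by rewrite mulrA -rmorphM -exprSr.
Qed.

End Smooth.

(** * A smooth bump function *)

Section Bump1.
Variable R : realType.

(** The derivative of [exp (-1/s)] is the same exponential times a power of
    [1/s]; this family is closed under derivation. *)
Definition flat (n : nat) (s : R) : R := if 0 < s then s^-1 ^+ n * expR (- s^-1) else 0.

Lemma flat_ge0 n s : 0 <= flat n s.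
Proof.
by rewrite /flat; case: ifP => // s0; rewrite mulr_ge0 ?expR_ge0// exprn_ge0// invr_ge0 ltW.
Qed.

(** One term of the exponential series beats the negative power; the square
    gives the derivative 0 at the origin. *)
Lemma flat_bound n s : flat n s <= n.+2`!%:R * s ^+ 2.
Proof.
rewrite /flat; case: ifP => s0; last by rewrite mulr_ge0 ?sqr_ge0.
have si0 : 0 < s^-1 by rewrite invr_gt0.
rewrite expRN ler_pdivrMr ?expR_gt0//.
have H := expR_ge1Dxn n.+1 (ltW si0).
have {}H : s^-1 ^+ n.+2 <= n.+2`!%:R * expR s^-1.
  rewrite mulrC -ler_pdivrMr ?ltr0n ?fact_gt0//; apply: le_trans H.
  by rewrite lerDr.
have -> : s^-1 ^+ n = s ^+ 2 * s^-1 ^+ n.+2.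
  by rewrite -[n.+2]addn2 exprD mulrCA -exprMn divff ?gt_eqF// expr1n mulr1.
by rewrite [leRHS](_ : _ = s ^+ 2 * (n.+2`!%:R * expR s^-1)) ?ler_wpM2l ?sqr_ge0//; ring.
Qed.

Lemma flat_derive n (s : R) :
  is_derive s (1 : R) (flat n) (flat n.+2 s - n%:R * flat n.+1 s).
Proof.
have [s0|s0|->] := ltgtP s 0.
- have flat0 k : flat k s = 0 by rewrite /flat ltNge ltW.
  rewrite !flat0 mulr0 subr0.
  apply: (near_eq_is_derive _ (is_derive_cst (0 : R) s 1)).
  near=> t; rewrite /flat ifF//; apply/negbTE; rewrite -leNgt ltW//.
  by near: t; exact: lt_nbhsl.
- have flatE k (t : R) : 0 < t -> flat k t = t^-1 ^+ k * expR (- t^-1).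
    by rewrite /flat => ->.
  pose g (t : R) := t^-1 ^+ n * expR (- t^-1).
  apply: (@near_eq_is_derive _ _ _ g).
    near=> t; rewrite flatE//; near: t; exact: lt_nbhsr.
  have sn0 : s != 0 by rewrite gt_eqF.
  have dV : is_derive s (1 : R) (fun t : R => t^-1) (- s ^- 2).
    apply: DeriveDef; first exact: derivableV.
    by rewrite deriveV// derive_id /GRing.scale/= mulr1.
  have dX := is_deriveX n dV.
  have dN : is_derive s (1 : R) (fun t : R => - t^-1) (- - s ^- 2) by exact: is_deriveN dV.
  have dE := @is_derive1_comp R expR (fun t => - t^-1) s _ _ (is_derive_expR (- s^-1)) dN.
  have -> : g = (fun t : R => t^-1) ^+ n * (expR \o (fun t => - t^-1)).
    by apply/funext => t; rewrite /g mulrfctE exprfctE.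
  apply: (is_derive_eq (is_deriveM dX dE)); rewrite exprfctE.
  rewrite !flatE// /GRing.scale/= opprK.
  have E : s ^- 2 = s^-1 ^+ 2 by rewrite exprVn.
  rewrite E; case: (n) => [|k] /=; first by rewrite !mul0r mulr0 subr0 addr0 !expr0 expr2; ring.
  by rewrite !exprS; ring.
- have flat0 k : flat k 0 = 0 by rewrite /flat ltxx.
  rewrite !flat0 mulr0 subr0; apply: is_derive_small => e e0.
  have K0 : 0 < n.+2`!%:R :> R by rewrite ltr0n fact_gt0.
  exists (e / n.+2`!%:R); first by rewrite divr_gt0.
  move=> h he; rewrite flat0 mulr0 !subr0 add0r ger0_norm ?flat_ge0//.
  rewrite (_ : h *: (1 : R) = h); last by rewrite /GRing.scale/= mulr1.
  apply: le_trans (flat_bound n h) _.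
  rewrite -(real_normK (num_real h)) expr2 mulrA ler_wpM2r// mulrC -ler_pdivlMr//.
  exact: ltW.
Unshelve. all: by end_near.
Qed.

Lemma flat_gt0 s : 0 < s -> 0 < flat 0 s.
Proof. by rewrite /flat => ->; rewrite expr0 mul1r expR_gt0. Qed.

End Bump1.

Section Bump.
Variables (R : realType) (d : nat).
Local Notation V := 'rV[R]_d.
Local Notation C := R[i].
Implicit Types (x : V) (j : 'I_d).

Definition bumpv x : R := \prod_j (flat 0 (1 - x 0 j) * flat 0 (1 + x 0 j)).

Lemma bumpv_ge0 x : 0 <= bumpv x.
Proof. by apply: prodr_ge0 => j _; rewrite mulr_ge0// flat_ge0. Qed.

Lemma bumpv_gt0 x : `|x| < 1 -> 0 < bumpv x.
Proof.
move=> x1; apply: prodr_gt0 => j _.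
have := le_lt_trans (rv_coord x j) x1; rewrite ltr_norml => /andP[a b].
by rewrite mulr_gt0// flat_gt0; lra.
Qed.

Lemma bumpv_eq0 x : 1 < `|x| -> bumpv x = 0.
Proof.
move=> x1; have [j xj] : exists j, 1 < `|x 0 j|.
  apply: contrapT => /forallNP H; move: x1; rewrite ltNge => /negP; apply.
  by apply: rv_norm_le => // j; rewrite leNgt; apply/negP/H.
have flat0 (s : R) : s <= 0 -> flat 0 s = 0 by rewrite /flat ltNge => ->.
rewrite /bumpv (bigD1 j)//=; move: xj; rewrite ltr_normr => /orP[xj|xj].
  by rewrite (flat0 (1 - _)) ?mul0r//; lra.
by rewrite (flat0 (1 + _)) ?mulr0 ?mul0r//; lra.
Qed.

Lemma bumpv_smooth : smooth (fun x => (bumpv x)%:C).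
Proof.
pose E1 (n : nat) (s : R) := flat n (1 - s).
pose D1 (n : nat) : seq (R * nat) := [:: (-1, n.+2); (n%:R, n.+1)].
pose E2 (n : nat) (s : R) := flat n (1 + s).
pose D2 (n : nat) : seq (R * nat) := [:: (1, n.+2); (- n%:R, n.+1)].
have s1 j : smooth (fun x : V => (flat 0 (1 - x 0 j))%:C).
  apply: (@smooth_coord_family R d nat E1 D1 j _ 0%N) => n s.
  have d1 : is_derive s (1 : R) (fun t : R => 1 - t) (-1).
    apply: (is_derive_eq (is_deriveB (is_derive_cst (1 : R) s 1) (is_derive_id s 1))).
    by rewrite sub0r.
  rewrite (_ : E1 n = flat n \o (fun t : R => 1 - t))//.
  apply: (is_derive_eq (@is_derive1_comp R (flat n) (fun t : R => 1 - t) s _ _ (flat_derive n (1 - s)) d1)).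
  by rewrite /D1 big_cons big_seq1 /= /E1; ring.
have s2 j : smooth (fun x : V => (flat 0 (1 + x 0 j))%:C).
  apply: (@smooth_coord_family R d nat E2 D2 j _ 0%N) => n s.
  have d1 : is_derive s (1 : R) (fun t : R => 1 + t) 1.
    apply: (is_derive_eq (is_deriveD (is_derive_cst (1 : R) s 1) (is_derive_id s 1))).
    by rewrite add0r.
  rewrite (_ : E2 n = flat n \o (fun t : R => 1 + t))//.
  apply: (is_derive_eq (@is_derive1_comp R (flat n) (fun t : R => 1 + t) s _ _ (flat_derive n (1 + s)) d1)).
  by rewrite /D2 big_cons big_seq1 /= /E2; ring.
rewrite (_ : (fun _ => _) = fun x => \prod_(j <- index_enum 'I_d)
    ((flat 0 (1 - x 0 j))%:C * (flat 0 (1 + x 0 j))%:C)).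
  by apply: smooth_prod => j; exact: smooth_mul.
apply/funext => x; rewrite /bumpv rmorph_prod; apply: eq_bigr => j _.
by rewrite rmorphM.
Qed.

Lemma ccsmooth_bumpv : ccsmooth (fun x => (bumpv x)%:C).
Proof.
split; first exact: bumpv_smooth.
apply/ccontE; split; first exact: smooth_cont bumpv_smooth.
by exists 1 => x /bumpv_eq0 ->.
Qed.

End Bump.

(** * Schwartz functions *)

Section Schwartz.
Variables (R : realType) (d : nat).
Local Notation V := 'rV[R]_d.
Local Notation C := R[i].
Implicit Types (f g F : V -> C) (x y z : V) (i j : 'I_d).

Lemma schwartz_seminorm_le a b f (r : R) :
  (schwartz_seminorm a b f <= r%:E)%E <->
  forall x, `|monom a x| * cabs (pderivs b f x) <= r.
Proof.
split=> [H x|H].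
  rewrite -lee_fin -cabs_rr -cabsM; apply: le_trans H.
  by apply: ereal_sup_ubound; exists x.
apply: ge_ereal_sup => _ [x _ <-]; rewrite lee_fin cabsM cabs_rr.
exact: H.
Qed.

Lemma schwartz_seminormP a b f : (schwartz_seminorm a b f < +oo)%E <->
  exists r : R, forall x, `|monom a x| * cabs (pderivs b f x) <= r.
Proof.
split=> [|[r /schwartz_seminorm_le H]]; last exact: le_lt_trans H (ltry _).
case E : (schwartz_seminorm a b f) => [r||] // _.
  by exists r; apply/schwartz_seminorm_le; rewrite E.
by exists 0; apply/schwartz_seminorm_le; rewrite E leNye.
Qed.

Lemma schwartzP f : schwartz f <-> smooth f /\ forall a b,
  exists r : R, forall x, `|monom a x| * cabs (pderivs b f x) <= r.
Proof.
split=> -[sf H]; split; try exact: sf; move=> a b.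
  exact/schwartz_seminormP.
exact/schwartz_seminormP.
Qed.

Lemma schwartz_lin (k : C) f g : schwartz f -> schwartz g ->
  schwartz (fun x => k * f x + g x).
Proof.
move=> /schwartzP[sf Hf] /schwartzP[sg Hg]; apply/schwartzP; split.
  exact: smooth_lin.
move=> a b; have [r Hr] := Hf a b; have [q Hq] := Hg a b.
exists (cabs k * r + q) => x; rewrite pderivs_lin//.
apply: (@le_trans _ _ (`|monom a x| * (cabs k * cabs (pderivs b f x) + cabs (pderivs b g x)))).
  by rewrite ler_wpM2l// (le_trans (cabsD _ _))// cabsM.
by rewrite mulrDr lerD// mulrCA ler_wpM2l ?cabs_ge0.
Qed.

Lemma schwartz_sub f g : schwartz f -> schwartz g -> schwartz (fun x => f x - g x).
Proof.
move=> sf sg; rewrite (_ : (fun _ => _) = fun x => -1 * g x + f x).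
  exact: schwartz_lin sg sf.
by apply/funext => x; rewrite mulN1r addrC.
Qed.

Lemma schwartz_smooth f : schwartz f -> smooth f.
Proof. by case. Qed.

Lemma schwartz_pderiv i f : schwartz f -> schwartz (pderiv i f).
Proof.
move=> /schwartzP[sf Hf]; apply/schwartzP; split; first exact: smooth_pderiv.
by move=> a b; have [r Hr] := Hf a (rcons b i); exists r => x; rewrite -pderivs_rcons.
Qed.

Lemma schwartz_pderivs s f : schwartz f -> schwartz (pderivs s f).
Proof.
elim/last_ind: s f => [|s i ih] f sf; first exact: sf.
by rewrite pderivs_rcons; apply: ih; exact: schwartz_pderiv.
Qed.

Lemma pderivs_zero_outside (r : R) s f : smooth f -> (forall x, r < `|x| -> f x = 0) ->
  forall x, r < `|x| -> pderivs s f x = 0.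
Proof.
elim/last_ind: s f => [|s i ih] f sf Hf; first exact: Hf.
rewrite pderivs_rcons; apply: ih; first exact: smooth_pderiv.
move=> x xr; apply: has_pderiv_val; apply: has_pderiv_small => e e0.
exists (`|x| - r); first by rewrite subr_gt0.
move=> h hr; rewrite (Hf x xr) Hf.
  by rewrite subr0 mulr0 subr0 cabs0 mulr_ge0// ltW.
rewrite -(opprK (h *: _)); apply: lt_le_trans (lerB_dist _ _).
rewrite normrN normrZ.
have e1 : `|delta_mx 0 i : V| <= 1.
  by apply: rv_norm_le => // j; rewrite !mxE normr_nat lern1 leq_b1.
have : `|h| * `|delta_mx 0 i : V| <= `|h| by rewrite ler_piMr.
lra.
Qed.

Lemma ccsmooth_pderivs s f : ccsmooth f -> ccsmooth (pderivs s f).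
Proof.
move=> [sf /ccontE[_ [r Hr]]]; have sp := smooth_pderivs s sf; split; first exact: sp.
apply/ccontE; split; first exact: smooth_cont sp.
by exists r; exact: pderivs_zero_outside.
Qed.

Lemma monom_smooth a : smooth (fun x => (monom a x)%:C).
Proof.
rewrite (_ : (fun _ => _) = fun x => \prod_(i <- a) (x 0 i)%:C).
  by apply: smooth_prod => i; exact: smooth_coord.
by apply/funext => x; rewrite /monom rmorph_prod.
Qed.

Lemma ccsmooth_mul f g : ccsmooth f -> smooth g -> ccsmooth (fun x => f x * g x).
Proof.
move=> [sf cf] sg; split; first exact: smooth_mul.
by apply: ccont_mul cf _; exact: smooth_cont.
Qed.

Lemma ccsmooth_schwartz f : ccsmooth f -> schwartz f.
Proof.
move=> cf; apply/schwartzP; split; first exact: cf.1.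
move=> a b; have [_ h] := ccsmooth_mul (ccsmooth_pderivs b cf) (monom_smooth a).
have [M M0 HM] := ccont_bounded h; exists M => x; apply: le_trans (HM x).
by rewrite cabsM cabs_rr mulrC.
Qed.

(** Expanding the product of the [1 + x_i^2] bounds it by monomials. *)
Lemma weight_monomials (s : seq 'I_d) a0 x (c r : R) : 0 <= c ->
  (forall a, (size a <= size a0 + (size s).*2)%N -> `|monom a x| * c <= r) ->
  `|monom a0 x| * \prod_(i <- s) (1 + x 0 i ^+ 2) * c <= 2 ^+ size s * r.
Proof.
move=> c0; elim: s a0 => [|i s ih] a0 H.
  by rewrite big_nil mulr1 expr0 mul1r; apply: H; rewrite addn0.
pose P := \prod_(j <- s) (1 + x 0 j ^+ 2); rewrite -/P in ih.
rewrite big_cons -/P [size _]/= [in leRHS]exprS.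
rewrite [leLHS](_ : _ = `|monom a0 x| * P * c + `|monom a0 x| * x 0 i ^+ 2 * P * c); last by ring.
rewrite [leRHS](_ : _ = 2 ^+ size s * r + 2 ^+ size s * r); last by ring.
apply: lerD.
  apply: ih => a ha; apply: H.
  by rewrite (leq_trans ha)// leq_add2l doubleS leqW// leqW.
have := ih (i :: i :: a0).
rewrite /monom !big_cons -/(monom a0 x) !normrM.
rewrite [`|x 0 i| * _](_ : _ = `|monom a0 x| * `|x 0 i| ^+ 2); last by ring.
rewrite real_normK ?num_real//; apply => a ha; apply: H.
by rewrite (leq_trans ha)// doubleS !addSn !addnS.
Qed.

Definition coords (p : nat) : seq 'I_d := flatten (nseq p (index_enum 'I_d)).

Lemma size_coords p : size (coords p) = (p * d)%N.
Proof.
by rewrite size_flatten /shape map_nseq sumn_nseq mulnC; congr (_ * _)%N; rewrite -[RHS]card_ord cardT enumT.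
Qed.

Lemma prod_coords p x : \prod_(i <- coords p) (1 + x 0 i ^+ 2) = (weight x ^+ p)^-1.
Proof.
elim: p => [|p ih]; first by rewrite big_nil expr0 invr1.
rewrite /coords /= big_cat/= -/(coords p) ih exprS invfM; congr (_ * _).
by rewrite /weight prodfV invrK.
Qed.

Lemma decay_of_monomials p f x (r : R) :
  (forall a, (size a <= (p * d).*2)%N -> `|monom a x| * cabs (f x) <= r) ->
  cabs (f x) <= 2 ^+ (p * d) * r * weight x ^+ p.
Proof.
move=> H; have := @weight_monomials (coords p) [::] x (cabs (f x)) r (cabs_ge0 _).
rewrite size_coords /monom big_nil normr1 mul1r prod_coords => /(_ H).
by rewrite mulrC ler_pdivrMr// exprn_gt0// weight_gt0.
Qed.

Lemma bounded_size_list (N : nat) : exists L : seq (seq 'I_d),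
  forall a : seq 'I_d, (size a <= N)%N -> a \in L.
Proof.
pose T := {n : 'I_N.+1 & n.-tuple 'I_d}.
exists [seq (tagged t : seq 'I_d) | t : T] => a aN.
have aN' : (size a < N.+1)%N by rewrite ltnS.
apply/mapP; exists (existT (fun n : 'I_N.+1 => n.-tuple 'I_d) (Ordinal aN') (in_tuple a)) => //.
by rewrite mem_enum.
Qed.

(** Finitely many pairs of lists are concerned, so half the least threshold
    serves them all. *)
Lemma uniform_scale (N : nat) (Q : seq 'I_d -> seq 'I_d -> R -> Prop) :
  (forall a b, exists2 s0 : R, 0 < s0 & forall s, 0 < s < s0 -> Q a b s) ->
  exists2 s : R, 0 < s & forall a b, (size a <= N)%N -> (size b <= N)%N -> Q a b s.
Proof.
move=> H; have [L HL] := bounded_size_list N.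
have Hp (p : seq 'I_d * seq 'I_d) : exists s0 : R,
    0 < s0 /\ forall s, 0 < s < s0 -> Q p.1 p.2 s.
  by have [s0 s00 Hs] := H p.1 p.2; exists s0.
have [s0 Hs0] := choice Hp.
have [m [m0 Hm]] : exists m : R, 0 < m /\ forall p, p \in [seq (a, b) | a <- L, b <- L] -> m <= s0 p.
  elim: [seq (a, b) | a <- L, b <- L] => [|p s [m [m0 Hm]]]; first by exists 1.
  exists (Num.min (s0 p) m); split; first by rewrite lt_min m0 (Hs0 p).1.
  move=> q; rewrite inE => /predU1P[->|/Hm qm]; first by rewrite ge_min lexx.
  by rewrite ge_min qm orbT.
exists (m / 2); first by rewrite divr_gt0.
move=> a b aN bN; apply: ((Hs0 (a, b)).2 _ _); rewrite divr_gt0//=.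
apply: (@lt_le_trans _ _ m); first by rewrite ltr_pdivrMr// mulr2n mulrDr mulr1 ltrDl.
by apply: Hm; apply/allpairsP; exists (a, b); split => //=; exact: HL.
Qed.

(** The bounds are read as inverses of thresholds. *)
Lemma uniform_bound (N : nat) (P : seq 'I_d -> seq 'I_d -> V -> R) :
  (forall a b, exists r : R, forall x, P a b x <= r) ->
  exists r : R, forall a b, (size a <= N)%N -> (size b <= N)%N -> forall x, P a b x <= r.
Proof.
move=> H; have [a b|s s0 Hs] := @uniform_scale N (fun a b s => forall x, P a b x <= s^-1).
  have [r Hr] := H a b; have r0 : 0 < `|r| + 1 by rewrite ltr_wpDl.
  exists (`|r| + 1)^-1; first by rewrite invr_gt0.
  move=> s /andP[s0]; rewrite -[s in s < _]invrK ltf_pV2 ?posrE ?invr_gt0// => sr x.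
  by apply: le_trans (Hr x) _; apply: le_trans (ler_norm r) _; rewrite (le_trans _ (ltW sr))// lerDl.
by exists s^-1 => a b aN bN; exact: Hs.
Qed.

Lemma schwartz_bound (N : nat) f : schwartz f -> exists r : R,
  forall a b, (size a <= N)%N -> (size b <= N)%N ->
    forall x, `|monom a x| * cabs (pderivs b f x) <= r.
Proof. by move=> /schwartzP[_ H]; exact: uniform_bound H. Qed.

Lemma schwartz_decay p f : schwartz f ->
  exists r : R, forall x, cabs (f x) <= r * weight x ^+ p.
Proof.
move=> sf; have [r Hr] := schwartz_bound (p * d).*2 sf.
by exists (2 ^+ (p * d) * r) => x; apply: decay_of_monomials => a ha; exact: (Hr a [::]).
Qed.

Lemma schwartz_decaying f : schwartz f -> decaying f.
Proof.
move=> sf; split; first exact/smooth_cont/schwartz_smooth.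
by have [r Hr] := schwartz_decay 1 sf; exists r => x; have := Hr x; rewrite expr1.
Qed.

End Schwartz.

(** * The Fourier transform of decaying functions *)

Section Expi.
Variable R : realType.

Lemma expi_taylor (s : R) : cabs (expi s - 1 - s%:C * 'i%C) <= 2 * s ^+ 2.
Proof.
have c1 (t : R) : `|- cos t| <= 1 by rewrite normrN cos_max.
have s1 (t : R) : `|- sin t| <= 1 by rewrite normrN sin_max.
have dN (t : R) : is_derive t (1 : R) (fun u : R => - sin u) (- cos t).
  exact: is_deriveN (is_derive_sin t).
have H1 := @taylor2 R (@cos R) (fun u => - sin u) (fun u => - cos u) s 1
  (@is_derive_cos R) dN (fun t _ => c1 t).
have H2 := @taylor2 R (@sin R) (@cos R) (fun u => - sin u) s 1
  (@is_derive_sin R) (@is_derive_cos R) (fun t _ => s1 t).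
rewrite (le_trans (cabs_le _))// (_ : 2 * s ^+ 2 = 1 * s ^+ 2 + 1 * s ^+ 2); last by ring.
move: H1 H2; rewrite cos0 sin0 !(oppr0, mulr0, addr0, subr0, mulr1) => H1 H2.
apply: lerD.
  rewrite (_ : complex.Re _ = cos s - 1)//.
  by rewrite !(cReD, cReN, cReM) /=; ring.
rewrite (_ : complex.Im _ = sin s - s)//.
by rewrite !(cImD, cImN, cImM) /=; ring.
Qed.

Lemma expi_lipschitz (s : R) : cabs (expi s - 1) <= 2 * `|s|.
Proof.
have [c [cs E1]] := mean_value 0 s (@is_derive_cos R).
have [b [bs E2]] := mean_value 0 s (@is_derive_sin R).
rewrite (le_trans (cabs_le _))// (_ : 2 * `|s| = 1 * `|s| + 1 * `|s|); last by ring.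
rewrite cos0 subr0 in E1; rewrite sin0 !subr0 in E2.
apply: lerD.
  by rewrite cReD cReN /= E1 normrM normrN ler_wpM2r// sin_max.
by rewrite cImD cImN /= subr0 E2 normrM ler_wpM2r// cos_max.
Qed.

End Expi.

Section Fourier.
Variables (R : realType) (d : nat).
Local Notation V := 'rV[R]_d.
Local Notation C := R[i].
Implicit Types (f g F : V -> C) (x y z t : V) (i j : 'I_d).
Local Notation ei i := (delta_mx 0 i : V).
Local Notation W := (rintegral (@weight R d)).

Lemma decay_coef_ge0 (a c : R) p x : 0 <= c -> c <= a * weight x ^+ p -> 0 <= a.
Proof.
move=> c0 H; rewrite -(pmulr_lge0 a (exprn_gt0 p (weight_gt0 x))).
exact: le_trans c0 H.
Qed.

Definition wave x y : C := expi (2 * pi * dotv x y).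

Lemma dotvC x y : dotv x y = dotv y x.
Proof. by apply: eq_bigr => i _; rewrite mulrC. Qed.

Lemma dotvDr x y z : dotv x (y + z) = dotv x y + dotv x z.
Proof. by rewrite -big_split; apply: eq_bigr => i _; rewrite !mxE mulrDr. Qed.

Lemma dotvDl x y z : dotv (x + y) z = dotv x z + dotv y z.
Proof. by rewrite !(dotvC _ z) dotvDr. Qed.

Lemma dotvZr (a : R) x y : dotv x (a *: y) = a * dotv x y.
Proof. by rewrite mulr_sumr; apply: eq_bigr => i _; rewrite !mxE mulrCA. Qed.

Lemma dotvZl (a : R) x y : dotv (a *: x) y = a * dotv x y.
Proof. by rewrite dotvC dotvZr dotvC. Qed.

Lemma dotvNr x y : dotv x (- y) = - dotv x y.
Proof. by rewrite -scaleN1r dotvZr mulN1r. Qed.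

Lemma dotvNl x y : dotv (- x) y = - dotv x y.
Proof. by rewrite dotvC dotvNr dotvC. Qed.

Lemma dotv_delta i y : dotv (ei i) y = y 0 i.
Proof.
rewrite /dotv (bigD1 i)//= !mxE !eqxx mul1r big1 ?addr0// => j ji.
by rewrite mxE eqxx (negbTE ji) mul0r.
Qed.

Lemma dotv_le x y : `|dotv x y| <= d%:R * (`|x| * `|y|).
Proof.
apply: (le_trans (ler_norm_sum _ _ _)).
apply: (@le_trans _ _ (\sum_(i < d) `|x| * `|y|)).
  by apply: ler_sum => i _; rewrite normrM ler_pM// rv_coord.
by rewrite sumr_const card_ord mulr_natl.
Qed.

Lemma dotv_cont y : continuous (fun x => dotv x y).
Proof.
by apply: cr_sum => i; apply: cr_mul; [exact: coord_cont|exact: cr_cst].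
Qed.

Lemma wave_cont y : continuous ((fun x => wave x y) : V -> (C : numFieldType)).
Proof. by apply: cc_expi; apply: cr_mul; [exact: cr_cst|exact: dotv_cont]. Qed.

Lemma cabs_wave x y : cabs (wave x y) = 1.
Proof. exact: cabs_expi. Qed.

Lemma waveC x y : wave x y = wave y x.
Proof. by rewrite /wave dotvC. Qed.

Lemma waveDr x y z : wave x (y + z) = wave x y * wave x z.
Proof. by rewrite /wave dotvDr mulrDr expiD. Qed.

Lemma waveDl x y z : wave (x + y) z = wave x z * wave y z.
Proof. by rewrite /wave dotvDl mulrDr expiD. Qed.

Lemma waveNr x y : wave x (- y) = (wave x y)^*.
Proof. by rewrite /wave dotvNr mulrN expiN. Qed.

Lemma waveNl x y : wave (- x) y = (wave x y)^*.
Proof. by rewrite /wave dotvNl mulrN expiN. Qed.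

Lemma wave_shift x h i y : wave (x + h *: ei i) y = wave x y * expi (2 * pi * y 0 i * h).
Proof.
by rewrite waveDl; congr (_ * _); rewrite /wave dotvZl dotv_delta; congr expi; ring.
Qed.

Lemma pi2_ge1 : 1 <= 2 * pi :> R.
Proof. by have := @pi_ge2 R; lra. Qed.

Lemma pi2_ge0 : 0 <= 2 * pi :> R.
Proof. by have := pi2_ge1; lra. Qed.

Lemma wave_lipschitz x y z : cabs (wave x y - wave x z) <= 2 * (2 * pi * (d%:R * (`|x| * `|y - z|))).
Proof.
rewrite -{1}(subrK z y) waveDr -{2}[wave x z]mul1r -mulrBl cabsM cabs_wave mulr1.
apply: le_trans (expi_lipschitz _) _; rewrite ler_wpM2l//.
by rewrite normrM (ger0_norm pi2_ge0) ler_wpM2l ?pi2_ge0// dotv_le.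
Qed.

Lemma fcheckE f y : fcheck f y = cintegral (fun x => f x * wave x y).
Proof. by []. Qed.

Lemma decaying_wave f y : decaying f -> decaying (fun x => f x * wave x y).
Proof.
move=> df; apply: (@decaying_mul _ _ _ _ 1 df); first exact: wave_cont.
by move=> x; rewrite cabs_wave.
Qed.

Lemma fcheck_bound f (a : R) y : continuous (f : V -> (C : numFieldType)) ->
  (forall x, cabs (f x) <= a * weight x) -> cabs (fcheck f y) <= a * W.
Proof.
move=> cf fa; rewrite fcheckE; apply: cintegral_bound.
  exact: (cc_mul cf (@wave_cont y)).
by move=> x; rewrite cabsM cabs_wave mulr1.
Qed.

Lemma fcheck_lin (a : C) f g : decaying f -> decaying g ->
  fcheck (fun x => a * f x + g x) = fun y => a * fcheck f y + fcheck g y.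
Proof.
move=> df dg; apply/funext => y; rewrite !fcheckE -cintegral_lin; try exact: decaying_wave.
by congr cintegral; apply/funext => x; rewrite mulrDl mulrA.
Qed.

Lemma fcheck_scale (a : C) f : decaying f ->
  fcheck (fun x => a * f x) = fun y => a * fcheck f y.
Proof.
move=> df; apply/funext => y; rewrite !fcheckE -cintegral_scale; last exact: decaying_wave.
by congr cintegral; apply/funext => x; rewrite mulrA.
Qed.

Lemma fcheck_add f g : decaying f -> decaying g ->
  fcheck (fun x => f x + g x) = fun y => fcheck f y + fcheck g y.
Proof.
move=> df dg; apply/funext => y; rewrite !fcheckE -cintegral_add; try exact: decaying_wave.
by congr cintegral; apply/funext => x; rewrite mulrDl.
Qed.

Lemma fcheck_sub f g : decaying f -> decaying g ->
  fcheck (fun x => f x - g x) = fun y => fcheck f y - fcheck g y.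
Proof.
move=> df dg; apply/funext => y; rewrite !fcheckE -cintegral_sub; try exact: decaying_wave.
by congr cintegral; apply/funext => x; rewrite mulrBl.
Qed.

Lemma fcheck_modulate f t y : fcheck (fun x => f x * wave x t) y = fcheck f (y + t).
Proof.
rewrite !fcheckE; congr cintegral; apply/funext => x.
by rewrite waveDr -mulrA [_ * wave x y]mulrC.
Qed.

(** The square of the weight absorbs the Lipschitz constant of the wave. *)
Lemma fcheck_lipschitz f (a : R) y z : 0 <= a ->
  continuous (f : V -> (C : numFieldType)) ->
  (forall x, cabs (f x) <= a * weight x ^+ 2) ->
  cabs (fcheck f y - fcheck f z) <= 4 * pi * d%:R * a * W * `|y - z|.
Proof.
move=> a0 cf fa.
have df : decaying f.
  split; [exact: cf|exists a => x; apply: le_trans (fa x) _].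
  by rewrite ler_wpM2l// expr2 ler_piMr ?weight_ge0 ?weight_le1.
rewrite !fcheckE -cintegral_sub; try exact: decaying_wave.
rewrite (_ : 4 * pi * d%:R * a * W * `|y - z| = (4 * pi * d%:R * a * `|y - z|) * W); last by ring.
apply: cintegral_bound.
  exact: decaying_cont (decaying_sub (decaying_wave y df) (decaying_wave z df)).
move=> x; rewrite -mulrBr cabsM.
apply: (@le_trans _ _ (a * weight x ^+ 2 * (2 * (2 * pi * (d%:R * (`|x| * `|y - z|)))))).
  by rewrite ler_pM ?cabs_ge0// wave_lipschitz.
rewrite [leLHS](_ : _ = 4 * pi * d%:R * a * `|y - z| * weight x * (weight x * `|x|)); last by ring.
rewrite ler_piMr ?weight_norm// !mulr_ge0 ?weight_ge0// pi_ge0//.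
Qed.

Lemma lipschitz_cont f (K : R) :
  (forall y z, cabs (f y - f z) <= K * `|y - z|) -> continuous (f : V -> (C : numFieldType)).
Proof.
move=> H; apply/ccP => x e e0.
pose B := `|K| + 1; have B0 : 0 < B by rewrite ltr_wpDl.
exists (e / B); first by rewrite divr_gt0.
move=> y yx; apply: (le_lt_trans (H y x)); apply: (@le_lt_trans _ _ (B * `|y - x|)).
  by rewrite ler_wpM2r// (le_trans (ler_norm K))// lerDl.
by rewrite mulrC -ltr_pdivlMr.
Qed.

Lemma fcheck_cont f (a : R) : continuous (f : V -> (C : numFieldType)) ->
  (forall x, cabs (f x) <= a * weight x ^+ 2) ->
  continuous (fcheck f : V -> (C : numFieldType)).
Proof.
move=> cf fa.
have a0 : 0 <= a := decay_coef_ge0 (cabs_ge0 _) (fa 0).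
apply: (@lipschitz_cont _ (4 * pi * d%:R * a * W)) => y z.
exact: fcheck_lipschitz.
Qed.

Lemma ccont_weight p f : ccont f -> exists a : R, forall x, cabs (f x) <= a * weight x ^+ p.
Proof.
move=> cf; have [M M0 HM] := ccont_bounded cf; have /ccontE[_ [r Hr]] := cf.
have B0 : 0 <= (1 + r ^+ 2) ^+ d by rewrite exprn_ge0// ltW// oneDsq_gt0.
exists (M * ((1 + r ^+ 2) ^+ d) ^+ p) => x.
have [xr|xr] := leP `|x| r.
  by rewrite -mulrA -exprMn -[leLHS]mulr1 ler_pM ?cabs_ge0// exprn_ege1// weight_ball.
rewrite Hr// cabs0; apply: mulr_ge0; last by rewrite exprn_ge0// weight_ge0.
by rewrite mulr_ge0 ?(ltW M0)// exprn_ge0.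
Qed.

Lemma ccont_fcheck_cont f : ccont f -> continuous (fcheck f : V -> (C : numFieldType)).
Proof.
move=> cf; have [a Ha] := ccont_weight 2 cf.
exact: (fcheck_cont (ccont_cont cf) Ha).
Qed.

Lemma schwartz_fcheck_cont f : schwartz f -> continuous (fcheck f : V -> (C : numFieldType)).
Proof.
move=> sf; have [a Ha] := schwartz_decay 2 sf.
exact: (fcheck_cont (smooth_cont (schwartz_smooth sf)) Ha).
Qed.

(** ** Derivatives *)

(** Translation invariance turns a difference quotient of [g] into one of the
    wave; both are compared with their derivatives to second order. *)
Lemma fcheck_pderiv i g y : schwartz g ->
  fcheck (pderiv i g) y = - ((2 * pi * y 0 i)%:C * 'i%C) * fcheck g y.
Proof.
move=> sg; have sg1 := schwartz_pderiv i sg.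
have [a Ha] := schwartz_decay 1 (schwartz_pderiv i sg1).
have a0 : 0 <= a := decay_coef_ge0 (cabs_ge0 _) (Ha 0).
have [dg dg1] := (schwartz_decaying sg, schwartz_decaying sg1).
set G := fcheck g y; set D := fcheck _ y; pose th := 2 * pi * y 0 i.
pose A := 2 * (a * 3 ^+ d).
have key (h : R) : `|h| <= 1 ->
    cabs ((expi (- (th * h)) - 1) * G - h%:C * D) <= A * W * h ^+ 2.
  move=> h1.
  have bnd x : cabs (g (x + h *: ei i) - g x - h%:C * pderiv i g x) <= A * h ^+ 2 * weight x.
    rewrite /A [leRHS](_ : _ = 2 * (a * 3 ^+ d * weight x) * h ^+ 2); last by ring.
    apply: smooth_taylor; first exact: schwartz_smooth.
    move=> t th1; apply: le_trans (Ha _) _; rewrite expr1 -mulrA ler_wpM2l//.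
    apply: weight_shift; rewrite addrAC subrr add0r normrZ.
    have e1 : `|ei i| <= 1.
      by apply: rv_norm_le => // j; rewrite !mxE normr_nat lern1 leq_b1.
    by rewrite -[leRHS]mulr1 ler_pM// (le_trans th1).
  have dsh : decaying (fun x => g (x + h *: ei i)).
    have -> : (fun x => g (x + h *: ei i)) =
        fun x => 1 * (g x + h%:C * pderiv i g x) + (g (x + h *: ei i) - g x - h%:C * pderiv i g x).
      by apply/funext => x; ring.
    apply: decaying_lin.
      rewrite (_ : (fun _ => _) = fun x => h%:C * pderiv i g x + g x).
        exact: decaying_lin.
      by apply/funext => x; rewrite addrC.
    split; last by exists (A * h ^+ 2).
    have cg := smooth_cont (schwartz_smooth sg).
    have cg1 := smooth_cont (schwartz_smooth sg1).
    have csh : continuous ((fun x => g (x + h *: ei i)) : V -> (C : numFieldType)).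
      rewrite (_ : (fun _ => _) = fun x => g (x - (- (h *: ei i)))).
        exact: (cc_comp (@shift_cont R d _) cg).
      by apply/funext => x; rewrite opprK.
    exact: (cc_add (cc_add csh (cc_opp cg)) (cc_opp (cc_mul (@cc_cst _ _ h%:C) cg1))).
  have E : (expi (- (th * h)) - 1) * G - h%:C * D =
      cintegral (fun x => (g (x + h *: ei i) - g x - h%:C * pderiv i g x) * wave x y).
    have E1 : expi (- (th * h)) * G = cintegral (fun x => g (x + h *: ei i) * wave x y).
      rewrite -(cintegral_shift (- (h *: ei i))); last exact: decaying_wave.
      rewrite /G fcheckE -cintegral_scale; last exact: decaying_wave.
      congr cintegral; apply/funext => x; rewrite subrK -[- (h *: ei i)]scaleNr wave_shift.
      by rewrite (_ : 2 * pi * y 0 i * - h = - (th * h)); [ring|rewrite /th; ring].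
    rewrite mulrBl mul1r E1 /G /D !fcheckE -cintegral_sub; try exact: decaying_wave.
    rewrite -cintegral_scale; last exact: decaying_wave.
    rewrite -cintegral_sub.
    - by congr cintegral; apply/funext => x; ring.
    - exact: decaying_sub (decaying_wave y dsh) (decaying_wave y dg).
    - exact: decaying_scale (decaying_wave y dg1).
  rewrite E mulrAC; apply: cintegral_bound; last first.
    by move=> x; rewrite cabsM cabs_wave mulr1.
  apply: (cc_mul _ (@wave_cont y)).
  have := decaying_sub (decaying_sub dsh dg) (decaying_scale h%:C dg1).
  exact: decaying_cont.
have B h : `|h| <= 1 -> cabs (h%:C * (- (th%:C * 'i%C) * G - D)) <=
    (A * W + 2 * th ^+ 2 * cabs G) * h ^+ 2.
  move=> h1.
  have -> : h%:C * (- (th%:C * 'i%C) * G - D) =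
      ((expi (- (th * h)) - 1) * G - h%:C * D) -
      (expi (- (th * h)) - 1 - (- (th * h))%:C * 'i%C) * G.
    have -> : (- (th * h))%:C = - (th%:C * h%:C).
      by rewrite (rmorphN (real_complex R)) (rmorphM (real_complex R) th h).
    by ring.
  apply: le_trans (cabsB _ _) _; rewrite [leRHS]mulrDl lerD ?key//.
  rewrite cabsM [leRHS]mulrAC ler_wpM2r ?cabs_ge0//.
  apply: le_trans (expi_taylor _) _.
  by rewrite sqrrN exprMn mulrA.
apply/esym/eqP; rewrite -subr_eq0; apply/eqP/cabs_eq0.
set z := _ - _ in B *; set K := _ + _ in B.
apply/eqP; rewrite eq_le cabs_ge0 andbT; apply/ler_addgt0Pr => e e0.
rewrite add0r.
have K0 : 0 <= K.
  have A0 : 0 <= A by rewrite mulr_ge0// mulr_ge0// exprn_ge0.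
  apply: addr_ge0; first exact: mulr_ge0 A0 (@rintegral_weight_ge0 R d).
  by rewrite mulr_ge0 ?cabs_ge0// mulr_ge0// sqr_ge0.
pose h := Num.min 1 (e / (K + 1)).
have h0 : 0 < h by rewrite lt_min ltr01 divr_gt0// ltr_wpDl.
have h1 : h <= 1 by rewrite ge_min lexx.
have := B h; rewrite ger0_norm ?(ltW h0)// => /(_ h1).
rewrite cabsM cabs_rr ger0_norm ?(ltW h0)// expr2 mulrCA ler_pM2l// => H.
apply: le_trans H _; apply: (@le_trans _ _ ((K + 1) * h)).
  by rewrite ler_wpM2r ?(ltW h0)// lerDl.
by rewrite mulrC -ler_pdivlMr ?ltr_wpDl// ge_min lexx orbT.
Qed.

Lemma fcheck_monom s g y : schwartz g ->
  `|monom s y| * cabs (fcheck g y) <= cabs (fcheck (pderivs s g) y).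
Proof.
elim: s => [|i s ih] sg; first by rewrite /monom big_nil normr1 mul1r.
have sp := schwartz_pderivs s sg.
rewrite (fcheck_pderiv i y sp) cabsM cabsN cabsM cabs_rr.
rewrite (_ : cabs 'i%C = 1); last by rewrite /= expr0n add0r expr1n sqrtr1.
have -> : `|2 * pi * y 0 i| = 2 * pi * `|y 0 i| by rewrite normrM (ger0_norm pi2_ge0).
rewrite mulr1 /monom big_cons normrM -/(monom s y) -[leLHS]mulrA.
apply: ler_pM; [by []|by rewrite mulr_ge0 ?cabs_ge0| |exact: ih].
by rewrite ler_peMl// pi2_ge1.
Qed.

(** Derivatives of [g] become monomials times the transform, and enough
    monomials recover the power of the weight; only finitely many seminorms
    enter, which is what continuity in the Schwartz space needs. *)
Lemma fcheck_decay p g (r : R) y : schwartz g ->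
  (forall a b, (size a <= d.*2)%N -> (size b <= (p * d).*2)%N ->
     forall x, `|monom a x| * cabs (pderivs b g x) <= r) ->
  cabs (fcheck g y) <= 2 ^+ (p * d) * (2 ^+ d * r * W) * weight y ^+ p.
Proof.
move=> sg H; apply: decay_of_monomials => b hb.
apply: le_trans (fcheck_monom b y sg) _.
apply: fcheck_bound; first exact/smooth_cont/schwartz_smooth/schwartz_pderivs.
move=> x; have := @decay_of_monomials R d 1 (pderivs b g) x r.
by rewrite mul1n expr1; apply => a ha; exact: H.
Qed.

(** Differentiation under the integral sign, for a kernel with a second order
    expansion dominated by the weight. *)
Lemma has_pderiv_cintegral i (K D : V -> V -> C) y (A : R) :
  (forall z, decaying (K z)) -> decaying (D y) ->
  (forall (h : R) x, `|h| <= 1 ->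
     cabs (K (y + h *: ei i) x - K y x - h%:C * D y x) <= A * h ^+ 2 * weight x) ->
  has_pderiv i (fun z => cintegral (K z)) y (cintegral (D y)).
Proof.
move=> dK dD H; apply: (@has_pderiv_quad _ _ _ _ _ _ (A * W)) => h h1.
have d1 := decaying_sub (dK (y + h *: ei i)) (dK y).
have d2 := decaying_scale h%:C dD.
rewrite -cintegral_scale// -cintegral_sub// -cintegral_sub// mulrAC.
apply: cintegral_bound; first exact: decaying_cont (decaying_sub d1 d2).
by move=> x; exact: H.
Qed.

(** The factor that derivation of [wave x y] in the coordinate [y_i] produces. *)
Definition cmonom i x : C := (2 * pi * x 0 i)%:C * 'i%C.

Lemma ccont_cmonom i g : ccont g -> ccont (fun x => cmonom i x * g x).
Proof.
move=> cg; rewrite (_ : (fun _ => _) = fun x => g x * cmonom i x).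
  apply: (ccont_mul cg); apply: (cc_mul _ (@cc_cst _ _ _)); apply: cc_real.
  by apply: cr_mul; [exact: cr_cst|exact: coord_cont].
by apply/funext => x; rewrite mulrC.
Qed.

Lemma pderiv_fcheck i g y : ccont g ->
  has_pderiv i (fcheck g) y (fcheck (fun x => cmonom i x * g x) y).
Proof.
move=> cg; have cg' := ccont_cmonom i cg.
have dg := decaying_ccont cg; have dg' := decaying_ccont cg'.
have [a Ha] := ccont_weight 1 (ccont_cmonom i cg').
have a0 : 0 <= a := decay_coef_ge0 (cabs_ge0 _) (Ha 0).
apply: (@has_pderiv_cintegral i (fun z x => g x * wave x z)
  (fun z x => cmonom i x * g x * wave x z) y (2 * a)).
- by move=> z; exact: decaying_wave.
- exact: decaying_wave.
- move=> h x h1; rewrite (waveC x (y + _)) wave_shift (waveC y x).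
  set th := 2 * pi * x 0 i.
  have -> : g x * (wave x y * expi (th * h)) - g x * wave x y -
      h%:C * (cmonom i x * g x * wave x y) =
      g x * wave x y * (expi (th * h) - 1 - (th * h)%:C * 'i%C).
    by rewrite /cmonom -/th (rmorphM (real_complex R) th h); ring.
  rewrite cabsM cabsM cabs_wave mulr1.
  apply: (@le_trans _ _ (cabs (g x) * (2 * (th * h) ^+ 2))).
    by rewrite ler_wpM2l ?cabs_ge0// expi_taylor.
  have := Ha x; rewrite !cabsM !cabs_rr -/th.
  rewrite (_ : cabs 'i%C = 1); last by rewrite /= expr0n add0r expr1n sqrtr1.
  rewrite !mulr1 mulrA -expr2 real_normK ?num_real// expr1 => H.
  rewrite [leLHS](_ : _ = 2 * h ^+ 2 * (th ^+ 2 * cabs (g x))); last by ring.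
  rewrite [leRHS](_ : _ = 2 * h ^+ 2 * (a * weight x)); last by ring.
  by rewrite ler_wpM2l// mulr_ge0// sqr_ge0.
Qed.

Lemma smooth_fcheck g : ccont g -> smooth (fcheck g).
Proof.
move=> cg; apply: Ck_smooth => k; elim: k g cg => [|k ih] g cg.
  by split; first exact: ccont_fcheck_cont.
split; first exact: ccont_fcheck_cont.
move=> i; split => [x|]; first exact: has_pderiv_able (pderiv_fcheck i x cg).
rewrite (_ : pderiv i _ = fcheck (fun x => cmonom i x * g x)).
  by apply: ih; exact: ccont_cmonom.
by apply/funext => y; apply: has_pderiv_val; exact: pderiv_fcheck.
Qed.

Lemma smooth_cmonom i : smooth (cmonom i).
Proof.
apply: smooth_mul; last exact: smooth_cst.
rewrite (_ : (fun _ => _) = fun x => (2 * pi)%:C * (x 0 i)%:C).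
  by apply: smooth_mul; [exact: smooth_cst|exact: smooth_coord].
by apply/funext => x; rewrite rmorphM.
Qed.

Lemma ccsmooth_cmonom i g : ccsmooth g -> ccsmooth (fun x => cmonom i x * g x).
Proof.
move=> sg; rewrite (_ : (fun _ => _) = fun x => g x * cmonom i x).
  by apply: (ccsmooth_mul sg); exact: smooth_cmonom.
by apply/funext => x; rewrite mulrC.
Qed.

Lemma schwartz_fcheck g : ccsmooth g -> schwartz (fcheck g).
Proof.
move=> sg; apply/schwartzP; split; first exact: smooth_fcheck sg.2.
move=> a b; elim/last_ind: b g sg => [|b i ih] g sg.
  have sp := ccsmooth_schwartz (ccsmooth_pderivs a sg).
  have [c Hc] := schwartz_decay 1 sp.
  exists (c * W) => y; apply: le_trans (fcheck_monom a y (ccsmooth_schwartz sg)) _.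
  apply: fcheck_bound; first exact/smooth_cont/schwartz_smooth.
  by move=> x; have := Hc x; rewrite expr1.
rewrite pderivs_rcons (_ : pderiv i _ = fcheck (fun x => cmonom i x * g x)).
  by apply: ih; exact: ccsmooth_cmonom.
by apply/funext => y; apply: has_pderiv_val; apply: pderiv_fcheck sg.2.
Qed.

End Fourier.

(** * Convolution *)

Section Convolution.
Variables (R : realType) (d : nat).
Local Notation V := 'rV[R]_d.
Local Notation C := R[i].
Implicit Types (f g h F : V -> C) (x y z t : V) (i j : 'I_d).
Local Notation ei i := (delta_mx 0 i : V).
Local Notation W := (rintegral (@weight R d)).

Lemma cc_reflect h x : continuous (h : V -> (C : numFieldType)) ->
  continuous ((fun y => h (x - y)) : V -> (C : numFieldType)).
Proof.
move=> ch; have c : continuous (fun y : V => x - y).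
  by move=> y; apply: (@cvgB _ _ _ (nbhs y)); [exact: cvg_cst|exact: cvg_id].
exact: (cc_comp c ch).
Qed.

Lemma decaying_conv f h x : decaying f -> ccont h -> decaying (fun y => f y * h (x - y)).
Proof.
move=> df ch; have [M M0 HM] := ccont_bounded ch.
exact: (decaying_mul df (@cc_reflect h x (ccont_cont ch)) (fun y => HM (x - y))).
Qed.

Lemma convolution_cont f h : decaying f -> ccont h ->
  continuous (convolution f h : V -> (C : numFieldType)).
Proof.
move=> df ch; have [cf [a Ha]] := df; apply/ccP => x e e0.
have W0 := @rintegral_weight_ge0 R d.
have a0 : 0 <= a.
  by rewrite -(pmulr_lge0 a (weight_gt0 (0 : V))); apply: le_trans (cabs_ge0 _) (Ha 0).
have K0 : 0 < a * W + 1 by rewrite ltr_wpDl// mulr_ge0.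
have [r r0 Hr] := ccont_uniform ch (divr_gt0 e0 K0).
exists r => // z zx; rewrite /convolution -cintegral_sub; try exact: decaying_conv.
apply: (@le_lt_trans _ _ (a * (e / (a * W + 1)) * W)).
  apply: cintegral_bound.
    exact: decaying_cont (decaying_sub (decaying_conv z df ch) (decaying_conv x df ch)).
  move=> y; rewrite -mulrBr cabsM mulrAC ler_pM ?cabs_ge0// ltW// Hr//.
  by rewrite opprB addrA subrK.
rewrite [ltLHS](_ : _ = e * (a * W / (a * W + 1))); last by ring.
by rewrite gtr_pMr// ltr_pdivrMr//; lra.
Qed.

Lemma convolution_eq0 f h (r s : R) :
  (forall x, r < `|x| -> f x = 0) -> (forall x, s < `|x| -> h x = 0) ->
  forall x, r + s < `|x| -> convolution f h x = 0.
Proof.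
move=> Hr Hs x xrs; rewrite /convolution -[RHS](cintegral_zero R d).
congr cintegral; apply/funext => y.
have [yr|yr] := ltP r `|y|; first by rewrite Hr// mul0r.
rewrite Hs ?mulr0//; apply: lt_le_trans (lerB_dist _ _).
by rewrite ltrBrDr; apply: le_lt_trans xrs; rewrite addrC lerD2r.
Qed.

Lemma ccont_convolution f h : ccont f -> ccont h -> ccont (convolution f h).
Proof.
move=> cf ch; apply/ccontE; split.
  exact: convolution_cont (decaying_ccont cf) ch.
have /ccontE[_ [r Hr]] := cf; have /ccontE[_ [s Hs]] := ch.
by exists (r + s); exact: convolution_eq0.
Qed.

Lemma has_pderiv_convolution i f h x : decaying f -> ccsmooth h ->
  has_pderiv i (convolution f h) x (convolution f (pderiv i h) x).
Proof.
move=> df sh.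
have s1 := ccsmooth_pderivs [:: i] sh; have s2 := ccsmooth_pderivs [:: i; i] sh.
have [M M0 HM] := ccont_bounded s2.2; have [_ [a Ha]] := df.
apply: (@has_pderiv_cintegral _ _ i (fun z y => f y * h (z - y))
  (fun z y => f y * pderiv i h (z - y)) x (2 * (a * M))).
- by move=> z; exact: decaying_conv df sh.2.
- exact: decaying_conv df s1.2.
- move=> s y s1'; rewrite (addrAC x (s *: ei i) (- y)).
  have -> : f y * h (x - y + s *: ei i) - f y * h (x - y) -
      s%:C * (f y * pderiv i h (x - y)) =
      f y * (h (x - y + s *: ei i) - h (x - y) - s%:C * pderiv i h (x - y)) by ring.
  rewrite cabsM; apply: (@le_trans _ _ (a * weight y * (2 * M * s ^+ 2))).
    apply: ler_pM; [exact: cabs_ge0|exact: cabs_ge0|exact: Ha|].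
    by apply: smooth_taylor sh.1 _ => t _; exact: HM.
  by rewrite le_eqVlt; apply/orP; left; apply/eqP; ring.
Qed.

Lemma pderivs_convolution s f h : decaying f -> ccsmooth h ->
  pderivs s (convolution f h) = convolution f (pderivs s h).
Proof.
move=> df; elim/last_ind: s h => [|s i ih] h sh; first by [].
rewrite !pderivs_rcons (_ : pderiv i _ = convolution f (pderiv i h)).
  by apply: ih; exact: (ccsmooth_pderivs [:: i] sh).
by apply/funext => x; apply: has_pderiv_val; exact: has_pderiv_convolution.
Qed.

Lemma smooth_convolution f h : decaying f -> ccsmooth h -> smooth (convolution f h).
Proof.
move=> df sh s; rewrite pderivs_convolution//.
have sp := ccsmooth_pderivs s sh; split.
  exact: convolution_cont df sp.2.
by move=> i x; exact: has_pderiv_able (has_pderiv_convolution i x df sp).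
Qed.

Lemma ccsmooth_convolution f h : ccont f -> ccsmooth h -> ccsmooth (convolution f h).
Proof.
move=> cf sh; split; first exact: smooth_convolution (decaying_ccont cf) sh.
exact: ccont_convolution cf sh.2.
Qed.

(** ** The reflected conjugate *)

Lemma ccont_tilde f : ccont f -> ccont (tilde f).
Proof.
move=> /ccontE[cf [r Hr]]; apply/ccontE; split.
  apply: cc_conj; rewrite (_ : (fun _ => _) = fun x => f (0 - x)).
    exact: (@cc_reflect f 0 cf).
  by apply/funext => x; rewrite sub0r.
by exists r => x xr; rewrite /tilde Hr ?normrN// conjc0.
Qed.

Lemma ccsmooth_tilde f : ccsmooth f -> ccsmooth (tilde f).
Proof.
move=> sf; split; last exact: ccont_tilde sf.2.
apply: smooth_conj; rewrite (_ : (fun _ => _) = fun x => f (-1 *: x)).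
  exact: (smooth_dilate (-1) sf.1).
by apply/funext => x; rewrite scaleN1r.
Qed.

Lemma tildeK f : tilde (tilde f) = f.
Proof. by apply/funext => x; rewrite /tilde opprK conjcK. Qed.

Lemma fcheck_tilde f y : decaying f -> fcheck (tilde f) y = (fcheck f y)^*.
Proof.
move=> df; rewrite !fcheckE -cintegral_conj; last exact: decaying_wave.
have dw := decaying_wave y df.
have dc : decaying (fun x => (f x * wave x y)^*).
  split; first exact: cc_conj (decaying_cont dw).
  by have [_ [a Ha]] := dw; exists a => x; rewrite cabs_conj.
rewrite -(cintegral_reflect 0 dc); congr cintegral; apply/funext => x.
have cM (u v : C) : (u * v)^*%C = u^*%C * v^*%C := rmorphM (@conjc R) u v.
by rewrite /tilde sub0r cM waveNl conjcK.
Qed.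

(** ** Mollifiers *)

Definition mollifier (r : R) (k : V -> R) : Prop :=
  [/\ ccsmooth (fun x => (k x)%:C), forall x, 0 <= k x,
      forall x, r < `|x| -> k x = 0 & cintegral (fun x => (k x)%:C) = 1].

Lemma mollifier_le (r s : R) (k : V -> R) : r <= s -> mollifier r k -> mollifier s k.
Proof. by move=> rs [sk k0 kr k1]; split => // x xs; apply: kr; exact: le_lt_trans xs. Qed.

Lemma mollifier_exists (r : R) : 0 < r -> exists k, mollifier r k.
Proof.
move=> r0; pose b x := bumpv (r^-1 *: x).
have sb : smooth (fun x => (b x)%:C) := smooth_dilate r^-1 (@bumpv_smooth R d).
have b0 x : r < `|x| -> b x = 0.
  move=> xr; apply: bumpv_eq0; rewrite normrZ gtr0_norm ?invr_gt0//.
  by rewrite mulrC ltr_pdivlMr// mul1r.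
have cb : ccont (fun x => (b x)%:C).
  apply/ccontE; split; first exact: smooth_cont sb.
  by exists r => x /b0 ->.
have cb' := cc_re (ccont_cont cb).
have I0 : 0 < rintegral b.
  apply: rintegral_gt0; [exact: cb'|exact: (decaying_re (decaying_ccont cb))| |].
  - by move=> x; exact: bumpv_ge0.
  - by rewrite /b scaler0 bumpv_gt0// normr0.
have E : cintegral (fun x => (b x)%:C) = (rintegral b)%:C.
  rewrite cintegralE; apply: complex_eq => //=.
  by rewrite /rintegral Rintegral_cst//= mul0r.
exists (fun x => (rintegral b)^-1 * b x); split.
- rewrite (_ : (fun _ => _) = fun x => (b x)%:C * (rintegral b)^-1%:C).
    by apply: ccsmooth_mul; [split; [exact: sb|exact: cb]|exact: smooth_cst].
  by apply/funext => x; rewrite mulrC rmorphM.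
- by move=> x; rewrite mulr_ge0 ?bumpv_ge0// invr_ge0 ltW.
- by move=> x /b0 ->; rewrite mulr0.
- rewrite (_ : (fun _ => _) = fun x => (rintegral b)^-1%:C * (b x)%:C).
    rewrite (cintegral_scale _ (decaying_ccont cb)) E -rmorphM mulVf ?rmorph1//.
    by rewrite gt_eqF.
  by apply/funext => x; rewrite rmorphM.
Qed.

Lemma mollifier_rintegral r k : mollifier r k -> rintegral k = 1.
Proof. by move=> [_ _ _]; rewrite cintegralE => -[]. Qed.

Lemma mollifier_decaying r k : mollifier r k -> decaying (fun x => (k x)%:C).
Proof. by move=> [[_ ck] _ _ _]; exact: decaying_ccont. Qed.

(** A convolution with a mollifier averages values at distance at most [r]. *)
Lemma convolution_mollifier f (r e : R) k : mollifier r k -> ccont f ->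
  (forall x y, `|y - x| <= r -> cabs (f y - f x) <= e) ->
  forall x, cabs (convolution f (fun x => (k x)%:C) x - f x) <= e.
Proof.
move=> mk cf He x; have [[sk ck] k0 kr k1] := mk.
have dk := mollifier_decaying mk.
have dkx : decaying (fun y => (k (x - y))%:C).
  apply: decaying_ccont; apply/ccontE; split; first exact: (@cc_reflect _ x (ccont_cont ck)).
  have /ccontE[_ [s Hs]] := ck; exists (s + `|x|) => y ys; apply: Hs.
  by rewrite distrC; apply: lt_le_trans (lerB_dist _ _); rewrite ltrBrDr.
have -> : f x = cintegral (fun y => f x * (k (x - y))%:C).
  by rewrite cintegral_scale// (cintegral_reflect x dk) k1 mulr1.
rewrite /convolution -cintegral_sub; last 2 first.
- exact: decaying_conv (decaying_ccont cf) ck.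
- exact: decaying_scale.
have -> : e = rintegral (fun y => e * k (x - y)).
  rewrite rintegral_scale; last exact: decaying_re dkx.
  have := cintegral_reflect x dk; rewrite k1 cintegralE => -[-> _].
  by rewrite mulr1.
apply: cintegral_le.
- exact: decaying_sub (decaying_conv x (decaying_ccont cf) ck) (decaying_scale _ dkx).
- by apply: rintegrable_scale; exact: decaying_re dkx.
move=> y; rewrite -mulrBl cabsM cabs_rr ger0_norm//.
have [yr|yr] := leP `|x - y| r; first by rewrite ler_wpM2r// He// distrC.
by rewrite kr// !mulr0.
Qed.

Lemma mollify f (e : R) : ccont f -> 0 < e -> exists2 r : R, 0 < r &
  forall k, mollifier r k -> forall x, cabs (convolution f (fun x => (k x)%:C) x - f x) <= e.
Proof.
move=> cf e0; have [r r0 Hr] := ccont_uniform cf e0.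
exists (r / 2); first by rewrite divr_gt0.
move=> k mk; apply: (convolution_mollifier mk cf) => x y yx; apply/ltW/Hr.
by apply: le_lt_trans yx _; rewrite ltr_pdivrMr// mulr2n mulrDr mulr1 ltrDl.
Qed.

Lemma fcheck_mollifier (r : R) k y : 0 < r -> mollifier r k ->
  cabs (fcheck (fun x => (k x)%:C) y - 1) <= 4 * pi * d%:R * r * `|y|.
Proof.
move=> r0 mk; have [[sk ck] k0 kr k1] := mk; have dk := mollifier_decaying mk.
rewrite -k1 fcheckE -cintegral_sub//; last exact: decaying_wave.
set A := _ * `|y|.
have -> : A = rintegral (fun x => A * k x).
  rewrite rintegral_scale; last exact: decaying_re dk.
  by rewrite (mollifier_rintegral mk) mulr1.
apply: cintegral_le.
- exact: decaying_sub (decaying_wave y dk) dk.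
- by apply: rintegrable_scale; exact: decaying_re dk.
move=> x; rewrite -[X in _ - X]mulr1 -mulrBr cabsM cabs_rr ger0_norm// mulrC.
have [xr|xr] := leP `|x| r; last by rewrite kr// !mulr0.
rewrite ler_wpM2r//.
have := wave_lipschitz x y 0; rewrite subr0 (_ : wave x 0 = 1); last first.
  by rewrite /wave -(scale0r y) dotvZr mul0r mulr0 expi0.
move/le_trans; apply.
rewrite /A [leRHS](_ : _ = 2 * (2 * pi * (d%:R * (r * `|y|)))); last by ring.
by rewrite !ler_wpM2l ?pi2_ge0// ler_wpM2r.
Qed.

(** ** Fourier transforms of convolutions *)

(** Peetre's inequality for the weight: it bounds the double integrand of a
    convolution by a product of weights. *)
Lemma weight_peetre x y : weight (x - y) * weight y <= 2 ^+ d * weight x.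
Proof.
have -> : 2 ^+ d = \prod_(i < d) (2 : R) by rewrite prodr_const card_ord.
rewrite /weight -!big_split/=; apply: ler_prod => i _.
have p1 := oneDsq_gt0 (x 0 i); have p2 := oneDsq_gt0 (y 0 i).
have p3 := oneDsq_gt0 ((x - y) 0 i).
apply/andP; split; first by rewrite mulr_ge0// invr_ge0 ltW.
have H : 1 + x 0 i ^+ 2 <= 2 * ((1 + (x - y) 0 i ^+ 2) * (1 + y 0 i ^+ 2)).
  rewrite !mxE; move: (x 0 i) (y 0 i) => a b.
  by have := sqr_ge0 (a - 2 * b); have := sqr_ge0 ((a - b) * b); rewrite exprMn; nra.
rewrite ler_pdivlMr//; set A := 1 + x 0 i ^+ 2 in H p1 *.
set B := 1 + y 0 i ^+ 2 in H p2 *; set D := 1 + (x - y) 0 i ^+ 2 in H p3 *.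
have -> : D^-1 / B * A = A / (D * B).
  by field; rewrite !gt_eqF.
by rewrite ler_pdivrMr ?mulr_gt0.
Qed.

Lemma cc_fst f : continuous (f : V -> (C : numFieldType)) ->
  continuous ((fun p : V * V => f p.1) : V * V -> (C : numFieldType)).
Proof. by move=> cf; apply: (cc_comp _ cf) => p; exact: cvg_fst. Qed.

Lemma cc_snd f : continuous (f : V -> (C : numFieldType)) ->
  continuous ((fun p : V * V => f p.2) : V * V -> (C : numFieldType)).
Proof. by move=> cf; apply: (cc_comp _ cf) => p; exact: cvg_snd. Qed.

Lemma cc_diff f : continuous (f : V -> (C : numFieldType)) ->
  continuous ((fun p : V * V => f (p.1 - p.2)) : V * V -> (C : numFieldType)).
Proof.
move=> cf; apply: (cc_comp _ cf) => p.
by apply: (@cvgB _ _ _ (nbhs p)); [exact: cvg_fst|exact: cvg_snd].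
Qed.

Lemma fcheck_convolution f h y : ccont f -> ccont h ->
  fcheck (convolution f h) y = fcheck f y * fcheck h y.
Proof.
move=> cf ch; have [df dh] := (decaying_ccont cf, decaying_ccont ch).
pose F x t := f t * h (x - t) * wave x y.
have [a Ha] := ccont_weight 2 cf; have [b Hb] := ccont_weight 1 ch.
have a0 := decay_coef_ge0 (cabs_ge0 _) (Ha 0).
have b0 := decay_coef_ge0 (cabs_ge0 _) (Hb 0).
have cF : continuous ((fun p : V * V => F p.1 p.2) : V * V -> (C : numFieldType)).
  apply: cc_mul; last exact: cc_fst (@wave_cont R d y).
  apply: cc_mul; first exact: cc_snd (ccont_cont cf).
  exact: cc_diff (ccont_cont ch).
have bF x t : cabs (F x t) <= a * b * 2 ^+ d * weight x * weight t.
  rewrite /F !cabsM cabs_wave mulr1.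
  apply: (@le_trans _ _ (a * weight t ^+ 2 * (b * weight (x - t) ^+ 1))).
    by rewrite ler_pM ?cabs_ge0.
  rewrite expr1 [leLHS](_ : _ = a * b * weight t * (weight (x - t) * weight t)); last by ring.
  rewrite [leRHS](_ : _ = a * b * weight t * (2 ^+ d * weight x)); last by ring.
  by rewrite ler_wpM2l ?weight_peetre// !mulr_ge0 ?weight_ge0.
have := cintegral_fubini cF bF.
rewrite [LHS](_ : _ = fcheck (convolution f h) y); last first.
  rewrite fcheckE; congr cintegral; apply/funext => x; rewrite /F /convolution mulrC.
  rewrite -cintegral_scale; last exact: decaying_conv df ch.
  by congr cintegral; apply/funext => t; rewrite mulrC.
move=> ->; rewrite mulrC [fcheck f y]fcheckE -cintegral_scale; last exact: decaying_wave.
congr cintegral; apply/funext => t.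
have dw : decaying (fun x => wave t y * (h x * wave x y)).
  by apply: decaying_scale; exact: decaying_wave.
have E : cintegral (fun x => h (x - t) * wave x y) = wave t y * fcheck h y.
  rewrite fcheckE -cintegral_scale; last exact: decaying_wave.
  rewrite -(cintegral_shift (- t) dw); congr cintegral; apply/funext => x.
  by rewrite mulrCA -waveDl [t + _]addrC subrK.
rewrite [RHS](_ : _ = f t * (wave t y * fcheck h y)); last by ring.
rewrite -E -cintegral_scale.
  by congr cintegral; apply/funext => x; rewrite /F mulrA.
apply: decaying_wave; apply: decaying_ccont; apply/ccontE; split.
  exact: (cc_comp (@shift_cont R d t) (ccont_cont ch)).
have /ccontE[_ [s Hs]] := ch; exists (s + `|t|) => x xs; apply: Hs.
by apply: lt_le_trans (lerB_dist _ _); rewrite ltrBrDr.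
Qed.

End Convolution.

(** * Density of test functions and of their transforms *)

Section Density.
Variables (R : realType) (d : nat).
Local Notation V := 'rV[R]_d.
Local Notation C := R[i].
Implicit Types (f g h F : V -> C) (x y z t : V) (i j : 'I_d).
Local Notation ei i := (delta_mx 0 i : V).
Local Notation W := (rintegral (@weight R d)).

(** ** Cutting off *)

Lemma schwartz_monom_decay a p f : schwartz f ->
  exists2 r : R, 0 <= r & forall x, `|monom a x| * cabs (f x) <= r * weight x ^+ p.
Proof.
move=> /schwartzP[_ H].
have Hc b : exists r : R, forall x, `|monom b x| * cabs ((monom a x)%:C * f x) <= r.
  have [r Hr] := H (b ++ a) [::]; exists r => x; apply: le_trans (Hr x).
  by rewrite /monom big_cat/= normrM cabsM cabs_rr mulrA.
have [r Hr] := uniform_bound (p * d).*2 (fun b (_ : seq 'I_d) => Hc b).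
have K x := decay_of_monomials (p := p) (f := fun x => (monom a x)%:C * f x)
  (fun b hb => Hr b [::] hb (leq0n _) x).
exists (2 ^+ (p * d) * r); first exact: decay_coef_ge0 (cabs_ge0 _) (K 0).
by move=> x; have := K x; rewrite cabsM cabs_rr.
Qed.

(** The error of a cutoff, in a form inherited by derivatives: each derivative
    tends to 0 with [s], up to a linear growth in [x]. *)
Definition vanishing (E : R -> V -> C) : Prop := (forall s, smooth (E s)) /\
  forall q (e : R), 0 < e -> exists s0 A : R, [/\ 0 < s0, 0 <= A &
    forall s, 0 < s < s0 -> forall x, cabs (pderivs q (E s) x) <= e + A * s * `|x|].

(** By the product rule on [b]; the decay of the derivatives of [f] absorbs
    the monomial and the linear growth. *)
Lemma schwartz_vanishing b f E a (e : R) : schwartz f -> vanishing E -> 0 < e ->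
  exists2 s0 : R, 0 < s0 & forall s, 0 < s < s0 ->
    forall x, `|monom a x| * cabs (pderivs b (fun x => f x * E s x) x) <= e.
Proof.
elim/last_ind: b f E e => [|b i ih] f E e sf [sE HE] e0.
  have [r r0 Hr] := schwartz_monom_decay a 1 sf.
  have r1 : 0 < 2 * (r + 1) by rewrite mulr_gt0// ltr_wpDl.
  have [s1 [A [s10 A0 HA]]] := HE [::] (e / (2 * (r + 1))) (divr_gt0 e0 r1).
  have A1 : 0 < 2 * (r + 1) * (A + 1) by rewrite mulr_gt0// ltr_wpDl.
  exists (Num.min s1 (e / (2 * (r + 1) * (A + 1)))); first by rewrite lt_min s10 divr_gt0.
  move=> s /andP[s0]; rewrite lt_min => /andP[ss1 ss2] x.
  have sE1 := HA s; rewrite s0 ss1 in sE1; have {}sE1 := sE1 isT x.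
  rewrite /= cabsM mulrA.
  apply: (@le_trans _ _ (r * weight x * (e / (2 * (r + 1)) + A * s * `|x|))).
    apply: ler_pM; [by rewrite mulr_ge0 ?cabs_ge0|exact: cabs_ge0| |exact: sE1].
    by have := Hr x; rewrite expr1.
  apply: (@le_trans _ _ (r * (e / (2 * (r + 1)) + A * s))).
    rewrite -mulrA ler_wpM2l// mulrDr lerD//.
      by rewrite ler_piMl ?weight_le1// ltW// divr_gt0.
    by rewrite mulrCA ler_piMr ?weight_norm// mulr_ge0// ltW.
  have h1 : A * s <= e / (2 * (r + 1)).
    move: ss2; rewrite ltr_pdivlMr// => /ltW h.
    rewrite ler_pdivlMr//; apply: le_trans h.
    rewrite [leRHS](_ : _ = A * s * (2 * (r + 1)) + s * (2 * (r + 1))); last by ring.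
    by rewrite lerDl mulr_ge0// ltW.
  apply: (@le_trans _ _ (r * (e / (2 * (r + 1)) + e / (2 * (r + 1))))).
    by rewrite ler_wpM2l// lerD2l.
  rewrite (_ : _ + _ = e / (r + 1)); last by field; rewrite gt_eqF// ltr_wpDl.
  by rewrite mulrCA ler_piMr ?(ltW e0)// ler_pdivrMr ?ltr_wpDl//; lra.
have e20 : 0 < e / 2 by rewrite divr_gt0.
have vE' : vanishing (fun s => pderiv i (E s)).
  split; first by move=> s; exact: smooth_pderiv.
  move=> q e' e'0; have [s0 [A [h1 h2 h3]]] := HE (rcons q i) e' e'0.
  exists s0, A; split; [exact: h1|exact: h2|].
  by move=> s ss x; rewrite -pderivs_rcons; exact: h3.
have [s1 s10 H1] := ih _ E _ (schwartz_pderiv i sf) (conj sE HE) e20.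
have [s2 s20 H2] := ih _ _ _ sf vE' e20.
exists (Num.min s1 s2); first by rewrite lt_min s10.
move=> s /andP[s0]; rewrite lt_min => /andP[ss1 ss2] x.
have {}H1 := H1 s; rewrite s0 ss1 in H1; have {}H1 := H1 isT x.
have {}H2 := H2 s; rewrite s0 ss2 in H2; have {}H2 := H2 isT x.
have smf := schwartz_smooth sf.
rewrite pderivs_rcons (_ : pderiv i _ =
    fun x => pderiv i f x * E s x + f x * pderiv i (E s) x); last first.
  apply/funext => z; apply: has_pderiv_val.
  exact: (has_pderiv_mul (smooth_has_pderiv i z smf) (smooth_has_pderiv i z (sE s))).
rewrite pderivs_add; last 2 first.
- exact: smooth_mul (smooth_pderiv i smf) (sE s).
- exact: smooth_mul smf (smooth_pderiv i (sE s)).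
apply: (@le_trans _ _ (e / 2 + e / 2)); last by rewrite -splitr.
apply: (le_trans (ler_wpM2l (normr_ge0 _) (cabsD _ _))).
by rewrite mulrDr lerD.
Qed.

(** The cutoff [chi (s x)] tends to 1 locally uniformly as [s] tends to 0, and
    its derivatives are [O(s)]. *)
Lemma ccsmooth_dense f (N : nat) (e : R) : schwartz f -> 0 < e ->
  exists2 g, ccsmooth g & forall a b, (size a <= N)%N -> (size b <= N)%N ->
    forall x, `|monom a x| * cabs (pderivs b (fun x => f x - g x) x) <= e.
Proof.
move=> sf e0; pose b0 := bumpv (0 : V).
have b00 : 0 < b0 by apply: bumpv_gt0; rewrite normr0.
pose chi x : C := b0^-1%:C * (bumpv x)%:C.
have schi : ccsmooth chi.
  rewrite (_ : chi = fun x => (bumpv x)%:C * b0^-1%:C).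
    by apply: (ccsmooth_mul (@ccsmooth_bumpv R d)); exact: smooth_cst.
  by apply/funext => x; rewrite mulrC.
have chi0 : chi 0 = 1 by rewrite /chi -rmorphM mulVf ?gt_eqF.
pose E (s : R) x := -1 * chi (s *: x) + 1.
have dchi s : smooth (fun x => chi (s *: x)) := smooth_dilate s schi.1.
have vE : vanishing E.
  split; first by move=> s; apply: smooth_lin; [exact: dchi|exact: smooth_cst].
  move=> q e' e'0.
  have [M M0 HM] := ccont_bounded (ccsmooth_pderivs q schi).2.
  case/lastP: q => [|q i] in HM *.
    have /ccP/(_ 0 e' e'0)[r r0 Hr] := smooth_cont schi.1.
    exists 1, ((M + 1) / r); split=> //; first by rewrite divr_ge0 ?addr_ge0 ?(ltW M0)// ltW.
    move=> s /andP[s0 s1] x; rewrite -[pderivs _ _ _]/(E s x).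
    have -> : E s x = chi 0 - chi (s *: x) by rewrite chi0 /E mulN1r addrC.
    rewrite cabs_distC.
    have [xr|xr] := ltP `|s *: x| r.
      rewrite (le_trans (ltW (Hr _ _))) ?subr0// lerDl !mulr_ge0 ?invr_ge0 ?(ltW r0) ?(ltW s0)//.
      by rewrite addr_ge0// ltW.
    apply: (le_trans (cabsB _ _)); rewrite chi0 cabs1.
    apply: (@le_trans _ _ (M + 1)); first by rewrite lerD2r; exact: HM.
    rewrite -[leLHS]add0r lerD ?(ltW e'0)//.
    rewrite [leRHS](_ : _ = (M + 1) * (s * `|x| / r)); last by ring.
    rewrite ler_peMr ?addr_ge0 ?(ltW M0)// ler_pdivlMr// mul1r.
    by move: xr; rewrite normrZ gtr0_norm.
  exists (Num.min 1 (e' / (M + 1))), 0; split => //.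
    by rewrite lt_min ltr01 divr_gt0// addr_gt0.
  move=> s /andP[s0]; rewrite lt_min => /andP[s1 s2] x.
  rewrite pderivs_lin; [|exact: dchi|exact: smooth_cst].
  rewrite pderivs_cst pderivs_dilate ?size_rcons; last exact: schi.1.
  rewrite addr0 mul0r mul0r addr0 cabsM cabsN cabs1 mul1r cabsM cabs_rr.
  rewrite ger0_norm ?exprn_ge0 ?(ltW s0)//.
  apply: (@le_trans _ _ (s * (M + 1))).
    apply: ler_pM; [by rewrite exprn_ge0// ltW|exact: cabs_ge0| |].
      by rewrite exprS ler_piMr ?(ltW s0)// exprn_ile1// ltW.
    by rewrite (le_trans (HM _))// lerDl.
  by move: s2; rewrite ltr_pdivlMr ?addr_gt0// => /ltW.
have [s s0 Hs] := uniform_scale N (fun a b => schwartz_vanishing b a sf vE e0).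
exists (fun x => f x * chi (s *: x)).
  split; first exact: smooth_mul (schwartz_smooth sf) (dchi s).
  have /ccontE[_ [r Hr]] := schi.2.
  apply/ccontE; split.
    exact: cc_mul (smooth_cont (schwartz_smooth sf)) (smooth_cont (dchi s)).
  exists (r / s) => x xr; rewrite Hr ?mulr0// normrZ gtr0_norm//.
  by rewrite mulrC -ltr_pdivrMr.
move=> a b aN bN x; have := Hs a b aN bN x.
rewrite (_ : (fun x => f x * E s x) = fun x => f x - f x * chi (s *: x))//.
by apply/funext => z; rewrite /E; ring.
Qed.

(** ** Approximate inversion *)

(** Fubini. This replaces Fourier inversion: the factor [f] makes the double
    integral converge absolutely, and dilating [f] lets it tend to a constant. *)
Lemma fcheck_mul f h y : ccont f -> ccont h ->
  fcheck (fun x => f x * fcheck h (- x)) y = convolution (fcheck f) h y.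
Proof.
move=> cf ch; have df := decaying_ccont cf; have dh := decaying_ccont ch.
pose F x t := f x * h t * (wave t (- x) * wave x y).
have [a Ha] := ccont_weight 1 cf; have [b Hb] := ccont_weight 1 ch.
have cw : continuous ((fun p : V * V => wave p.2 (- p.1)) : V * V -> (C : numFieldType)).
  apply: cc_expi; apply: cr_mul; first exact: cr_cst.
  apply: cr_sum => i.
  have cfst : continuous (fun p : V * V => p.1 0 i).
    by move=> p; apply: (@cvg_comp _ _ _ fst (fun x : V => x 0 i) (nbhs p) (nbhs p.1));
      [exact: cvg_fst|exact: coord_cont].
  have csnd : continuous (fun p : V * V => p.2 0 i).
    by move=> p; apply: (@cvg_comp _ _ _ snd (fun x : V => x 0 i) (nbhs p) (nbhs p.2));
      [exact: cvg_snd|exact: coord_cont].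
  rewrite (_ : (fun _ => _) = fun p : V * V => p.2 0 i * (- p.1 0 i)).
    exact: cr_mul csnd (cr_opp cfst).
  by apply/funext => p; rewrite !mxE.
have cF : continuous ((fun p : V * V => F p.1 p.2) : V * V -> (C : numFieldType)).
  apply: cc_mul.
    exact: cc_mul (cc_fst (ccont_cont cf)) (cc_snd (ccont_cont ch)).
  exact: cc_mul cw (cc_fst (@wave_cont R d y)).
have bF x t : cabs (F x t) <= a * b * weight x * weight t.
  rewrite /F !cabsM !cabs_wave !mulr1.
  rewrite [leRHS](_ : _ = a * weight x ^+ 1 * (b * weight t ^+ 1)); last by ring.
  by rewrite ler_pM ?cabs_ge0.
have := cintegral_fubini cF bF.
rewrite [LHS](_ : _ = fcheck (fun x => f x * fcheck h (- x)) y); last first.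
  rewrite fcheckE; congr cintegral; apply/funext => x; rewrite fcheckE.
  rewrite [RHS](_ : _ = (f x * wave x y) * cintegral (fun t => h t * wave t (- x))); last by ring.
  rewrite -cintegral_scale; last exact: decaying_wave.
  by congr cintegral; apply/funext => t; rewrite /F; ring.
move=> ->; rewrite /convolution.
have sf2 : exists a : R, forall x, cabs (f x) <= a * weight x ^+ 2 := ccont_weight 2 cf.
have dc : decaying (fun t => h t * fcheck f (y - t)).
  have [a2 Ha2] := ccont_weight 1 cf.
  apply: (@decaying_mul _ _ h (fun t => fcheck f (y - t)) (a2 * W) dh).
    exact: (@cc_reflect _ _ (fcheck f) y (ccont_fcheck_cont cf)).
  by move=> t; apply: fcheck_bound (ccont_cont cf) _ => x; have := Ha2 x; rewrite expr1.
have -> : (fun t => fcheck f t * h (y - t)) =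
    (fun t => (fun t => h t * fcheck f (y - t)) (y - t)).
  by apply/funext => t; rewrite (_ : y - (y - t) = t) 1?[LHS]mulrC// opprB addrC subrK.
rewrite (cintegral_reflect y dc); congr cintegral; apply/funext => t.
rewrite fcheckE -cintegral_scale; last exact: decaying_wave.
congr cintegral; apply/funext => x; rewrite /F (waveDr x y (- t)) (waveC t).
by rewrite waveNl waveNr; ring.
Qed.

Lemma fcheck_dilate f (s : R) y : 0 < s -> ccont f ->
  fcheck (fun x => f (s *: x)) (s *: y) = (s^-1 ^+ d)%:C * fcheck f y.
Proof.
move=> s0 cf; have dw := decaying_wave y (decaying_ccont cf).
rewrite [fcheck f y]fcheckE (cintegral_affine 0 (lt0r_neq0 s0) dw) mulrA -rmorphM.
rewrite gtr0_norm// -exprMn mulVf ?gt_eqF// expr1n mul1r fcheckE.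
congr cintegral; apply/funext => x; rewrite addr0; congr (_ * _).
by rewrite /wave dotvZr dotvZl.
Qed.

Lemma ccsmooth_dilate f (s : R) : 0 < s -> ccsmooth f -> ccsmooth (fun x => f (s *: x)).
Proof.
move=> s0 sf; split; first exact: smooth_dilate s sf.1.
have /ccontE[_ [r Hr]] := sf.2; apply/ccontE; split.
  exact: smooth_cont (smooth_dilate s sf.1).
exists (r / s) => x xr; rewrite Hr// normrZ gtr0_norm//.
by rewrite mulrC -ltr_pdivrMr.
Qed.

(** Substituting [s *: t] moves the dilation from the kernel to the argument of
    [h], where uniform continuity applies. *)
Lemma convolution_dilate f h (s : R) y : 0 < s -> ccsmooth f -> ccont h ->
  convolution (fcheck (fun x => f (s *: x))) h y =
  cintegral (fun t => fcheck f t * h (y - s *: t)).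
Proof.
move=> s0 sf ch.
have sfs := ccsmooth_dilate s0 sf.
have dF := decaying_conv y (schwartz_decaying (schwartz_fcheck sfs)) ch.
rewrite /convolution (cintegral_affine 0 (lt0r_neq0 s0) dF).
rewrite -cintegral_scale.
  congr cintegral; apply/funext => t; rewrite addr0 (fcheck_dilate _ s0 sf.2) !mulrA -rmorphM.
  by rewrite gtr0_norm// -exprMn divff ?gt_eqF// expr1n mul1r.
have [M M0 HM] := ccont_bounded ch.
have dK := schwartz_decaying (schwartz_fcheck sf).
have dK' := decaying_scale (s^-1 ^+ d)%:C dK.
have c : continuous ((fun t => h (y - s *: t)) : V -> (C : numFieldType)).
  exact: (cc_comp (@dilate_cont R d s) (@cc_reflect _ _ h y (ccont_cont ch))).
rewrite (_ : (fun _ => _) = fun t => (s^-1 ^+ d)%:C * fcheck f t * h (y - s *: t)).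
  exact: (decaying_mul dK' c (fun t => HM _)).
by apply/funext => t; rewrite addr0 (fcheck_dilate _ s0 sf.2).
Qed.

Lemma monom_le a x : `|monom a x| <= (1 + `|x|) ^+ size a.
Proof.
elim: a => [|i a ih]; first by rewrite /monom big_nil normr1.
rewrite /monom big_cons normrM exprS -/(monom a x) ler_pM//.
by apply: le_trans (rv_coord x i) _; rewrite lerDr.
Qed.

(** Since [h] has support in a ball of radius [r], both values of [h] vanish
    unless [|y| <= |r| + |t|]; so the monomial costs at most a power of [1 +
    |r| + |t|], which the decay of the kernel absorbs. *)
Lemma approximate_identity f h a (e : R) : ccsmooth f -> ccont h -> 0 < e ->
  exists2 s0 : R, 0 < s0 & forall s, 0 < s < s0 -> forall y,
    `|monom a y| * cabs (cintegral (fun t => fcheck f t * h (y - s *: t)) -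
       cintegral (fcheck f) * h y) <= e.
Proof.
move=> sf ch e0.
have sK := schwartz_fcheck sf; have dK := schwartz_decaying sK.
have /ccontE[_ [r Hr]] := ch; have [M M0 HM] := ccont_bounded ch.
pose p := size a; have [q Hq] := schwartz_decay p.+2 sK.
have q0 := decay_coef_ge0 (cabs_ge0 _) (Hq 0).
have W0 := @rintegral_weight_ge0 R d.
pose B := q * (2 + `|r|) ^+ p * W + 1.
have B0 : 0 < B by rewrite ltr_wpDl// !mulr_ge0// exprn_ge0// addr_ge0.
have e1 : 0 < e / (2 * B) by rewrite divr_gt0// mulr_gt0.
have [de de0 Hde] := ccont_uniform ch e1.
pose A := 2 * M / de; have A0 : 0 <= A by rewrite !mulr_ge0 ?invr_ge0 ?(ltW M0)// ltW.
have h_close x y : cabs (h x - h y) <= e / (2 * B) + A * `|x - y|.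
  have [xy|xy] := ltP `|x - y| de.
    by rewrite (le_trans (ltW (Hde _ _ xy)))// lerDl mulr_ge0.
  rewrite -[leLHS]add0r lerD ?(ltW e1)// (le_trans (cabsB _ _))//.
  apply: (@le_trans _ _ (M + M)); first by rewrite lerD.
  rewrite [leRHS](_ : _ = (M + M) * (`|x - y| / de)); last by rewrite /A; ring.
  by rewrite ler_peMr ?addr_ge0 ?(ltW M0)// ler_pdivlMr// mul1r.
clearbody A; have AB0 : 0 < 2 * B * (A + 1) by rewrite !mulr_gt0// ltr_wpDl.
exists (Num.min 1 (e / (2 * B * (A + 1)))); first by rewrite lt_min ltr01 divr_gt0.
move=> s /andP[s0]; rewrite lt_min => /andP[s1 s2] y.
have cK := decaying_cont dK.
have c1 : continuous ((fun t => h (y - s *: t)) : V -> (C : numFieldType)).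
  exact: (cc_comp (@dilate_cont R d s) (@cc_reflect _ _ h y (ccont_cont ch))).
have d1 := decaying_mul dK c1 (fun t => HM _).
have d2 : decaying (fun t => h y * fcheck f t) by exact: decaying_scale.
rewrite [_ * h y]mulrC -(cintegral_scale _ dK) -(cintegral_sub d1 d2).
have -> : `|monom a y| = cabs (monom a y)%:C by rewrite cabs_rr.
rewrite -cabsM -(cintegral_scale _ (decaying_sub d1 d2)).
pose K := q * (2 + `|r|) ^+ p * (e / (2 * B) + A * s).
have As : A * s <= e / (2 * B).
  move: s2; rewrite ltr_pdivlMr// => /ltW h'.
  rewrite ler_pdivlMr ?mulr_gt0//; apply: le_trans h'.
  rewrite [leRHS](_ : _ = A * s * (2 * B) + s * (2 * B)); last by ring.
  by rewrite lerDl mulr_ge0 ?mulr_ge0// ltW.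
apply: (@le_trans _ _ (K * W)); last first.
  apply: (@le_trans _ _ (q * (2 + `|r|) ^+ p * (e / B) * W)).
    rewrite ler_wpM2r// ler_wpM2l ?mulr_ge0 ?exprn_ge0 ?addr_ge0//.
    rewrite (_ : e / B = e / (2 * B) + e / (2 * B)); first by rewrite lerD2l.
    by field; rewrite gt_eqF.
  rewrite [leLHS](_ : _ = e * ((q * (2 + `|r|) ^+ p * W) / B)); last by ring.
  by rewrite ler_piMr ?(ltW e0)// ler_pdivrMr// mul1r lerDl.
apply: cintegral_bound.
  apply: (cc_mul (@cc_cst _ _ (monom a y)%:C)).
  exact: decaying_cont (decaying_sub d1 d2).
move=> t; rewrite cabsM cabs_rr.
have -> : fcheck f t * h (y - s *: t) - h y * fcheck f t = fcheck f t * (h (y - s *: t) - h y) by ring.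
rewrite cabsM.
have dist : `|y - s *: t - y| = s * `|t| by rewrite addrAC subrr add0r normrN normrZ gtr0_norm.
have mono : `|monom a y| * cabs (h (y - s *: t) - h y) <=
    (1 + (`|r| + `|t|)) ^+ p * (e / (2 * B) + A * (s * `|t|)).
  have rt : 0 <= `|r| + `|t| by rewrite addr_ge0.
  have rhs0 : 0 <= e / (2 * B) + A * (s * `|t|).
    by rewrite addr_ge0 ?(ltW e1)// !mulr_ge0// ltW.
  have [yr|yr] := leP `|y| (`|r| + `|t|).
    rewrite ler_pM ?cabs_ge0//.
      by rewrite (le_trans (monom_le a y))// lerXn2r ?nnegrE ?addr_ge0// lerD2l.
    by have := h_close (y - s *: t) y; rewrite dist.
  have yr' : r < `|y| by apply: le_lt_trans yr; rewrite (le_trans (ler_norm r))// lerDl.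
  have st : s * `|t| <= `|t| by rewrite ler_piMl// ltW.
  have yst : r < `|y - s *: t|.
    apply: lt_le_trans (lerB_dist _ _); rewrite normrZ gtr0_norm// ltrBrDr.
    by apply: le_lt_trans yr; rewrite lerD// ler_norm.
  by rewrite !Hr// subrr cabs0 mulr0 mulr_ge0// exprn_ge0// addr_ge0.
rewrite [leLHS](_ : _ = cabs (fcheck f t) * (`|monom a y| * cabs (h (y - s *: t) - h y))); last by ring.
apply: (@le_trans _ _ (q * weight t ^+ p.+2 * ((1 + (`|r| + `|t|)) ^+ p * (e / (2 * B) + A * (s * `|t|))))).
  by rewrite ler_pM ?cabs_ge0// mulr_ge0// cabs_ge0.
have w0 := weight_ge0 t; have w1 := weight_le1 t; have wn := weight_norm t.
rewrite /K [leLHS](_ : _ = q * ((weight t * (1 + (`|r| + `|t|))) ^+ p *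
  (weight t * (e / (2 * B)) + A * s * (weight t * `|t|))) * weight t); last first.
  by rewrite exprMn !exprS; ring.
rewrite ler_wpM2r// -[leRHS]mulrA ler_wpM2l//.
have rt : 0 <= 1 + (`|r| + `|t|) by rewrite !addr_ge0.
apply: ler_pM; [by rewrite exprn_ge0// mulr_ge0| | |].
- apply: addr_ge0; first exact: mulr_ge0 w0 (ltW e1).
  by rewrite mulr_ge0 ?(mulr_ge0 A0 (ltW s0)) ?mulr_ge0.
- rewrite lerXn2r ?nnegrE ?mulr_ge0 ?addr_ge0//.
  rewrite mulrDr mulr1 mulrDr (_ : 2 + `|r| = 1 + (`|r| + 1)); last by ring.
  by rewrite lerD// lerD// ler_piMl.
- apply: lerD; first by rewrite ler_piMl// ltW.
  by rewrite ler_piMr// mulr_ge0// ltW.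
Qed.

(** Approximate inversion: the transform of [g (s x) * fcheck h (- x)] is the
    convolution of [h] with a dilation of [fcheck g]. For [g = B * tilde B]
    this kernel is [|fcheck B|^2], whose integral is positive. *)
Lemma fcheck_dense h (N : nat) (e : R) : ccsmooth h -> 0 < e ->
  exists2 u, ccsmooth u & forall a b, (size a <= N)%N -> (size b <= N)%N ->
    forall x, `|monom a x| * cabs (pderivs b (fun y => fcheck u y - h y) x) <= e.
Proof.
move=> sh e0.
pose B x : C := (bumpv x)%:C; have sB : ccsmooth B := @ccsmooth_bumpv R d.
pose g := convolution B (tilde B).
have sg : ccsmooth g by apply: ccsmooth_convolution sB.2 (ccsmooth_tilde sB).
have gE y : fcheck g y = (cabs (fcheck B y) ^+ 2)%:C.
  rewrite (fcheck_convolution y sB.2 (ccont_tilde sB.2)).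
  by rewrite (fcheck_tilde y (decaying_ccont sB.2)) cabs_sqr.
have df := decaying_ccont sB.2.
pose G y := cabs (fcheck B y) ^+ 2.
have dg := schwartz_decaying (schwartz_fcheck sg).
have GRe : (fun y => complex.Re (fcheck g y)) = G by apply/funext => y; rewrite gE.
have iG : rintegrable G by rewrite -GRe; exact: decaying_re.
pose c := rintegral G.
have cE : cintegral (fcheck g) = c%:C.
  rewrite cintegralE GRe /c; congr (_ +i* _).
  rewrite (_ : (fun x => complex.Im (fcheck g x)) = fun=> 0); last by apply/funext => y; rewrite gE.
  by have /(congr1 (fun z : C => complex.Im z)) := @cintegral_zero R d; rewrite cintegralE.
have c0 : 0 < c.
  have cBc := ccont_fcheck_cont sB.2.
  apply: rintegral_gt0; [exact: cr_mul (cc_cabs cBc) (cc_cabs cBc)|exact: iG| |].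
    by move=> y; rewrite exprn_ge0 ?cabs_ge0.
  rewrite exprn_gt0// lt0r cabs_ge0 andbT; apply/negP => /eqP /cabs_eq0.
  rewrite fcheckE cintegralE => /(congr1 (fun z : C => complex.Re z))/= B0.
  have : 0 < rintegral (fun x : V => complex.Re (B x * wave x 0)).
    rewrite (_ : (fun _ => _) = @bumpv R d).
      apply: rintegral_gt0; [|exact: decaying_re df| |].
      - exact: cc_re (ccont_cont sB.2).
      - by move=> x; exact: bumpv_ge0.
      - by apply: bumpv_gt0; rewrite normr0.
    apply/funext => x; rewrite (_ : wave x 0 = 1) ?mulr1//.
    by rewrite /wave -(scale0r x) dotvZr mul0r mulr0 expi0.
  by rewrite B0 ltxx.
have ec : 0 < e * c by rewrite mulr_gt0.
have sgs (s : R) : 0 < s -> ccsmooth (fun x => g (s *: x)) by move=> s0; exact: ccsmooth_dilate.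
have [s s0 Hs] := uniform_scale N (fun a b =>
  approximate_identity a sg (ccsmooth_pderivs b sh).2 ec).
pose u x := (c^-1)%:C * (g (s *: x) * fcheck h (- x)).
have sv : ccsmooth (fun x => g (s *: x) * fcheck h (- x)).
  apply: (ccsmooth_mul (sgs s s0)).
  rewrite (_ : (fun _ => _) = fun x => fcheck h (-1 *: x)).
    exact: smooth_dilate (smooth_fcheck sh.2).
  by apply/funext => x; rewrite scaleN1r.
exists u.
  rewrite (_ : u = fun x => (g (s *: x) * fcheck h (- x)) * (c^-1)%:C).
    by apply: (ccsmooth_mul sv); exact: smooth_cst.
  by apply/funext => x; rewrite mulrC.
have dF := schwartz_decaying (schwartz_fcheck (sgs s s0)).
pose F t := (c^-1)%:C * fcheck (fun x => g (s *: x)) t.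
have dF' : decaying F by exact: decaying_scale.
have convF k x : ccont k -> convolution F k x =
    (c^-1)%:C * convolution (fcheck (fun x => g (s *: x))) k x.
  move=> ck; rewrite /convolution -cintegral_scale; last exact: decaying_conv.
  by congr cintegral; apply/funext => t; rewrite mulrA.
move=> a b aN bN x.
have -> : (fun y => fcheck u y - h y) = fun y => -1 * h y + convolution F h y.
  apply/funext => y; rewrite /u (fcheck_scale _ (decaying_ccont sv.2)).
  by rewrite (fcheck_mul y (sgs s s0).2 sh.2) (convF _ _ sh.2) mulN1r addrC.
rewrite (pderivs_lin _ _ sh.1 (smooth_convolution dF' sh)) (pderivs_convolution b dF' sh).
have cb := (ccsmooth_pderivs b sh).2.
rewrite (convF _ _ cb) (convolution_dilate x s0 sg cb).
have := Hs a b aN bN x; rewrite cE; set I := cintegral _.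
set H := pderivs b h x.
have -> : -1 * H + c^-1%:C * I = c^-1%:C * (I - c%:C * H).
  by rewrite mulrBr mulrA -rmorphM mulVf ?gt_eqF// mulN1r mul1r addrC.
have ci : `|c^-1| = c^-1 by rewrite gtr0_norm ?invr_gt0.
rewrite cabsM cabs_rr ci => Hle.
by rewrite [leLHS]mulrCA (mulrC c^-1) ler_pdivrMr.
Qed.

End Density.

(** * The large sieve *)

Section LargeSieve.
Variables (R : realType) (d : nat).
Local Notation V := 'rV[R]_d.
Local Notation C := R[i].
Implicit Types (f g h F : V -> C) (x y z t : V).
Local Notation W := (rintegral (@weight R d)).

Lemma decaying_sum (I : Type) (s : seq I) (F : I -> V -> C) :
  (forall k, decaying (F k)) -> decaying (fun x => \sum_(k <- s) F k x).
Proof.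
move=> H; elim: s => [|k s ih].
  rewrite (_ : (fun _ => _) = fun=> 0); first exact: decaying_zero.
  by apply/funext => x; rewrite big_nil.
rewrite (_ : (fun _ => _) = fun x => 1 * F k x + \sum_(j <- s) F j x).
  exact: decaying_lin (H k) ih.
by apply/funext => x; rewrite big_cons mul1r.
Qed.

Lemma cintegral_sum (I : Type) (s : seq I) (F : I -> V -> C) :
  (forall k, decaying (F k)) ->
  cintegral (fun x => \sum_(k <- s) F k x) = \sum_(k <- s) cintegral (F k).
Proof.
move=> H; elim: s => [|k s ih].
  rewrite big_nil -[RHS](@cintegral_zero R d).
  by congr cintegral; apply/funext => x; rewrite big_nil.
rewrite big_cons -ih -cintegral_add; [|exact: H|exact: decaying_sum].
by congr cintegral; apply/funext => x; rewrite big_cons.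
Qed.

(** Duality: the sum is the integral of [f] against the exponential polynomial
    [G] with coefficients the conjugate values of [fcheck f], and the almost
    diagonal Gram matrix of the exponentials bounds the norm of [G] in
    [L2 (th)]. *)
Lemma large_sieve (I : finType) (y : I -> V) f (th : V -> R) (A D : R) :
  ccont f -> decaying (fun x => (th x)%:C) -> (forall x, 0 <= th x) ->
  (forall x, f x != 0 -> 1 <= th x) -> 0 < A -> 0 < D ->
  (forall t, cabs (fcheck (fun x => (th x)%:C) t) <= A * weight t) ->
  (forall j, \sum_k weight (y k - y j) <= D) ->
  \sum_k cabs (fcheck f (y k)) ^+ 2 <=
    A * D * rintegral (fun x => cabs (f x) ^+ 2).
Proof.
move=> cf dth th0 th1 A0 D0 thA wD.
have df := decaying_ccont cf.
have mid (u v w : R) : u <= w -> v <= w -> (u + v) / 2 <= w by lra.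
have [a aE] : exists a : I -> C, forall k, a k = (fcheck f (y k))^*%C.
  by exists (fun k => (fcheck f (y k))^*%C).
pose S := \sum_k cabs (a k) ^+ 2.
have -> : \sum_k cabs (fcheck f (y k)) ^+ 2 = S.
  by apply: eq_bigr => k _; rewrite aE cabs_conj.
pose G x := \sum_k a k * wave x (y k).
pose Q x := \sum_j \sum_k a j * (a k)^*%C * ((th x)%:C * wave x (y j - y k)).
have dQ j k : decaying (fun x => a j * (a k)^*%C * ((th x)%:C * wave x (y j - y k))).
  by apply: decaying_scale; exact: decaying_wave.
have dQs : decaying Q by apply: decaying_sum => j; apply: decaying_sum => k; exact: dQ.
have QE x : Q x = (th x * cabs (G x) ^+ 2)%:C.
  have -> : (th x * cabs (G x) ^+ 2)%:C = (th x)%:C * (G x * (G x)^*%C).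
    by rewrite -cabs_sqr; exact: (rmorphM (real_complex R)).
  rewrite /Q /G.
  have cS (u : I -> C) : (\sum_k u k)^*%C = \sum_k (u k)^*%C.
    exact: (rmorph_sum (@conjc R)).
  rewrite cS big_distrlr mulr_sumr; apply: eq_bigr => j _.
  rewrite mulr_sumr; apply: eq_bigr => k _.
  have cM (u v : C) : (u * v)^*%C = u^*%C * v^*%C := rmorphM (@conjc R) u v.
  rewrite cM waveDr waveNr.
  by move: (a j) ((a k)^*%C) (wave x (y j)) ((wave x (y k))^*%C) => p q u v /=; ring.
have intQ : cintegral Q =
    \sum_j \sum_k a j * (a k)^*%C * fcheck (fun x => (th x)%:C) (y j - y k).
  rewrite cintegral_sum; last by move=> j; apply: decaying_sum => k; exact: dQ.
  apply: eq_bigr => j _; rewrite cintegral_sum; last by move=> k; exact: dQ.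
  by apply: eq_bigr => k _; rewrite cintegral_scale ?fcheckE//; exact: decaying_wave.
have QS : cabs (cintegral Q) <= A * D * S.
  have cabs_sum (J : Type) (s : seq J) (u : J -> C) :
      cabs (\sum_(k <- s) u k) <= \sum_(k <- s) cabs (u k).
    elim: s => [|k s ih]; first by rewrite !big_nil cabs0.
    by rewrite !big_cons (le_trans (cabsD _ _))// lerD2l.
  rewrite intQ; apply: (le_trans (cabs_sum _ _ _)).
  pose w j k := A * weight (y j - y k).
  (* Schur's test: replace the product by the mean of the squares, then sum
     the weights first. *)
  apply: (@le_trans _ _ (\sum_j \sum_k ((cabs (a j) ^+ 2 + cabs (a k) ^+ 2) / 2 * w j k))).
    apply: ler_sum => j _; apply: (le_trans (cabs_sum _ _ _)); apply: ler_sum => k _.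
    rewrite !cabsM cabs_conj ler_pM ?mulr_ge0 ?cabs_ge0 ?thA//.
    have := sqr_ge0 (cabs (a j) - cabs (a k)).
    by move: (cabs (a j)) (cabs (a k)) => u v; nra.
  have half : \sum_j \sum_k cabs (a k) ^+ 2 * w j k <= A * D * S.
    rewrite exchange_big/= /S mulr_sumr; apply: ler_sum => k _.
    rewrite -mulr_sumr mulrC ler_wpM2r ?exprn_ge0 ?cabs_ge0//.
    by rewrite /w -mulr_sumr ler_wpM2l ?(ltW A0).
  have half' : \sum_j \sum_k cabs (a j) ^+ 2 * w j k <= A * D * S.
    rewrite exchange_big/= in half; apply: le_trans half.
    apply: ler_sum => j _; apply: ler_sum => k _.
    by rewrite /w -weightN opprB.
  have -> : \sum_j \sum_k ((cabs (a j) ^+ 2 + cabs (a k) ^+ 2) / 2 * w j k) =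
      (\sum_j \sum_k cabs (a j) ^+ 2 * w j k + \sum_j \sum_k cabs (a k) ^+ 2 * w j k) / 2.
    rewrite -big_split/= mulr_suml; apply: eq_bigr => j _.
    rewrite -big_split/= mulr_suml; apply: eq_bigr => k _.
    by rewrite -mulrDl mulrAC.
  exact: mid half' half.
have cw : continuous (G : V -> (C : numFieldType)).
  rewrite (_ : G = fun x => \sum_(k <- enum I) a k * wave x (y k)); last first.
    by apply/funext => x; rewrite big_enum.
  elim: (enum I) => [|k s ih].
    rewrite (_ : (fun _ => _) = fun=> 0); first exact: cc_cst.
    by apply/funext => x; rewrite big_nil.
  rewrite (_ : (fun _ => _) = fun x => a k * wave x (y k) + \sum_(j <- s) a j * wave x (y j)).
    exact: cc_add (cc_mul (@cc_cst _ _ _) (@wave_cont R d (y k))) ih.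
  by apply/funext => x; rewrite big_cons.
have dk k : decaying (fun x => a k * (f x * wave x (y k))).
  by apply: decaying_scale; exact: decaying_wave.
have fG : (fun x => f x * G x) = fun x => \sum_k a k * (f x * wave x (y k)).
  by apply/funext => x; rewrite /G mulr_sumr; apply: eq_bigr => k _; ring.
have dfG : decaying (fun x => f x * G x) by rewrite fG; exact: decaying_sum.
have intfG : cintegral (fun x => f x * G x) = S%:C.
  rewrite fG cintegral_sum// (rmorph_sum (real_complex R)); apply: eq_bigr => k _.
  rewrite cintegral_scale; last exact: decaying_wave.
  transitivity (a k * (a k)^*%C); last by rewrite -cabs_sqr.
  by rewrite -fcheckE aE conjcK.
have S0 : 0 <= S by apply: sumr_ge0 => k _; rewrite exprn_ge0 ?cabs_ge0.
have B0 : 0 < A * D by rewrite mulr_gt0.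
set B := A * D in QS B0 *; clearbody B.
have if2 : rintegrable (fun x => cabs (f x) ^+ 2).
  have [M M0 HM] := ccont_bounded cf.
  have cM : continuous (fun x => cabs (f x) ^+ 2).
    by apply: cr_mul; apply: cc_cabs; exact: ccont_cont cf.
  apply: (rintegrable_le cM (rintegrable_scale M (decaying_cabs df))) => x.
  by rewrite ger0_norm ?exprn_ge0 ?cabs_ge0// expr2 ler_wpM2r ?cabs_ge0.
have iQ : rintegrable (fun x => complex.Re (Q x)) := decaying_re dQs.
(* [2 |f G| <= B |f|^2 + |G|^2 / B], and [th] may be inserted because it is at
   least 1 where [f] does not vanish. With this [B] half of [S] is absorbed. *)
have key : S <= rintegral (fun x => B / 2 * cabs (f x) ^+ 2 + (2 * B)^-1 * complex.Re (Q x)).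
  have -> : S = cabs (cintegral (fun x => f x * G x)) by rewrite intfG cabs_rr ger0_norm.
  apply: (cintegral_le dfG).
    by apply: rintegrable_add; exact: rintegrable_scale.
  move=> x; rewrite QE/= cabsM.
  have [fx|fx] := eqVneq (f x) 0.
    rewrite fx cabs0 mul0r addr_ge0// ?mulr_ge0 ?exprn_ge0 ?invr_ge0 ?cabs_ge0// ltW//.
    by rewrite mulr_gt0.
  apply: (@le_trans _ _ (B / 2 * cabs (f x) ^+ 2 + (2 * B)^-1 * cabs (G x) ^+ 2)).
    rewrite -subr_ge0 (_ : _ - _ = (B * cabs (f x) - cabs (G x)) ^+ 2 / (2 * B)).
      by rewrite divr_ge0 ?sqr_ge0// mulr_ge0// ltW.
    by field; rewrite gt_eqF.
  rewrite lerD2l ler_wpM2l ?invr_ge0 ?mulr_ge0 ?(ltW B0)//.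
  by rewrite ler_peMl ?exprn_ge0 ?cabs_ge0 ?th1.
rewrite rintegral_add in key; [|exact: rintegrable_scale|exact: rintegrable_scale].
rewrite !rintegral_scale// in key.
have QR : rintegral (fun x => complex.Re (Q x)) <= B * S.
  apply: le_trans QS; apply: le_trans (cabs_re _); rewrite cintegralE/=.
  exact: ler_norm.
set X := rintegral _ in key *; set Y := rintegral _ in key QR.
have : (2 * B)^-1 * Y <= S / 2.
  rewrite ler_pdivrMl ?mulr_gt0// (_ : 2 * B * (S / 2) = B * S)//; last by field.
by move: key; rewrite (_ : B / 2 * X = B * X / 2); [lra|ring].
Qed.

(** The large sieve for one sample point in each lattice cell. The constant
    depends on [f] only through its support and its bound, which makes [f]
    replaceable by uniform approximants. *)
Lemma fcheck_sq_dominated m (c r : R) : is_measure m -> uniformly_dominated m c ->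
  exists2 K : R, 0 <= K & forall f (M : R), ccont f ->
    (forall x, r < `|x| -> f x = 0) -> (forall x, cabs (f x) <= M) ->
    dominated m (fun y => cabs (fcheck f y) ^+ 2) (K * M ^+ 2).
Proof.
move=> hm hc; pose s := (2 * (`|r| + 1))^-1.
have s0 : 0 < s by rewrite invr_gt0 mulr_gt0// ltr_wpDl.
(* The bump is bounded below on the ball of radius 1/2, to which the scaling
   by [s] maps the ball of radius [r]. *)
have [mn mn0 Hmn] : exists2 mn : R, 0 < mn & forall x, `|x| <= 2^-1 -> mn <= bumpv x.
  pose A := [set x : V | `|x| <= 2^-1].
  have A0 : A !=set0 by exists 0; rewrite /A/= normr0.
  have cb : continuous (@bumpv R d) := cc_re (smooth_cont (@bumpv_smooth R d)).
  have [x0 x0A Hx] := EVT_min_rV A0 (@compact_cball R d 2^-1) (continuous_subspaceT cb).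
  exists (bumpv x0); last by move=> x xA; apply: Hx; rewrite inE.
  apply: bumpv_gt0; rewrite inE in x0A; apply: le_lt_trans x0A _.
  by rewrite invf_lt1// ltr1n.
pose th x := mn^-1 * bumpv (s *: x).
have sth : ccsmooth (fun x => (th x)%:C).
  rewrite (_ : (fun _ => _) = fun x => (bumpv (s *: x))%:C * (mn^-1)%:C).
    by apply: (ccsmooth_mul (ccsmooth_dilate s0 (@ccsmooth_bumpv R d))); exact: smooth_cst.
  by apply/funext => x; rewrite /th mulrC rmorphM.
have [A HA] := schwartz_decay 1 (schwartz_fcheck sth).
have A0 : 0 < `|A| + 1 by rewrite ltr_wpDl.
have D0 : (0 : R) < 24 ^+ d by rewrite exprn_gt0.
have W0 := @rintegral_weight_ge0 R d.
pose K0 := (`|A| + 1) * 24 ^+ d * ((1 + r ^+ 2) ^+ d * W).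
have K00 : 0 <= K0.
  rewrite !mulr_ge0 ?(ltW A0) ?(ltW D0)// exprn_ge0// ltW//; exact: oneDsq_gt0.
exists (c * K0); first by rewrite mulr_ge0// (uniformly_dominated_ge0 hm hc).
move=> f M cf fr fM.
have cfc : continuous (fun y => cabs (fcheck f y) ^+ 2).
  by apply: cr_mul; apply: cc_cabs; exact: ccont_fcheck_cont.
rewrite (_ : (fun y => _) = fun y => cabs (fcheck f (y - 0)) ^+ 2); last first.
  by apply/funext => y; rewrite subr0.
rewrite -mulrA; apply: (lattice_dominated (h := fun y => cabs (fcheck f y) ^+ 2) hm hc cfc).
  by move=> x; rewrite exprn_ge0 ?cabs_ge0.
move=> N y yk.
have M0 : 0 <= M by apply: le_trans (fM 0); exact: cabs_ge0.
apply: (le_trans (large_sieve (th := th) (A := `|A| + 1) (D := 24 ^+ d) cf _ _ _ A0 D0 _ _)).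
- exact: decaying_ccont sth.2.
- by move=> x; rewrite mulr_ge0 ?invr_ge0 ?(ltW mn0)// bumpv_ge0.
- move=> x fx; have xr : `|x| <= r by rewrite leNgt; apply: contra fx => /fr ->.
  rewrite /th ler_pdivlMl// mulr1; apply: Hmn; rewrite normrZ gtr0_norm//.
  rewrite /s invfM -mulrA ler_piMr ?invr_ge0//.
  rewrite ler_pdivrMl ?ltr_wpDl// mulr1 (le_trans xr)// (le_trans (ler_norm r))//.
  by rewrite lerDl.
- move=> t; have := HA t; rewrite expr1 => /le_trans; apply.
  rewrite ler_wpM2r ?weight_ge0// (le_trans (ler_norm A))//.
  by rewrite lerDl.
- by move=> j; exact: lattice_sum_weight.
rewrite [leRHS](_ : _ = (`|A| + 1) * 24 ^+ d * (M ^+ 2 * (1 + r ^+ 2) ^+ d * W)); last first.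
  by rewrite /K0; ring.
rewrite ler_wpM2l ?mulr_ge0 ?(ltW A0) ?(ltW D0)//.
have cfm : continuous (fun x => cabs (f x) ^+ 2).
  by apply: cr_mul; apply: cc_cabs; exact: ccont_cont cf.
have fw x : cabs (f x) ^+ 2 <= M ^+ 2 * (1 + r ^+ 2) ^+ d * weight x.
  have [xr|xr] := leP `|x| r.
    rewrite -mulrA -[leLHS]mulr1 ler_pM ?exprn_ge0 ?cabs_ge0 ?weight_ball//.
    by rewrite lerXn2r ?nnegrE ?cabs_ge0.
  rewrite fr// cabs0 expr0n/= !mulr_ge0 ?weight_ge0 ?exprn_ge0//.
  by rewrite ltW// oneDsq_gt0.
have iw := rintegrable_scale (M ^+ 2 * (1 + r ^+ 2) ^+ d) (@rintegrable_weight R d).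
rewrite -rintegral_scale; last exact: rintegrable_weight.
apply: rintegral_le => //; apply: rintegrable_le cfm iw _ => x.
by rewrite ger0_norm ?exprn_ge0 ?cabs_ge0.
Qed.

End LargeSieve.

(** * Uniform boundedness *)

Section Uniform.
Variables (R : realType) (d : nat).
Local Notation V := 'rV[R]_d.
Local Notation C := R[i].
Implicit Types (f g h F : V -> C) (x y z t : V) (m : (V -> C) -> C).
Local Notation W := (rintegral (@weight R d)).

Definition carried (r : R) f := ccont f /\ forall x, r < `|x| -> f x = 0.

Lemma carried_lin (r : R) (a : C) f g : carried r f -> carried r g ->
  carried r (fun x => a * f x + g x).
Proof.
move=> [cf fr] [cg gr]; split; first exact: ccont_lin.
by move=> x xr; rewrite fr// gr// mulr0 addr0.
Qed.

(** Baire's theorem in the Banach space of the functions carried by a ball. *)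
Lemma baire_carried (r : R) (U : nat -> (V -> C) -> Prop) :
  (forall n s (e : R), carried r s -> 0 < e -> exists s' (e' : R),
     [/\ carried r s', 0 < e', forall x, cabs (s' x - s x) <= e &
       forall g, carried r g -> (forall x, cabs (g x - s' x) <= e') -> U n g]) ->
  exists2 g, carried r g & forall n, U n g.
Proof.
move=> H.
pose good (q : (V -> C) * R) := carried r q.1 /\ 0 < q.2.
have step (p : nat * {q | good q}) : exists q : {q | good q},
    [/\ (sval q).2 <= (sval p.2).2 / 4,
      forall x, cabs ((sval q).1 x - (sval p.2).1 x) <= (sval p.2).2 / 4 &
      forall g, carried r g -> (forall x, cabs (g x - (sval q).1 x) <= 2 * (sval q).2) ->
        U p.1 g].
  case: p => n [[s e] [/= cs e0]]; have e40 : 0 < e / 4 by rewrite divr_gt0.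
  have [s' [e' [cs' e'0 ss' HU]]] := H n s _ cs e40.
  have gq : good (s', Num.min (e' / 2) (e / 4)).
    by split; [exact: cs'|rewrite /= lt_min e40 divr_gt0].
  exists (exist _ _ gq); split => /=; [by rewrite ge_min lexx orbT|exact: ss'|].
  move=> g cg gs; apply: HU cg _ => x; apply: le_trans (gs x) _.
  rewrite mulrC -ler_pdivlMr//; first by rewrite ge_min lexx.
have [F HF] := choice step.
have g0 : good (fun=> 0, 1) by split => //; split; [exact: ccont_zero|].
(* Nested balls whose radii shrink by a factor 4, so that the tail of the
   sequence stays within the current radius. *)
pose fix u (n : nat) : {q | good q} := if n is n'.+1 then F (n', u n') else exist _ _ g0.
pose s n := (sval (u n)).1; pose e n := (sval (u n)).2.
have cs n : carried r (s n) := (svalP (u n)).1.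
have e0 n : 0 < e n := (svalP (u n)).2.
have e4 n : e n.+1 <= e n / 4 by have [h _ _] := HF (n, u n).
have s4 n x : cabs (s n.+1 x - s n x) <= e n / 4 by have [_ h _] := HF (n, u n); exact: h.
have sU n g : carried r g -> (forall x, cabs (g x - s n.+1 x) <= 2 * e n.+1) -> U n g.
  by have [_ _ h] := HF (n, u n); exact: h.
have e00 : e 0%N = 1 by [].
clearbody s e; have near k n x : cabs (s (n + k)%N x - s n x) <= e n.
  elim: k n => [|k ih] n; first by rewrite addn0 subrr cabs0 ltW.
  rewrite addnS -addSn -(subrK (s n.+1 x) (s (n.+1 + k)%N x)) -addrA.
  apply: (le_trans (cabsD _ _)).
  apply: (@le_trans _ _ (e n / 4 + e n / 4)).
    by apply: lerD; [exact: le_trans (ih _) (e4 n)|exact: s4].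
  by have := e0 n; lra.
have rate x n p : cabs (s n x - s p x) <= e n + e p.
  have [np|/ltnW pn] := leqP n p.
    rewrite cabs_distC -(subnKC np); apply: le_trans (near _ _ _) _.
    by rewrite lerDl ltW.
  rewrite -(subnKC pn); apply: le_trans (near _ _ _) _.
  by rewrite lerDr ltW.
have [g Hg] := choice (fun x => cauchy_rateC (rate x)).
have e_small (a : R) : 0 < a -> exists n, e n <= a.
  move=> a0; have eb n : e n <= n.+1%:R^-1.
    elim: n => [|n ih]; first by rewrite invr1 e00.
    apply: le_trans (e4 n) _; apply: (@le_trans _ _ (n.+1%:R^-1 / 2)).
      by move: ih (e0 n); move: (e n) (n.+1%:R^-1) => p q; lra.
    rewrite -invfM lef_pV2 ?posrE ?mulr_gt0//.
    by rewrite -natrM ler_nat muln2 doubleS !ltnS -addnn leq_addr.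
  exists (Num.truncn a^-1); apply: le_trans (eb _) _.
  by rewrite invf_ple ?posrE// ltW// truncnS_gt.
have cg : continuous (g : V -> (C : numFieldType)).
  apply/ccP => x a a0.
  have a80 : 0 < a / 8 by rewrite divr_gt0.
  have [n en] := e_small _ a80.
  have /ccP/(_ x (a / 8) a80)[de de0 Hde] := ccont_cont (cs n).1.
  exists de => // y yx.
  have -> : g y - g x = - (s n y - g y) + (s n x - g x) + (s n y - s n x) by ring.
  apply: (le_lt_trans (cabsD _ _)).
  have h1 := Hg y n; have h2 := Hg x n; have h3 := Hde y yx.
  have := cabsD (- (s n y - g y)) (s n x - g x); rewrite cabsN.
  lra.
have gr x : r < `|x| -> g x = 0.
  move=> xr; apply/cabs_eq0/eqP; rewrite eq_le cabs_ge0 andbT.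
  apply/ler_addgt0Pr => a a0; rewrite add0r.
  have [n en] := e_small _ (divr_gt0 a0 (ltr0Sn R 1)).
  have := Hg x n; rewrite (cs n).2// sub0r cabsN; lra.
have cgr : carried r g by split => //; apply/ccontE; split => //; exists r.
exists g; first exact: cgr.
move=> n; apply: (sU n g cgr) => x; rewrite cabs_distC.
by have := Hg x n.+1; rewrite mulr2n mulrDl mul1r.
Qed.

Lemma carried_fcheck_bound (r e : R) g y : carried r g ->
  (forall x, cabs (g x) <= e) -> cabs (fcheck g y) <= e * ((1 + r ^+ 2) ^+ d * W).
Proof.
move=> [cg gr] ge; rewrite mulrA; apply: fcheck_bound; first exact: ccont_cont.
have e0 : 0 <= e := le_trans (cabs_ge0 _) (ge 0).
move=> x; have [xr|xr] := leP `|x| r.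
  by rewrite -mulrA -[leLHS]mulr1 ler_pM ?cabs_ge0 ?weight_ball.
rewrite gr// cabs0 !mulr_ge0 ?weight_ge0// exprn_ge0// ltW//; exact: oneDsq_gt0.
Qed.

Lemma dominated_parallelogram m f g (c : R) : is_measure m -> ccont f -> ccont g ->
  dominated m (fun y => cabs (fcheck (fun x => f x + g x) y) ^+ 2) c ->
  dominated m (fun y => cabs (fcheck (fun x => f x - g x) y) ^+ 2) c ->
  dominated m (fun y => cabs (fcheck g y) ^+ 2) c.
Proof.
move=> hm cf cg D1 D2.
have c2 h : ccont h -> continuous (fun y => cabs (fcheck h y) ^+ 2).
  by move=> ch; apply: cr_mul; apply: cc_cabs; exact: ccont_fcheck_cont.
have p2 h y : 0 <= cabs (fcheck h y) ^+ 2 by rewrite exprn_ge0 ?cabs_ge0.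
have D := dominated_add hm (c2 _ (ccont_add cf cg)) (c2 _ (ccont_sub cf cg))
  (p2 _) (p2 _) D1 D2.
have {D} := dominated_scale hm (a := 2^-1) _ D; rewrite invr_ge0 ler0n => /(_ isT).
apply: dominated_le; last by lra.
move=> y; have [df dg] := (decaying_ccont cf, decaying_ccont cg).
rewrite (fcheck_add df dg) (fcheck_sub df dg).
set u := fcheck f y; set v := fcheck g y.
have : 2 * cabs v <= cabs (u + v) + cabs (u - v).
  have -> : 2 * cabs v = cabs ((u + v) - (u - v)).
    rewrite (_ : u + v - (u - v) = (2 : R)%:C * v).
      by rewrite cabsM cabs_rr ger0_norm.
    by rewrite rmorphD rmorph1; ring.
  exact: cabsB.
have := cabs_ge0 v; move: (cabs v) (cabs (u + v)) (cabs (u - v)) => a b c'.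
by move=> a0 ab; have := sqr_ge0 (b - c'); nra.
Qed.

(** If no constant works, then for each [n] the functions whose constants all
    exceed [n] contain a dense open set. Density: near any [s], the
    parallelogram law makes one of [s + e h] and [s - e h] large. Openness: a
    large value at [s] is witnessed by a compactly supported minorant, which
    survives a small uniform change of [s]. Baire then yields a function
    without any constant. *)
Lemma fcheck_sq_uniform (r : R) m : is_measure m ->
  (forall f, ccont f -> exists c, dominated m (fun y => cabs (fcheck f y) ^+ 2) c) ->
  exists c, forall h, carried r h -> (forall x, cabs (h x) <= 1) ->
    dominated m (fun y => cabs (fcheck h y) ^+ 2) c.
Proof.
move=> hm Hf; apply: contrapT => /forallNP nH.
pose U (n : nat) g := forall c, dominated m (fun y => cabs (fcheck g y) ^+ 2) c -> n%:R <= c.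
have [|g [cg gr] gU] := @baire_carried r U; last first.
  have [c Hc] := Hf g cg; have := gU (Num.truncn c).+1 c Hc.
  by rewrite leNgt truncnS_gt.
move=> n s e cs e0.
have /existsNP[h /not_implyP[ch /not_implyP[h1 nh]]] := nH ((2 * n%:R + 1) / e ^+ 2).
have ce : ccont (fun x => e%:C * h x) := ccont_scale _ ch.1.
have [s' [cs' ss' ns']] : exists s', [/\ carried r s', forall x, cabs (s' x - s x) <= e &
    ~ dominated m (fun y => cabs (fcheck s' y) ^+ 2) (2 * n%:R + 1)].
  have sgn (a : C) : cabs a = 1 -> carried r (fun x => (a * e%:C) * h x + s x) /\
      forall x, cabs ((a * e%:C) * h x + s x - s x) <= e.
    move=> a1; split; first exact: carried_lin.
    move=> x; rewrite addrK !cabsM a1 mul1r cabs_rr ger0_norm ?(ltW e0)//.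
    by rewrite ler_piMr ?(ltW e0).
  have N1 : cabs (-1 : C) = 1 by rewrite cabsN cabs1.
  have [h1a h1b] := sgn 1 (@cabs1 R); have [h2a h2b] := sgn (-1) N1.
  have [D1|D1] := pselect (dominated m (fun y => cabs (fcheck (fun x => (1 * e%:C) * h x + s x) y) ^+ 2) (2 * n%:R + 1)); last first.
    by exists (fun x => (1 * e%:C) * h x + s x).
  exists (fun x => (-1 * e%:C) * h x + s x); split; [exact: h2a|exact: h2b|].
  move=> D2; apply: nh.
  have D : dominated m (fun y => cabs (fcheck (fun x => e%:C * h x) y) ^+ 2) (2 * n%:R + 1).
    apply: (dominated_parallelogram hm cs.1 ce).
      rewrite (_ : (fun x => s x + _) = fun x => (1 * e%:C) * h x + s x); first exact: D1.
      by apply/funext => x; rewrite mul1r addrC.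
    rewrite (_ : (fun x => s x - _) = fun x => (-1 * e%:C) * h x + s x); first exact: D2.
    by apply/funext => x; rewrite mulN1r mulNr addrC.
  have e20 : 0 < e ^+ 2 by rewrite exprn_gt0.
  have := @dominated_scale _ _ _ hm _ _ (e ^+ 2)^-1 _ D; rewrite invr_ge0 (ltW e20) => /(_ isT).
  apply: dominated_le; last by rewrite mulrC.
  move=> y; rewrite (fcheck_scale _ (decaying_ccont ch.1)) cabsM cabs_rr.
  by rewrite ger0_norm ?(ltW e0)// exprMn mulKf ?gt_eqF.
have /existsNP[phi /not_implyP[cphi /not_implyP[phis /negP]]] := ns'.
rewrite -ltNge => phin.
have /ccontE[_ [rho Hrho]] := cphi.
have [K K0 HK] := dominated_ball hm rho.
pose B := (1 + r ^+ 2) ^+ d * W.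
have B0 : 0 <= B.
  by rewrite mulr_ge0 ?rintegral_weight_ge0// exprn_ge0// ltW//; exact: oneDsq_gt0.
have K1 : 0 < 2 * K + 1 by rewrite ltr_wpDl// mulr_ge0// ltW.
have B1 : 0 < B + 1 by rewrite ltr_wpDl.
pose e' := ((2 * K + 1) * (B + 1))^-1.
have e'0 : 0 < e' by rewrite invr_gt0 mulr_gt0.
have e'B : e' * B <= (2 * K + 1)^-1.
  by rewrite /e' invfM -mulrA ler_piMr ?invr_ge0 ?(ltW K1)// ler_pdivrMl// mulr1 lerDl.
have e'B0 : 0 <= e' * B by rewrite mulr_ge0// ltW.
have KeB : K * (2 * (e' * B) ^+ 2) <= 1.
  have q1 : (2 * K + 1) * (e' * B) <= 1 by rewrite -ler_pdivlMl// mulr1.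
  have q2 : e' * B <= 1.
    by apply: le_trans e'B _; rewrite invf_le1//; have := K0; lra.
  move: (e' * B) q1 q2 e'B0 => b q1 q2 b0; have := K0; nra.
exists s', e'; split => // g cg gs c Dg.
have csg : carried r (fun x => s' x - g x).
  rewrite (_ : (fun _ => _) = fun x => -1 * g x + s' x); first exact: carried_lin.
  by apply/funext => x; rewrite mulN1r addrC.
have sgb y : cabs (fcheck (fun x => s' x - g x) y) <= e' * B.
  by apply: carried_fcheck_bound csg _ => x; rewrite cabs_distC.
have c2 h' : ccont h' -> continuous (fun y => cabs (fcheck h' y) ^+ 2).
  by move=> ch'; apply: cr_mul; apply: cc_cabs; exact: ccont_fcheck_cont.
(* The minimum keeps the support of [phi], where [m] is bounded, and it is
   uniformly small. *)
pose k y := Num.min (2 * cabs (fcheck (fun x => s' x - g x) y) ^+ 2) (cabs (phi y)).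
have ck : continuous k.
  apply: cr_min; last exact: cc_cabs (ccont_cont cphi).
  by apply: cr_mul; [exact: cr_cst|exact: c2 csg.1].
have k0 y : 0 <= k y by rewrite le_min cabs_ge0 mulr_ge0 ?exprn_ge0 ?cabs_ge0.
have Dk : dominated m k 1.
  apply: (dominated_le (fun y => lexx (k y)) KeB); apply: HK => [y /Hrho yr|y].
    by apply/eqP; rewrite eq_le k0 andbT /k yr cabs0 ge_min lexx orbT.
  rewrite ge_min ler_wpM2l ?lerXn2r ?nnegrE ?cabs_ge0//.
have Dg2 := @dominated_scale _ _ _ hm _ _ 2 (ler0n R 2) Dg.
have cg2 : continuous (fun y => 2 * cabs (fcheck g y) ^+ 2).
  by apply: cr_mul; [exact: cr_cst|exact: c2 cg.1].
have D := dominated_add hm cg2 ck (fun y => mulr_ge0 (ler0n R 2) (exprn_ge0 2 (cabs_ge0 (fcheck g y)))) k0 Dg2 Dk.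
have : cabs (m phi) <= 2 * c + 1.
  apply: D cphi _ => y; rewrite /k.
  have [_|_] := leP (2 * cabs (fcheck (fun x => s' x - g x) y) ^+ 2); last by rewrite lerDr mulr_ge0 ?exprn_ge0 ?cabs_ge0.
  apply: le_trans (phis y) _.
  have dg := decaying_ccont cg.1; have ds := decaying_ccont cs'.1.
  rewrite (fcheck_sub ds dg); have := cabsD (fcheck g y) (fcheck s' y - fcheck g y).
  rewrite addrC subrK; have := cabs_ge0 (fcheck s' y).
  move: (cabs (fcheck s' y)) (cabs (fcheck g y)) (cabs (fcheck s' y - _)) => a b b' a0 ab.
  by have := sqr_ge0 (b - b'); nra.
by move: phin; lra.
Qed.

(** A narrow mollifier has a transform of modulus at least 1/2 on the support
    of [tent]; modulating it moves the transform to the support of any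
    translate, without changing the support or the bound of the mollifier. *)
Lemma fourier_uniformly_dominated m : is_measure m ->
  (forall f, ccont f -> exists c, dominated m (fun y => cabs (fcheck f y) ^+ 2) c) ->
  exists c, uniformly_dominated m c.
Proof.
move=> hm Hf.
(* Chosen so that the transform of a mollifier of radius [r] stays within 1/2
   of 1 on the ball of radius 2. *)
pose a : R := 8 * pi * d%:R; pose r := (2 * (a + 1))^-1.
have a0 : 0 <= a by rewrite !mulr_ge0// pi_ge0.
have r0 : 0 < r by rewrite invr_gt0 mulr_gt0// ltr_wpDl.
have [k mk] := @mollifier_exists R d r r0; have [[sk ck] k0 kr k1] := mk.
pose kc x : C := (k x)%:C.
have [M M0 HM] := ccont_bounded ck.
have [c Hc] := fcheck_sq_uniform r hm Hf.
have kbig y : `|y| <= 2 -> 2^-1 <= cabs (fcheck kc y).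
  move=> y2; have := fcheck_mollifier y r0 mk; rewrite cabs_distC -/kc => h.
  have h2 : 4 * pi * d%:R * r * `|y| <= 2^-1.
    apply: (@le_trans _ _ (a * r)).
      rewrite [leRHS](_ : _ = 4 * pi * d%:R * r * 2); last by rewrite /a; ring.
      by rewrite ler_wpM2l ?mulr_ge0 ?pi_ge0 ?(ltW r0).
    by rewrite /r invfM mulrCA ler_piMr// ler_pdivrMr ?ltr_wpDl// mul1r lerDl.
  have := cabsD (1 - fcheck kc y) (fcheck kc y); rewrite subrK cabs1.
  by move: h h2; lra.
exists (8 * M ^+ 2 * c) => t.
pose h x := (M^-1)%:C * (kc x * wave x (- t)).
have ckw : ccont (fun x => kc x * wave x (- t)) := ccont_mul ck (@wave_cont R d (- t)).
have ch : carried r h.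
  split; first exact: ccont_scale.
  by move=> x xr; rewrite /h /kc kr// mul0r mulr0.
have h1 x : cabs (h x) <= 1.
  rewrite /h !cabsM cabs_wave mulr1 cabs_rr gtr0_norm ?invr_gt0//.
  by rewrite ler_pdivrMl// mulr1; exact: HM.
have MM : 0 <= 8 * M ^+ 2 by rewrite mulr_ge0// exprn_ge0// ltW.
apply: (dominated_le _ (lexx _) (dominated_scale hm MM (Hc h ch h1))) => y.
rewrite /h (fcheck_scale _ (decaying_ccont ckw)) fcheck_modulate cabsM cabs_rr.
rewrite gtr0_norm ?invr_gt0// exprMn -mulrA (mulrA (M ^+ 2)) exprVn mulfV; last first.
  by rewrite expf_neq0// gt_eqF.
rewrite mul1r; have [yt|yt] := leP `|y - t| 2.
  have := kbig _ yt; have := tent_le2 (y - t).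
  move: (cabs (fcheck kc (y - t))) (tent (y - t)) => b b' h2 h3; nra.
by rewrite tent_eq0 ?(ltW yt)// mulr_ge0// exprn_ge0 ?cabs_ge0.
Qed.

End Uniform.

(** * Tempered distributions *)

Section Tempered.
Variables (R : realType) (d : nat).
Local Notation V := 'rV[R]_d.
Local Notation C := R[i].
Implicit Types (f g h F : V -> C) (x y z t : V) (m nu T : (V -> C) -> C).
Local Notation W := (rintegral (@weight R d)).

Lemma schwartz_fcheck_decay p f : schwartz f ->
  exists a : R, forall y, cabs (fcheck f y) <= a * weight y ^+ p.
Proof.
move=> sf; have [r Hr] := schwartz_bound (maxn d.*2 (p * d).*2) sf.
exists (2 ^+ (p * d) * (2 ^+ d * r * W)) => y; apply: (fcheck_decay _ sf) => a b ha hb.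
by apply: Hr; [exact: leq_trans ha (leq_maxl _ _)|exact: leq_trans hb (leq_maxr _ _)].
Qed.

Lemma tempered_continuous T f (e : R) : tempered_distribution T -> schwartz f -> 0 < e ->
  exists N, exists2 r : R, 0 < r & forall g, schwartz g ->
    (forall a b, (size a <= N)%N -> (size b <= N)%N ->
       forall x, `|monom a x| * cabs (pderivs b (fun x => g x - f x) x) <= r) ->
    cabs (T g - T f) < e.
Proof.
move=> [_ H] sf e0; have [N [r r0 Hr]] := H f sf e e0.
exists N; exists (r / 2); first by rewrite divr_gt0.
move=> g sg Hg; apply: Hr sg _ => a b aN bN.
apply: (@le_lt_trans _ _ (r / 2)%:E); first by apply/schwartz_seminorm_le; exact: Hg.
by rewrite lte_fin ltr_pdivrMr// mulr2n mulrDr mulr1 ltrDl.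
Qed.

(** By linearity it is enough to bound the functional by finitely many
    seminorms. *)
Lemma tempered_bounded T (N : nat) (K : R) :
  (forall (a : C) f g, schwartz f -> schwartz g ->
     T (fun x => a * f x + g x) = a * T f + T g) ->
  (forall h r, schwartz h -> (forall a b, (size a <= N)%N -> (size b <= N)%N ->
     forall x, `|monom a x| * cabs (pderivs b h x) <= r) -> cabs (T h) <= K * r) ->
  tempered_distribution T.
Proof.
move=> linT HT; split; first exact: linT.
move=> f sf e e0; have K1 : 0 < `|K| + 1 by rewrite ltr_wpDl.
exists N; exists (e / (`|K| + 1)); first by rewrite divr_gt0.
move=> g sg Hg; have sgf := schwartz_sub sg sf.
have -> : T g - T f = T (fun x => g x - f x).
  rewrite addrC -mulN1r -linT//; congr T; apply/funext => x.
  by rewrite mulN1r addrC.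
have r0 : 0 < e / (`|K| + 1) by rewrite divr_gt0.
apply: (@le_lt_trans _ _ (K * (e / (`|K| + 1)))).
  apply: HT sgf _ => a b aN bN; apply/schwartz_seminorm_le.
  exact/ltW/Hg.
apply: (@lt_le_trans _ _ ((`|K| + 1) * (e / (`|K| + 1)))).
  by rewrite ltr_pM2r// (le_lt_trans (ler_norm K))// ltrDl.
by rewrite mulrCA divff ?mulr1// gt_eqF.
Qed.

(** ** Translation bounded measures as distributions *)

Section Dominated.
Variables (m : (V -> C) -> C) (c : R).
Hypotheses (hm : is_measure m) (hc : uniformly_dominated m c).

Lemma pairing_decay F (a : R) : continuous (F : V -> (C : numFieldType)) ->
  (forall x, cabs (F x) <= a * weight x ^+ 2) -> extension_value m F (pairing m F).
Proof.
by move=> cF Fa; apply: extension_value_pairing => //; exact: extension_value_decay Fa.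
Qed.

Lemma pairing_decay_bound F (a b : R) : continuous (F : V -> (C : numFieldType)) ->
  (forall x, cabs (F x) <= a * weight x ^+ 2) -> (forall x, cabs (F x) <= b * weight x) ->
  cabs (pairing m F) <= b * (c * 24 ^+ d).
Proof.
move=> cF Fa Fb; apply: (extension_value_bound hm cF _ (pairing_decay cF Fa)).
apply: (dominated_decay hm hc Fb).
by apply: (@decay_coef_ge0 R d _ _ 1 (0 : V) (cabs_ge0 (F 0))); rewrite expr1.
Qed.

Lemma pairing_lin F G (a b : R) (z : C) :
  continuous (F : V -> (C : numFieldType)) -> continuous (G : V -> (C : numFieldType)) ->
  (forall x, cabs (F x) <= a * weight x ^+ 2) ->
  (forall x, cabs (G x) <= b * weight x ^+ 2) ->
  pairing m (fun x => z * F x + G x) = z * pairing m F + pairing m G.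
Proof.
move=> cF cG Fa Gb; apply: (pairingE hm (cc_add (cc_mul (@cc_cst _ _ z) cF) cG)).
exact (extension_value_lin hm z cF cG (pairing_decay cF Fa) (pairing_decay cG Gb)).
Qed.

Lemma pairing_tempered : tempered_distribution (pairing m).
Proof.
have c0 := uniformly_dominated_ge0 hm hc.
apply: (@tempered_bounded _ (1 * d).*2 (2 ^+ (1 * d) * (c * 24 ^+ d))).
  move=> z f g sf sg; have [a Ha] := schwartz_decay 2 sf; have [b Hb] := schwartz_decay 2 sg.
  exact (pairing_lin z (smooth_cont (schwartz_smooth sf)) (smooth_cont (schwartz_smooth sg)) Ha Hb).
move=> h r sh Hr; have [a Ha] := schwartz_decay 2 sh.
rewrite (_ : _ * r = 2 ^+ (1 * d) * r * (c * 24 ^+ d)); last by ring.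
apply: (pairing_decay_bound (smooth_cont (schwartz_smooth sh)) Ha) => x.
rewrite -[X in _ * X]expr1.
by apply: decay_of_monomials => s hs; exact: (Hr s [::]).
Qed.

Lemma pairing_fcheck_tempered : tempered_distribution (fun g => pairing m (fcheck g)).
Proof.
have c0 := uniformly_dominated_ge0 hm hc.
pose K := 2 ^+ (1 * d) * (2 ^+ d * W) * (c * 24 ^+ d).
apply: (@tempered_bounded _ (maxn d.*2 (1 * d).*2) K).
  move=> z f g sf sg; have [a Ha] := schwartz_fcheck_decay 2 sf.
  have [b Hb] := schwartz_fcheck_decay 2 sg.
  rewrite (fcheck_lin _ (schwartz_decaying sf) (schwartz_decaying sg)).
  exact (pairing_lin z (schwartz_fcheck_cont sf) (schwartz_fcheck_cont sg) Ha Hb).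
move=> h r sh Hr; have [a Ha] := schwartz_fcheck_decay 2 sh.
rewrite (_ : K * r = 2 ^+ (1 * d) * (2 ^+ d * r * W) * (c * 24 ^+ d)); last by rewrite /K; ring.
apply: (pairing_decay_bound (schwartz_fcheck_cont sh) Ha) => x.
rewrite -[X in _ * X]expr1; apply: (fcheck_decay _ sh) => s t hs ht.
by apply: Hr; [exact: leq_trans hs (leq_maxl _ _)|exact: leq_trans ht (leq_maxr _ _)].
Qed.

(** A distribution that agrees with [m] on the test functions is the extension
    of [m], since the test functions are dense for both topologies. *)
Lemma extension_value_schwartz nu h : tempered_distribution nu -> extends nu m ->
  schwartz h -> extension_value m h (nu h).
Proof.
move=> tnu enu sh e e0; have [N [r r0 Hr]] := tempered_continuous tnu sh e0.
have c0 := uniformly_dominated_ge0 hm hc.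
pose K : R := 2 ^+ (1 * d) * (c * 24 ^+ d) + 1.
have K0 : 0 < K by rewrite ltr_wpDl// !mulr_ge0// exprn_ge0.
pose r' := Num.min r (e / K).
have r'0 : 0 < r' by rewrite lt_min r0 divr_gt0.
have [g sg Hg] := ccsmooth_dense (maxn N (1 * d).*2) sh r'0.
have D : forall x, cabs (h x - g x) <= 2 ^+ (1 * d) * r' * weight x.
  move=> x; rewrite -[X in _ * X]expr1.
  apply: (decay_of_monomials (f := fun x => h x - g x)) => a ha.
  by apply: (Hg a [::]); [exact: leq_trans ha (leq_maxr _ _)|].
exists g; split; first exact: sg.2.
  apply: (dominated_le (fun x => lexx _) _ (dominated_decay hm hc D _)); last first.
    by rewrite mulr_ge0 ?exprn_ge0// ltW.
  apply: (@le_trans _ _ (r' * K)).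
    rewrite /K mulrDr mulr1 [leLHS](_ : _ = r' * (2 ^+ (1 * d) * (c * 24 ^+ d))); last by ring.
    by rewrite lerDl ltW.
  by rewrite -ler_pdivlMr// ge_min lexx orbT.
rewrite -(enu g sg); apply: ltW; apply: Hr; first exact: ccsmooth_schwartz.
move=> a b aN bN x.
have := Hg a b (leq_trans aN (leq_maxl _ _)) (leq_trans bN (leq_maxl _ _)) x.
have smh := schwartz_smooth sh.
rewrite (pderivs_sub b smh sg.1) (pderivs_sub b sg.1 smh) cabs_distC => /le_trans; apply.
by rewrite ge_min lexx.
Qed.

End Dominated.

End Tempered.

(** * Fourier transforms of measures *)

Section Transform.
Variables (R : realType) (d : nat).
Local Notation V := 'rV[R]_d.
Local Notation C := R[i].
Implicit Types (f g h F : V -> C) (x y z t : V) (m nu T mu om : (V -> C) -> C).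
Local Notation W := (rintegral (@weight R d)).

Definition fsq f : V -> C := fun y => (cabs (fcheck f y) ^+ 2)%:C.

Lemma fsqE f : (fun y => `|fcheck f y| ^+ 2) = fsq f.
Proof. by apply/funext => y; rewrite /fsq -(rmorphXn (real_complex R) 2). Qed.

Lemma fsq_cont f : ccont f -> continuous (fsq f : V -> (C : numFieldType)).
Proof.
move=> cf; have cF := ccont_fcheck_cont cf; apply: cc_real.
exact: cr_mul (cc_cabs cF) (cc_cabs cF).
Qed.

Lemma transform_extension_value mu om : is_fourier_transform mu om ->
  forall f, ccont f -> extension_value om (fsq f) (mu (convolution f (tilde f))).
Proof.
move=> [hom H] f cf; have [HL ->] := H f cf; rewrite fsqE in HL *.
by apply: extension_value_pairing (fsq_cont cf) _ => //; exact: L1_extension_value (fsq_cont cf) HL.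
Qed.

Lemma transform_uniformly_dominated mu om : is_fourier_transform mu om ->
  exists c, uniformly_dominated om c.
Proof.
move=> tr; have hom := tr.1; apply: (fourier_uniformly_dominated hom) => f cf.
have [g [cg Dg _]] := transform_extension_value tr cf ltr01.
have [c Hc] := dominated_ccont hom cg.
have Hc' : dominated om (fun x => cabs (g x - 0)) c.
  by apply: (dominated_le _ (lexx c) Hc) => x; rewrite subr0.
exists (1 + c).
apply: (dominated_le _ (lexx _) (dominated_tri hom (fsq_cont cf) (ccont_cont cg) (@cc_cst _ _ 0) Dg Hc')).
by move=> x; rewrite subr0 /fsq cabs_rr ger0_norm// exprn_ge0 ?cabs_ge0.
Qed.

(** ** Polarization *)

Definition fourth_roots : seq C := [:: 1; -1; 'i%C; - 'i%C].

(** Over the fourth roots of unity [u], both [u] and [u ^ 2] sum to zero. *)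
Lemma polarization (p q p' q' : C) :
  \sum_(u <- fourth_roots) 4^-1 * u * ((u * q + p) * (u * q' + p')^*%C) = p * q'^*%C.
Proof.
have E : \sum_(u <- fourth_roots) u * ((u * q + p) * (u * q' + p')^*%C) = 4%:R * (p * q'^*%C).
  rewrite /fourth_roots !big_cons big_nil mulr_natl.
  case: p q p' q' => p1 p2 [q1 q2] [p3 p4] [q3 q4].
  apply: complex_eq; rewrite ?mulrS mulr0n /=; ring.
rewrite -[RHS](mulKf (x := 4%:R)) ?pnatr_eq0// -E mulr_sumr.
by apply: eq_bigr => u _; rewrite [RHS]mulrA.
Qed.

Lemma extension_value_sum m (I : Type) (s : seq I) (F : I -> V -> C) (a w : I -> C) :
  is_measure m -> (forall k, continuous (F k : V -> (C : numFieldType))) ->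
  (forall k, extension_value m (F k) (w k)) ->
  extension_value m (fun x => \sum_(k <- s) a k * F k x) (\sum_(k <- s) a k * w k).
Proof.
move=> hm cF H.
suff [_ //] : continuous ((fun x => \sum_(k <- s) a k * F k x) : V -> (C : numFieldType)) /\
  extension_value m (fun x => \sum_(k <- s) a k * F k x) (\sum_(k <- s) a k * w k).
elim: s => [|k s [ihc ih]].
  rewrite big_nil (_ : (fun _ => _) = fun=> 0).
    split; first exact: cc_cst.
    by have := extension_value_ccont hm (@ccont_zero R d); rewrite (measure_zero hm).
  by apply/funext => x; rewrite big_nil.
rewrite big_cons (_ : (fun _ => _) = fun x => a k * F k x + \sum_(j <- s) a j * F j x).
  split; first exact: (cc_add (cc_mul (@cc_cst _ _ (a k)) (cF k)) ihc).
  exact (extension_value_lin hm (a k) (cF k) ihc (H k) ih).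
by apply/funext => x; rewrite big_cons.
Qed.

Lemma measure_sum m (I : Type) (s : seq I) (F : I -> V -> C) (a : I -> C) :
  is_measure m -> (forall k, ccont (F k)) ->
  m (fun x => \sum_(k <- s) a k * F k x) = \sum_(k <- s) a k * m (F k).
Proof.
move=> hm cF.
suff [_ //] : ccont (fun x => \sum_(k <- s) a k * F k x) /\
  m (fun x => \sum_(k <- s) a k * F k x) = \sum_(k <- s) a k * m (F k).
elim: s => [|k s [ihc ih]].
  rewrite big_nil (_ : (fun _ => _) = fun=> 0).
    by split; [exact: ccont_zero|exact: measure_zero].
  by apply/funext => x; rewrite big_nil.
rewrite big_cons -ih (_ : (fun _ => _) = fun x => a k * F k x + \sum_(j <- s) a j * F j x).
  split; first exact: (ccont_lin (a k) (cF k) ihc).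
  exact: (hm.1 (a k) _ _ (cF k) ihc).
by apply/funext => x; rewrite big_cons.
Qed.

(** The defining identity of the transform is quadratic in [f]; polarize both
    sides. *)
Lemma transform_polarized mu om : is_measure mu -> is_fourier_transform mu om ->
  forall f h, ccont f -> ccont h ->
    extension_value om (fun y => fcheck f y * (fcheck h y)^*%C) (mu (convolution f (tilde h))).
Proof.
move=> hmu tr f h cf ch; pose g (u : C) x := u * h x + f x.
have cg u : ccont (g u) := ccont_lin u ch cf.
have cgt u : ccont (tilde (g u)) := ccont_tilde (cg u).
have -> : (fun y => fcheck f y * (fcheck h y)^*%C) =
    fun y => \sum_(u <- fourth_roots) 4^-1 * u * fsq (g u) y.
  apply/funext => y; rewrite -(polarization _ (fcheck h y) (fcheck f y)); apply: eq_bigr => u _; congr (_ * _).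
  by rewrite /fsq (fcheck_lin u (decaying_ccont ch) (decaying_ccont cf)) -cabs_sqr.
have -> : convolution f (tilde h) =
    fun x => \sum_(u <- fourth_roots) 4^-1 * u * convolution (g u) (tilde (g u)) x.
  apply/funext => x; rewrite /convolution.
  have dg u : decaying (fun y => 4^-1 * u * (g u y * tilde (g u) (x - y))).
    by apply: decaying_scale; exact: decaying_conv (decaying_ccont (cg u)) (cgt u).
  rewrite -[RHS](_ : cintegral (fun y => \sum_(u <- fourth_roots) 4^-1 * u * (g u y * tilde (g u) (x - y))) = _).
    congr cintegral; apply/funext => y; rewrite /tilde.
    by rewrite -(polarization _ (h y) (f (- (x - y)))).
  rewrite (cintegral_sum _ dg); apply: eq_bigr => u _; apply: cintegral_scale.
  exact: decaying_conv (decaying_ccont (cg u)) (cgt u).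
rewrite (measure_sum _ _ hmu (fun u => ccont_convolution (cg u) (cgt u))).
apply: (extension_value_sum _ _ tr.1 (fun u => fsq_cont (cg u))) => u.
exact: transform_extension_value tr _ (cg u).
Qed.

End Transform.

(** * Comparison of the two transforms *)

Section Main.
Variables (R : realType) (d : nat).
Local Notation V := 'rV[R]_d.
Local Notation C := R[i].
Implicit Types (f g h F : V -> C) (x y z t : V) (m nu T mu om : (V -> C) -> C).
Local Notation W := (rintegral (@weight R d)).

Lemma measure_mollify m f (e : R) : is_measure m -> ccont f -> 0 < e ->
  exists2 r : R, 0 < r & forall k, mollifier r k ->
    cabs (m (convolution f (fun x => (k x)%:C)) - m f) <= e.
Proof.
move=> hm cf e0; have /ccontE[_ [rf Hrf]] := cf.
have [K K0 HK] := measure_bound hm (rf + 1).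
have [r r0 Hr] := mollify cf (divr_gt0 e0 K0).
exists (Num.min r 1); first by rewrite lt_min r0 ltr01.
move=> k mk.
have mr : mollifier r k by apply: mollifier_le mk; rewrite ge_min lexx.
have [[_ ck] _ k1 _] : mollifier 1 k by apply: mollifier_le mk; rewrite ge_min lexx orbT.
have cfk := ccont_convolution cf ck.
rewrite -(measure_sub hm cfk cf) (_ : e = K * (e / K)); last by rewrite mulrCA divff ?mulr1// gt_eqF.
apply: HK; [exact: ccont_sub cfk cf| |exact: Hr].
move=> x xr; rewrite (convolution_eq0 Hrf _ xr); last by move=> y /k1 ->.
by rewrite Hrf ?subrr// (le_lt_trans _ xr)// lerDl.
Qed.

(** Let the second function of the polarized identity run through mollifiers.
    Their transforms tend to 1 with an error growing linearly in [y], which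
    the decay of [fcheck g] absorbs. *)
Lemma transform_ccsmooth mu om g : is_measure mu -> is_fourier_transform mu om ->
  ccsmooth g -> extension_value om (fcheck g) (mu g).
Proof.
move=> hmu tr sg; have hom := tr.1.
have [c hc] := transform_uniformly_dominated tr.
have c0 := uniformly_dominated_ge0 hom hc.
have scg := ccsmooth_schwartz sg.
have [a Ha] := schwartz_fcheck_decay 2 scg.
have a0 : 0 <= a := decay_coef_ge0 (cabs_ge0 _) (Ha 0).
have cg := schwartz_fcheck_cont scg.
apply: (extension_value_lim hom cg) => e e0.
have [r1 r10 Hr1] := measure_mollify hmu sg.2 e0.
pose A : R := a * (4 * pi * d%:R) * (c * 24 ^+ d).
have A0 : 0 <= A by rewrite !mulr_ge0 ?pi_ge0// exprn_ge0.
have A1 : 0 < A + 1 by rewrite ltr_wpDl.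
pose r := Num.min r1 (e / (A + 1)).
have r0 : 0 < r by rewrite lt_min r10 divr_gt0.
have [k mk] := @mollifier_exists R d r r0; have [[_ ck] _ _ _] := mk.
pose kc x : C := (k x)%:C.
have Gext := transform_polarized hmu tr sg.2 (ccont_tilde ck).
rewrite tildeK in Gext.
pose G y := fcheck g y * fcheck kc y.
have GE : (fun y => fcheck g y * (fcheck (tilde kc) y)^*%C) = G.
  by apply/funext => y; rewrite (fcheck_tilde y (decaying_ccont ck)) conjcK.
exists G, (mu (convolution g kc)); split.
- exact: cc_mul cg (ccont_fcheck_cont ck).
- by rewrite -GE; exact: Gext.
- have D y : cabs (fcheck g y - G y) <= a * (4 * pi * d%:R * r) * weight y.
    have -> : fcheck g y - G y = - (fcheck g y * (fcheck kc y - 1)) by rewrite /G; ring.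
    rewrite cabsN cabsM.
    apply: (@le_trans _ _ (a * weight y ^+ 2 * (4 * pi * d%:R * r * `|y|))).
      by rewrite ler_pM ?cabs_ge0//; exact: fcheck_mollifier.
    rewrite [leLHS](_ : _ = a * (4 * pi * d%:R * r) * weight y * (weight y * `|y|)); last by ring.
    rewrite ler_piMr ?weight_norm// !mulr_ge0 ?weight_ge0 ?pi_ge0// ltW//.
  apply: (dominated_le (fun y => lexx _) _ (dominated_decay hom hc D _)); last first.
    by rewrite !mulr_ge0 ?pi_ge0// ltW.
  rewrite [leLHS](_ : _ = A * r); last by rewrite /A; ring.
  apply: (@le_trans _ _ ((A + 1) * r)); first by rewrite ler_wpM2r ?(ltW r0)// lerDl.
  by rewrite mulrC -ler_pdivlMr// ge_min lexx orbT.
- by apply: Hr1; apply: mollifier_le mk; rewrite ge_min lexx.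
Qed.

(** ** A transformable measure is tempered *)

(** The transform is translation bounded, so both it and its composition with
    [fcheck] extend to Schwartz functions. *)
Lemma transformable_tempered mu om : is_measure mu -> is_fourier_transform mu om ->
  exists nu, is_tempered_fourier_transform mu nu /\
    exists m, is_distribution_of nu m /\ translation_bounded m.
Proof.
move=> hmu tr; have hom := tr.1.
have [c hc] := transform_uniformly_dominated tr.
exists (pairing om); split.
  split; first exact: pairing_tempered hom hc.
  exists (fun g => pairing om (fcheck g)); split => //.
    exact: pairing_fcheck_tempered hom hc.
  move=> g sg; apply: (pairingE hom (schwartz_fcheck_cont (ccsmooth_schwartz sg))).
  exact: transform_ccsmooth.
exists om; split; last exact: (uniformly_translation_bounded hom hc).
split; first exact: hom.
by move=> g sg; apply: (pairingE hom (ccont_cont sg.2) (extension_value_ccont hom sg.2)).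
Qed.

(** ** A tempered measure with translation bounded transform *)

Lemma convolution_bound f h (r a b : R) : carried r f -> ccont h ->
  (forall x, cabs (f x) <= a) -> (forall x, cabs (h x) <= b) ->
  forall x, cabs (convolution f h x) <= a * b * ((1 + r ^+ 2) ^+ d * W).
Proof.
move=> [cf fr] ch fa hb x.
have a0 : 0 <= a := le_trans (cabs_ge0 _) (fa 0).
have b0 : 0 <= b := le_trans (cabs_ge0 _) (hb 0).
rewrite mulrA; apply: cintegral_bound; first exact: decaying_cont (decaying_conv x (decaying_ccont cf) ch).
move=> y; rewrite cabsM; have [yr|yr] := leP `|y| r.
  rewrite -[X in _ <= X]mulrA -[leLHS]mulr1.
  by rewrite ler_pM ?mulr_ge0 ?cabs_ge0 ?weight_ball// ler_pM ?cabs_ge0.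
rewrite fr// cabs0 mul0r !mulr_ge0 ?weight_ge0// exprn_ge0// ltW//; exact: oneDsq_gt0.
Qed.

Lemma carried_tilde (r : R) f : carried r f -> carried r (tilde f).
Proof.
move=> [cf fr]; split; first exact: ccont_tilde.
by move=> x xr; rewrite /tilde fr ?normrN// conjc0.
Qed.

Lemma carried_sub (r : R) f g : carried r f -> carried r g -> carried r (fun x => f x - g x).
Proof.
move=> cf cg; rewrite (_ : (fun _ => _) = fun x => -1 * g x + f x).
  exact: carried_lin cg cf.
by apply/funext => x; rewrite mulN1r addrC.
Qed.

(** The difference of the two squares is the sum of two convolutions with a
    factor [g - f], and everything is carried by one ball. *)
Lemma measure_square_close mu f (r M : R) (e : R) : is_measure mu -> carried r f ->
  (forall x, cabs (f x) <= M) -> 0 < e ->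
  exists2 de : R, 0 < de & forall g, carried r g -> (forall x, cabs (g x - f x) <= de) ->
    cabs (mu (convolution g (tilde g)) - mu (convolution f (tilde f))) <= e.
Proof.
move=> hmu cf fM e0; pose B := (1 + r ^+ 2) ^+ d * W.
have B0 : 0 <= B.
  by rewrite mulr_ge0 ?rintegral_weight_ge0// exprn_ge0// ltW//; exact: oneDsq_gt0.
have M0 : 0 <= M := le_trans (cabs_ge0 _) (fM 0).
have [K K0 HK] := measure_bound hmu (r + r).
pose D := K * ((2 * M + 1) * B) + 1.
have D0 : 0 < D.
  by rewrite ltr_wpDl// mulr_ge0 ?(ltW K0)// mulr_ge0// addr_ge0// mulr_ge0.
exists (Num.min 1 (e / D)); first by rewrite lt_min ltr01 divr_gt0.
move=> g cg gf; set de := Num.min _ _ in gf.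
have de0 : 0 <= de := le_trans (cabs_ge0 _) (gf 0).
have de1 : de <= 1 by rewrite ge_min lexx.
have gM x : cabs (g x) <= M + 1.
  rewrite -(subrK (f x) (g x)) addrC; apply: (le_trans (cabsD _ _)).
  by rewrite lerD// (le_trans (gf x)).
have csg := carried_sub cg cf.
have cgt := carried_tilde cg; have cft := carried_tilde cf.
have cst := carried_tilde csg.
have c1 := ccont_convolution cg.1 cgt.1; have c2 := ccont_convolution cf.1 cft.1.
rewrite -(measure_sub hmu c1 c2).
have E x : convolution g (tilde g) x - convolution f (tilde f) x =
    convolution (fun x => g x - f x) (tilde g) x + convolution f (tilde (fun x => g x - f x)) x.
  rewrite /convolution -cintegral_sub; last 2 first.
  - exact: decaying_conv (decaying_ccont cg.1) cgt.1.
  - exact: decaying_conv (decaying_ccont cf.1) cft.1.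
  rewrite -cintegral_add; last 2 first.
  - exact: decaying_conv (decaying_ccont csg.1) cgt.1.
  - exact: decaying_conv (decaying_ccont cf.1) cst.1.
  congr cintegral; apply/funext => y; rewrite /tilde.
  have cB (u v : C) : (u - v)^*%C = u^*%C - v^*%C := rmorphB (@conjc R) u v.
  by rewrite cB; ring.
have b1 x : cabs (convolution (fun x => g x - f x) (tilde g) x) <= de * (M + 1) * B.
  by apply: (convolution_bound csg cgt.1 gf) => y; rewrite /tilde cabs_conj; exact: gM.
have b2 x : cabs (convolution f (tilde (fun x => g x - f x)) x) <= M * de * B.
  by apply: (convolution_bound cf cst.1 fM) => y; rewrite /tilde cabs_conj; exact: gf.
apply: (@le_trans _ _ (K * (de * (2 * M + 1) * B))).
  apply: HK; first exact: ccont_sub c1 c2.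
    move=> x xr; rewrite (convolution_eq0 cg.2 cgt.2 xr) (convolution_eq0 cf.2 cft.2 xr).
    by rewrite subrr.
  move=> x; rewrite E; apply: (le_trans (cabsD _ _)).
  apply: (le_trans (lerD (b1 x) (b2 x))).
  by rewrite [leLHS](_ : _ = de * (2 * M + 1) * B)//; ring.
rewrite [leLHS](_ : _ = de * (K * ((2 * M + 1) * B))); last by ring.
apply: (@le_trans _ _ (de * D)); first by rewrite ler_wpM2l// lerDl.
by rewrite -ler_pdivlMr// ge_min lexx orbT.
Qed.

(** From [||a|^2 - |b|^2| <= (1 + 1/q) |b - a|^2 + q |a|^2]: a small [q]
    settles the second term, and then a small distance settles the first. *)
Lemma fsq_close m (c r M e : R) f : is_measure m -> uniformly_dominated m c ->
  carried r f -> (forall x, cabs (f x) <= M) -> 0 < e ->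
  exists2 de : R, 0 < de & forall g, carried r g -> (forall x, cabs (g x - f x) <= de) ->
    dominated m (fun y => cabs (fsq f y - fsq g y)) e.
Proof.
move=> hm hc cf fM e0; have [K K0 HK] := fcheck_sq_dominated r hm hc.
have M0 : 0 <= M := le_trans (cabs_ge0 _) (fM 0).
have A0 : 0 < 2 * (K * M ^+ 2 + 1) by rewrite mulr_gt0// ltr_wpDl// mulr_ge0// exprn_ge0.
pose q := e / (2 * (K * M ^+ 2 + 1)); have q0 : 0 < q by rewrite divr_gt0.
have qi0 : 0 < 1 + q^-1 by rewrite addr_gt0// invr_gt0.
have B0 : 0 < 2 * ((1 + q^-1) * K + 1) by rewrite mulr_gt0// ltr_wpDl// mulr_ge0// ltW.
exists (Num.min 1 (e / (2 * ((1 + q^-1) * K + 1)))).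
  by rewrite lt_min ltr01 divr_gt0.
move=> g cg gf; set de := Num.min _ _ in gf.
have de0 : 0 <= de := le_trans (cabs_ge0 _) (gf 0).
have de1 : de <= 1 by rewrite ge_min lexx.
have csg := carried_sub cg cf.
have D1 := dominated_scale hm (ltW qi0) (HK _ _ csg.1 csg.2 gf).
have D2 := dominated_scale hm (ltW q0) (HK _ _ cf.1 cf.2 fM).
have c2 (a : R) h : ccont h -> continuous (fun y => a * cabs (fcheck h y) ^+ 2).
  move=> ch; apply: cr_mul; first exact: cr_cst.
  by apply: cr_mul; apply: cc_cabs; exact: ccont_fcheck_cont.
have p2 (a : R) h y : 0 < a -> 0 <= a * cabs (fcheck h y) ^+ 2.
  by move=> a0; rewrite mulr_ge0 ?(ltW a0) ?exprn_ge0 ?cabs_ge0.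
apply: dominated_le (dominated_add hm (c2 _ _ csg.1) (c2 _ _ cf.1)
  (fun y => p2 _ _ y qi0) (fun y => p2 _ _ y q0) D1 D2).
  move=> y; rewrite /fsq -(rmorphB (real_complex R)) cabs_rr.
  rewrite (fcheck_sub (decaying_ccont cg.1) (decaying_ccont cf.1)).
  set u := fcheck f y; set v := fcheck g y.
  have h1 := cabsD (v - u) u; rewrite subrK in h1.
  have h2 := cabsD (u - v) v; rewrite subrK in h2.
  rewrite cabs_distC in h2.
  have s0 := cabs_ge0 (v - u); have u0 := cabs_ge0 u; have v0 := cabs_ge0 v.
  have amgm : 2 * (cabs (v - u) * cabs u) <= q^-1 * cabs (v - u) ^+ 2 + q * cabs u ^+ 2.
    rewrite -subr_ge0 (_ : _ - _ = q^-1 * (cabs (v - u) - q * cabs u) ^+ 2).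
      by rewrite mulr_ge0 ?sqr_ge0// invr_ge0 ltW.
    by field; rewrite gt_eqF.
  rewrite mulrDl mul1r -addrA.
  apply: le_trans (lerD (lexx _) amgm).
  move: (cabs (v - u)) (cabs u) (cabs v) h1 h2 s0 u0 v0 {amgm} => s a b h1 h2 s0 a0 b0.
  by rewrite ler_norml; apply/andP; split; nra.
rewrite (_ : e = e / 2 + e / 2) ?lerD//; last by rewrite -splitr.
  apply: (@le_trans _ _ (((1 + q^-1) * K + 1) * de)).
    rewrite mulrA; apply: ler_pM; rewrite ?exprn_ge0 ?mulr_ge0 ?(ltW qi0) ?lerDl//.
    by rewrite expr2 ler_piMr.
  have : de <= e / (2 * ((1 + q^-1) * K + 1)) by rewrite ge_min lexx orbT.
  rewrite ler_pdivlMr// => h; rewrite ler_pdivlMr//; apply: le_trans h.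
  by rewrite [leRHS](_ : _ = ((1 + q^-1) * K + 1) * de * 2)//; ring.
have X0 : 0 < K * M ^+ 2 + 1 by rewrite ltr_wpDl// mulr_ge0// exprn_ge0.
rewrite /q [leLHS](_ : _ = e / 2 * (K * M ^+ 2 / (K * M ^+ 2 + 1))); last first.
  by field; rewrite gt_eqF.
rewrite ler_piMr//; first by rewrite divr_ge0// ltW.
by rewrite ler_pdivrMr// mul1r lerDl.
Qed.

Lemma tempered_transform_ccsmooth mu nu m g : is_tempered_fourier_transform mu nu ->
  is_distribution_of nu m -> (exists c, uniformly_dominated m c) -> ccsmooth g ->
  extension_value m (fcheck g) (mu g).
Proof.
move=> [tnu [T [_ TE TF]]] [hm num] [c hc] sg.
rewrite -(TE g sg) (TF g (ccsmooth_schwartz sg)).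
exact (extension_value_schwartz hm hc tnu num (schwartz_fcheck sg)).
Qed.

(** For a mollified [g] the function [g * tilde g] is a test function, on
    which [mu] is the distribution; both sides of the identity are continuous
    as [g] tends to [f]. *)
Lemma tempered_transformable mu nu m : is_measure mu -> is_tempered_fourier_transform mu nu ->
  is_distribution_of nu m -> translation_bounded m -> is_fourier_transform mu m.
Proof.
move=> hmu tr dm tb; have hm := dm.1.
have ud := translation_bounded_uniformly hm tb; have [c hc] := ud.
split; first exact: hm.
move=> f cf; set sq := (fun y => _).
have -> : sq = fsq f := fsqE f.
suff E : extension_value m (fsq f) (mu (convolution f (tilde f))).
  split; first exact: extension_value_L1 (fsq_cont cf) E.
  exact: esym (pairingE hm (fsq_cont cf) E).
have /ccontE[_ [r Hr]] := cf; have [M M0 HM] := ccont_bounded cf.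
have cfr : carried (r + 1) f.
  by split => // x xr; apply: Hr; apply: le_lt_trans xr; rewrite lerDl.
apply: (extension_value_lim hm (fsq_cont cf)) => e e0.
have [d1 d10 H1] := measure_square_close hmu cfr HM e0.
have [d2 d20 H2] := fsq_close hm hc cfr HM e0.
have d0 : 0 < Num.min d1 d2 by rewrite lt_min d10.
have [s s0 Hs] := mollify cf d0.
have s10 : 0 < Num.min s 1 by rewrite lt_min s0 ltr01.
have [k mk] := @mollifier_exists R d _ s10.
have mks : mollifier s k by apply: mollifier_le mk; rewrite ge_min lexx.
have [sk _ k1 _] : mollifier 1 k by apply: mollifier_le mk; rewrite ge_min lexx orbT.
pose g := convolution f (fun x => (k x)%:C).
have sg : ccsmooth g := ccsmooth_convolution cf sk.
have cg : carried (r + 1) g.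
  split; first exact: sg.2.
  by apply: convolution_eq0 => // x /k1 ->.
have gf := Hs k mks; rewrite -/g in gf.
have g1 x : cabs (g x - f x) <= d1 by rewrite (le_trans (gf x))// ge_min lexx.
have g2 x : cabs (g x - f x) <= d2 by rewrite (le_trans (gf x))// ge_min lexx orbT.
exists (fsq g), (mu (convolution g (tilde g))); split.
- exact: fsq_cont sg.2.
- have := tempered_transform_ccsmooth tr dm ud (ccsmooth_convolution sg.2 (ccsmooth_tilde sg)).
  rewrite (_ : fcheck _ = fsq g)//; apply/funext => y.
  rewrite (fcheck_convolution y sg.2 (ccont_tilde sg.2)).
  by rewrite (fcheck_tilde y (decaying_ccont sg.2)) /fsq cabs_sqr.
- exact: H2.
- exact: H1.
Qed.

Lemma same_measure_ccsmooth m om : is_measure m -> is_measure om ->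
  (forall g, ccsmooth g -> m g = om g) -> same_measure m om.
Proof.
move=> hm hom H f cf; apply/eqP; rewrite -subr_eq0; apply/eqP/cabs_eq0/eqP.
rewrite eq_le cabs_ge0 andbT; apply/ler_addgt0Pr => e e0; rewrite add0r.
have e20 : 0 < e / 2 by rewrite divr_gt0.
have [r r0 Hr] := measure_mollify hm cf e20.
have [s s0 Hs] := measure_mollify hom cf e20.
have rs0 : 0 < Num.min r s by rewrite lt_min r0.
have [k mk] := @mollifier_exists R d _ rs0; have [sk _ _ _] := mk.
have h1 := Hr k (mollifier_le _ mk); have h2 := Hs k (mollifier_le _ mk).
rewrite ge_min lexx in h1; rewrite ge_min lexx orbT in h2.
have {}h1 := h1 isT; have {}h2 := h2 isT.
rewrite -(H _ (ccsmooth_convolution cf sk)) in h2; move: h1 h2.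
set v := m (convolution _ _) => h1 h2.
rewrite (_ : m f - om f = (m f - v) + (v - om f)); last by ring.
apply: (le_trans (cabsD _ _)); rewrite cabs_distC.
by rewrite [leRHS]splitr lerD.
Qed.

(** On transforms of test functions [u] both [nu] and [muhat] take the value
    [mu u], and these transforms approximate every test function [h]. *)
Lemma transform_unique mu muhat nu m : is_measure mu -> is_fourier_transform mu muhat ->
  is_tempered_fourier_transform mu nu -> is_distribution_of nu m ->
  same_measure muhat m.
Proof.
move=> hmu tr [tnu [T [_ TE TF]]] [hm num]; have hom := tr.1.
have [c hc] := transform_uniformly_dominated tr.
have c0 := uniformly_dominated_ge0 hom hc.
apply: (same_measure_ccsmooth hom hm) => h sh; rewrite -(num h sh).
apply/eqP; rewrite -subr_eq0; apply/eqP/cabs_eq0/eqP.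
rewrite eq_le cabs_ge0 andbT; apply/ler_addgt0Pr => e e0; rewrite add0r.
have e20 : 0 < e / 2 by rewrite divr_gt0.
have [N [r r0 Hr]] := tempered_continuous tnu (ccsmooth_schwartz sh) e20.
pose K : R := 2 ^+ (1 * d) * (c * 24 ^+ d) + 1.
have K0 : 0 < K by rewrite ltr_wpDl// !mulr_ge0// exprn_ge0.
pose q := Num.min r (e / 2 / K).
have q0 : 0 < q by rewrite lt_min r0 divr_gt0.
have [u su Hu] := fcheck_dense (maxn N (1 * d).*2) sh q0.
have scu := schwartz_fcheck su.
have cu := schwartz_fcheck_cont (ccsmooth_schwartz su).
have h1 : cabs (nu (fcheck u) - nu h) <= e / 2.
  apply/ltW/Hr; first exact: scu.
  move=> a b aN bN x.
  have := Hu a b (leq_trans aN (leq_maxl _ _)) (leq_trans bN (leq_maxl _ _)) x.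
  by move=> /le_trans; apply; rewrite ge_min lexx.
have h2 : cabs (nu (fcheck u) - muhat h) <= e / 2.
  rewrite -(TF u (ccsmooth_schwartz su)) (TE u su).
  have D x : cabs (-1 * h x + fcheck u x) <= 2 ^+ (1 * d) * q * weight x.
    rewrite mulN1r addrC -[X in _ * X]expr1.
    apply: (decay_of_monomials (f := fun x => fcheck u x - h x)) => a ha.
    by apply: (Hu a [::]); [exact: leq_trans ha (leq_maxr _ _)|].
  have E := extension_value_lin hom (-1) (ccont_cont sh.2) cu
    (extension_value_ccont hom sh.2) (transform_ccsmooth hmu tr su).
  have cD : continuous ((fun x => -1 * h x + fcheck u x) : V -> (C : numFieldType)).
    exact: (cc_add (cc_mul (@cc_cst _ _ (-1)) (ccont_cont sh.2)) cu).
  have q0' : 0 <= 2 ^+ (1 * d) * q by rewrite mulr_ge0 ?exprn_ge0// ltW.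
  have := extension_value_bound hom cD (dominated_decay hom hc D q0') E.
  rewrite mulN1r addrC => /le_trans; apply.
  apply: (@le_trans _ _ (q * K)).
    rewrite /K mulrDr mulr1 [leLHS](_ : _ = q * (2 ^+ (1 * d) * (c * 24 ^+ d))); last by ring.
    by rewrite lerDl ltW.
  by rewrite -ler_pdivlMr// ge_min lexx orbT.
rewrite (_ : muhat h - nu h = - (nu (fcheck u) - muhat h) + (nu (fcheck u) - nu h)); last by ring.
apply: (le_trans (cabsD _ _)); rewrite cabsN.
by rewrite [leRHS]splitr lerD.
Qed.

End Main.

Theorem theorem5p2 (R : realType) (d : nat)
    (mu : ('rV[R]_d -> complex R) -> complex R) (hmu : is_measure mu) :
  (fourier_transformable mu <->
     tempered mu /\
     exists nu, is_tempered_fourier_transform mu nu /\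
       exists m, is_distribution_of nu m /\ translation_bounded m) /\
  (forall muhat nu m,
     is_fourier_transform mu muhat ->
     is_tempered_fourier_transform mu nu ->
     is_distribution_of nu m ->
     same_measure muhat m).
Proof.
split; last by move=> muhat nu m; exact: transform_unique.
split=> [[om tr]|[_ [nu [tr [m [dm tb]]]]]].
  have [nu [tnu H]] := transformable_tempered hmu tr; split; last by exists nu.
  by have [_ [T [tT TE _]]] := tnu; exists T.
by exists m; exact: tempered_transformable tr dm tb.
Qed.
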